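(* Let $\mathbf K=\mathbf H$ (with $r=2$) or $\mathbf K=\mathbf O$ (with $r=3$), and let $U$ be a domain in $\mathbf K^n$ satisfying the standing domain condition (D). Let $\mathcal F$ be a family of functions $f(z)=g'(z).1$ holomorphic on $U$ such that both each $f\in\mathcal F$ and the corresponding function $g$ satisfy the condition: (i) for each $j=1,\dots,n$ and at each $z\in U$ the function is either pseudoconformal by the variable ${}_jz$ or its partial derivative by ${}_jz$ is zero. If no $f\in\mathcal F$ takes any value from the set $\{0,1,i_1,i_2,\dots,i_{2^r-2}\}$, then $\mathcal F$ is a normal family in $U$.
   Context: Notation. $\mathbf K$ is the quaternion skew field $\mathbf H$ ($r=2$) or the octonion algebra $\mathbf O$ ($r=3$), with standard generators $i_0=1,i_1,\dots,i_{2^r-1}$; $\tilde z=z^*$ is the conjugate, $|z|^2=z\tilde z$, $\mathrm{Re}(z)=(z+\tilde z)/2$. A domain is an open connected set. Functions of $z$ are represented by phrases (finite or convergent infinite sums of bracketed words in $z$, $\tilde z$ and constants of $\mathbf K$); $\partial f/\partial z$ and $\partial f/\partial\tilde z$ are the partial (super)derivatives, $\mathbf R$-linear operators whose sum is the Fréchet derivative. $f$ is holomorphic if it is differentiable with $\partial f/\partial\tilde z=0$ (by each variable); such $f$ is locally given by convergent power series in $z-z_0$ with coefficients in $\mathbf K$ interlaced between powers (with prescribed brackets), and $f'(z)=\partial f/\partial z$. The expression $g'(z).1$ is the value of the operator $g'(z)$ on the unit ($1\in\mathbf K$ for $n=1$, the vector $(1,\dots,1)\in\mathbf K^n$ in general).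 Pseudoconformal. A differentiable $f:U\to\mathbf K$, $U$ open in $\mathbf K$, is pseudoconformal at $\xi$ if (1) $\partial f(z)/\partial\tilde z=0$ at $z=\xi$; (2) $\mathrm{Re}\{[f'(\xi).h_1][f'(\xi).h_2]^*\}|h_1||h_2|=|f'(\xi).h_1||f'(\xi).h_2|\,\mathrm{Re}(h_1\tilde h_2)$ for all $h_1,h_2\in\mathbf K$; (3) $f'(\xi)\neq0$; where nonproper rotations of the underlying space $\mathbf R^{2^r}$ associated with $f'$ are excluded. Pseudoconformal by ${}_jz$ means this holds for $f$ as a function of ${}_jz$, where $z=({}_1z,\dots,{}_nz)\in\mathbf K^n$. Domain condition (D). For a subset $W\subset\mathbf K$ and distinct generators $s,p$, let $\mathbf C_{s,p}=\{as+bp:a,b\in\mathbf R\}$, let $\mathbf K_{r,s,p}$ be the set of $z\in\mathbf K$ whose coordinates along $s$ and $p$ vanish, and for $t\in\mathbf K_{r,s,p}$ let $\pi_{s,p,t}(W)=\{u\in\mathbf C_{s,p}:u+t\in W\}$. Condition (D) on $U\subset\mathbf K^n$: each coordinate projection $U_j=\{{}_jz:z\in U\}$ is $(2^r-1)$-connected (arcwise connected with trivial homotopy groups $\pi_k$ for $1\le k\le 2^r-1$), and $\pi_{s,p,t}(U_j)$ is simply connected in $\mathbf C$ for each $k=0,1,\dots,2^{r-1}-1$, $s=i_{2k}$, $p=i_{2k+1}$, $t\in\mathbf K_{r,s,p}$ and $u\in\mathbf C_{s,p}$ for which there exists $z=u+t\in U_j$. Normal family. For $V=\mathrm{cl}(\mathrm{Int}(V))$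 closed bounded let $\rho_V(f,g)=\max_{z\in V}\big[|f(z)-g(z)|+\max_{|h|=1}|f'(z).h-g'(z).h|\big]$. A family $\mathcal F$ on $U$ is normal if each $f\in\mathcal F$ is holomorphic, at each $\xi\in U$ by each ${}_jz$ either pseudoconformal or with $\partial f/\partial\,{}_jz=0$, and for each infinite sequence in $\mathcal F$ and each closed bounded $V=\mathrm{cl}(\mathrm{Int}(V))\subset U$ there is a subsequence converging uniformly relative to $\rho_V$ to some limit function, which may also be a finite or infinite constant. *)

(* Defs.v *)
From HB Require Import structures.
From mathcomp Require Import all_boot all_order all_algebra.
From mathcomp Require Import all_classical all_reals all_analysis.
Set Implicit Arguments.
Unset Strict Implicit.
Unset Printing Implicit Defensive.
Import Order.TTheory GRing.Theory Num.Theory.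
Import numFieldNormedType.Exports.
Local Open Scope classical_set_scope.
Local Open Scope ring_scope.

(* The Cayley-Dickson algebra of real dimension 2^r (r = 2: quaternions,
   r = 3: octonions) is carried by row vectors of real coordinates along
   i_0 = 1, i_1, ..., i_(2^r - 1).  A point of its n-th power is the n x 2^r
   matrix whose j-th row is the j-th coordinate; hence K^1 is K itself. *)
Notation cdalg R r := 'rV[R]_(2 ^ r).
Notation cdspace R r n := 'M[R]_(n, 2 ^ r).

Section CayleyDickson.
Variable R : realType.

Lemma cd_dim r : (2 ^ r.+1 = 2 ^ r + 2 ^ r)%N.
Proof. by rewrite expnS mul2n addnn. Qed.

Lemma cd_pos r : (0 < 2 ^ r)%N. Proof. by rewrite expn_gt0. Qed.

Definition cdpair r (a b : cdalg R r) : cdalg R r.+1 :=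
  castmx (erefl, esym (cd_dim r)) (row_mx a b).
Definition cdfst r (x : cdalg R r.+1) : cdalg R r :=
  lsubmx (castmx (erefl, cd_dim r) x).
Definition cdsnd r (x : cdalg R r.+1) : cdalg R r :=
  rsubmx (castmx (erefl, cd_dim r) x).

Definition cdconj r (x : cdalg R r) : cdalg R r :=
  \row_k (if (k : nat) == 0%N then x 0 k else - x 0 k).

(* Doubling, with x = a + b l written (a, b):
   (a + b l) (c + d l) = (a c - d~ b) + (d a + b c~) l. *)
Fixpoint cdmul r : cdalg R r -> cdalg R r -> cdalg R r :=
  match r with
  | 0 => fun x y => \row_k (x 0 k * y 0 k)
  | r'.+1 => fun x y =>
      cdpair (cdmul (cdfst x) (cdfst y) - cdmul (cdconj (cdsnd y)) (cdsnd x))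
             (cdmul (cdsnd y) (cdfst x) + cdmul (cdsnd x) (cdconj (cdfst y)))
  end.

Definition cdgen r (k : nat) : cdalg R r := \row_j ((j : nat) == k)%:R.

Definition cdRe r (x : cdalg R r) : R := x 0 (Ordinal (cd_pos r)).

Definition cdabs r (x : cdalg R r) : R := Num.sqrt (cdRe (cdmul x (cdconj x))).

Definition cdinv r (x : cdalg R r) : cdalg R r :=
  (cdabs x ^+ 2)^-1 *: cdconj x.

Definition cdnorm r n (h : cdspace R r n) : R :=
  Num.sqrt (\sum_(j < n) cdabs (row j h) ^+ 2).

Definition cdones r n : cdspace R r n := \matrix_(j < n) cdgen r 0.

(* z with its j-th coordinate replaced by w. *)
Definition setrow r n (j : 'I_n) (z : cdspace R r n) (w : cdalg R r) :
    cdspace R r n :=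
  \matrix_(i, k) (if i == j then w 0 k else z i k).

Definition slice r n (f : cdspace R r n -> cdalg R r) (j : 'I_n)
    (z : cdspace R r n) : cdalg R r -> cdalg R r :=
  fun w => f (setrow j z w).

End CayleyDickson.

(* A word is a bracketed product of constants, variables z_j and conjugate
   variables z~_j.  The letters z_j and z~_j are independent: z~_j is also the
   value of a word combination in z_j alone, so the operators d/dz_j and
   d/dz~_j are defined on words and phrases, not on their values. *)
Inductive word (R : realType) (r n : nat) : Type :=
| WConst of cdalg R r
| WVar of 'I_n
| WConj of 'I_n
| WMul of word R r n & word R r n.

Section Phrases.
Variables (R : realType) (r n : nat).
Implicit Types (w : word R r n) (z : cdspace R r n) (h : cdalg R r)
  (j : 'I_n).

Fixpoint weval w z : cdalg R r :=
  match w with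
  | WConst a => a
  | WVar i => row i z
  | WConj i => cdconj (row i z)
  | WMul u v => cdmul (weval u z) (weval v z)
  end.

Fixpoint wdz j w z h : cdalg R r :=
  match w with
  | WConst _ => 0
  | WVar i => if i == j then h else 0
  | WConj _ => 0
  | WMul u v => cdmul (wdz j u z h) (weval v z) + cdmul (weval u z) (wdz j v z h)
  end.

(* wdz + wdzbar is the Frechet differential of the word in the j-th variable. *)
Fixpoint wdzbar j w z h : cdalg R r :=
  match w with
  | WConst _ => 0
  | WVar _ => 0
  | WConj i => if i == j then cdconj h else 0
  | WMul u v =>
      cdmul (wdzbar j u z h) (weval v z) + cdmul (weval u z) (wdzbar j v z h)
  end.

(* The maximum of |w| over the closed polydisc of radius rho at 0, since the
   absolute value of H and O is multiplicative. *)
Fixpoint wmaj w (rho : R) : R :=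
  match w with
  | WConst a => cdabs a
  | WVar _ => rho
  | WConj _ => rho
  | WMul u v => wmaj u rho * wmaj v rho
  end.

(* The formal sum of the words phi 0, phi 1, ...  (finite sums are padded with
   WConst 0), to be evaluated at z - z0 for a centre z0. *)
Definition phrase := nat -> word R r n.

Definition polydisc (z0 : cdspace R r n) (rho : R) : set (cdspace R r n) :=
  [set z | forall j, cdabs (row j (z - z0)) < rho].

(* f is the sum of the normally convergent phrase phi in z - z0 on the
   polydisc of radius rho at z0. *)
Definition represents (phi : phrase) (f : cdspace R r n -> cdalg R r)
    (z0 : cdspace R r n) (rho : R) : Prop :=
  [/\ 0 < rho,
      cvgn (series (fun k => wmaj (phi k) rho)) &
      forall z, polydisc z0 rho z ->
        series (fun k => weval (phi k) (z - z0)) @ \oo --> f z].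

Definition phrase_dz_is (phi : phrase) j (z0 z : cdspace R r n)
    (L : cdalg R r -> cdalg R r) : Prop :=
  forall h, series (fun k => wdz j (phi k) (z - z0) h) @ \oo --> L h.

Definition phrase_dzbar_is (phi : phrase) j (z0 z : cdspace R r n)
    (L : cdalg R r -> cdalg R r) : Prop :=
  forall h, series (fun k => wdzbar j (phi k) (z - z0) h) @ \oo --> L h.

(* L is d f / d z_j at z0, where d f / d z~_j vanishes.  It then agrees with the
   Frechet derivative in the j-th variable, whatever phrase represents f. *)
Definition superpartial (f : cdspace R r n -> cdalg R r) j
    (z0 : cdspace R r n) (L : cdalg R r -> cdalg R r) : Prop :=
  exists (phi : phrase) (rho : R),
    [/\ represents phi f z0 rho,
        phrase_dzbar_is phi j z0 z0 (fun=> 0) &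
        phrase_dz_is phi j z0 z0 L].

(* L is the operator f'(z0), of value the sum of the (d f / d z_j).h_j. *)
Definition superderivative (f : cdspace R r n -> cdalg R r)
    (z0 : cdspace R r n) (L : cdspace R r n -> cdalg R r) : Prop :=
  exists2 Lj : 'I_n -> cdalg R r -> cdalg R r,
    forall j, superpartial f j z0 (Lj j) &
    forall h : cdspace R r n, L h = \sum_(j < n) Lj j (row j h).

(* A function is holomorphic when some phrases without d/dz~_j represent it
   around each point. *)
Definition holomorphic (U : set (cdspace R r n))
    (f : cdspace R r n -> cdalg R r) : Prop :=
  forall z0, U z0 -> differentiable f z0 /\
    exists (phi : phrase) (rho : R), represents phi f z0 rho /\
      forall z, polydisc z0 rho z ->
        forall j, phrase_dzbar_is phi j z0 z (fun=> 0).

End Phrases.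

Section Pseudoconformal.
Variables (R : realType) (r : nat).

(* A nonzero linear map satisfying the angle condition is a similarity; it
   involves no nonproper rotation exactly when its determinant is positive. *)
Definition pseudoconformal (f : cdalg R r -> cdalg R r) (xi : cdalg R r) :
    Prop :=
  differentiable f xi /\
  exists L : {linear cdalg R r -> cdalg R r},
    [/\ superpartial (n := 1) f 0 xi L,
        forall h1 h2 : cdalg R r,
          cdRe (cdmul (L h1) (cdconj (L h2))) * (cdabs h1 * cdabs h2)
          = cdabs (L h1) * cdabs (L h2) * cdRe (cdmul h1 (cdconj h2)),
        exists h : cdalg R r, L h <> 0 &
        0 < \det (lin1_mx L)].

Definition pseudoconformal_by n (j : 'I_n) (f : cdspace R r n -> cdalg R r)
    (z : cdspace R r n) : Prop :=
  pseudoconformal (slice f j z) (row j z).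

Definition pseudoconformal_or_zero n (U : set (cdspace R r n))
    (f : cdspace R r n -> cdalg R r) : Prop :=
  forall (j : 'I_n) z, U z -> pseudoconformal_by j f z \/ superpartial f j z (fun=> 0).

End Pseudoconformal.

Section DomainCondition.
Variable R : realType.

Definition path_connected (T : topologicalType) (A : set T) : Prop :=
  forall x y, A x -> A y -> exists gamma : R -> T,
    [/\ {within `[0, 1]%classic, continuous gamma},
        gamma @` `[0, 1]%classic `<=` A, gamma 0 = x & gamma 1 = y].

Definition cube k : set 'rV[R]_k := [set t | forall i, 0 <= t 0 i <= 1].
Definition cube_boundary k : set 'rV[R]_k :=
  [set t | cube t /\ exists i, t 0 i = 0 \/ t 0 i = 1].

(* pi_k(A, x0) is trivial for every base point x0: each map
   (I^k, bd I^k) -> (A, x0) is homotopic to the constant one rel. bd I^k. *)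
Definition trivial_homotopy_group k (T : topologicalType) (A : set T) : Prop :=
  forall (x0 : T) (gamma : 'rV[R]_k -> T), A x0 ->
    {within @cube k, continuous gamma} ->
    gamma @` @cube k `<=` A ->
    (forall t, cube_boundary t -> gamma t = x0) ->
    exists H : R * 'rV[R]_k -> T,
      [/\ {within `[0, 1]%classic `*` @cube k, continuous H},
          H @` (`[0, 1]%classic `*` @cube k) `<=` A,
          forall t, cube t -> H (0, t) = gamma t,
          forall t, cube t -> H (1, t) = x0 &
          forall s t, s \in `[0, 1] -> cube_boundary t -> H (s, t) = x0].

Definition m_connected (m : nat) (T : topologicalType) (A : set T) : Prop :=
  path_connected A /\
  forall k, (1 <= k <= m)%N -> trivial_homotopy_group k A.

Definition simply_connected (T : topologicalType) (A : set T) : Prop :=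
  m_connected 1 A.

Variables r n : nat.

Definition coord_proj (U : set (cdspace R r n)) (j : 'I_n) :
    set (cdalg R r) := [set row j z | z in U].

(* C_{s,p} and K_{r,s,p} for s = i_a, p = i_b. *)
Definition cdplane (a b : nat) : set (cdalg R r) :=
  [set u | exists x y : R, u = x *: cdgen R r a + y *: cdgen R r b].
Definition cdcoplane (a b : nat) : set (cdalg R r) :=
  [set t | forall k : 'I_(2 ^ r), (k : nat) = a \/ (k : nat) = b -> t 0 k = 0].

Definition plane_section (a b : nat) (t : cdalg R r) (W : set (cdalg R r)) :
    set (cdalg R r) := [set u | cdplane a b u /\ W (u + t)].

Definition domain_condition (U : set (cdspace R r n)) : Prop :=
  forall j : 'I_n,
    m_connected (2 ^ r - 1)%N (coord_proj U j) /\
    forall k, (k < 2 ^ r.-1)%N ->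
      forall t u, cdcoplane k.*2 k.*2.+1 t -> cdplane k.*2 k.*2.+1 u ->
        coord_proj U j (u + t) ->
        simply_connected (plane_section k.*2 k.*2.+1 t (coord_proj U j)).

End DomainCondition.

Section Normality.
Variables (R : realType) (r n : nat).
Local Notation func := (cdspace R r n -> cdalg R r).

(* The maxima are suprema in the extended reals, for nonempty V.  For a
   holomorphic f the superderivative f'(z) is the Frechet derivative 'd f z,
   which also makes sense for a limit function. *)
Definition rho_dist (V : set (cdspace R r n)) (f g : func) : \bar R :=
  ereal_sup [set ((cdabs (f z - g z)%R)%:E +
      ereal_sup [set (cdabs ('d f z h - 'd g z h)%R)%:E
                | h in [set h : cdspace R r n | (cdnorm h = 1)%R]])%E
    | z in V].

(* Uniform convergence to the infinite constant is convergence of 1/u_k to 0. *)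
Definition rho_cvg_infty (V : set (cdspace R r n)) (u : nat -> func) : Prop :=
  (\forall k \near \oo, forall z, V z -> u k z <> 0) /\
  rho_dist V (fun z => cdinv (u k z)) (fun=> 0) @[k --> \oo] --> 0%E.

(* For rho_dist to make sense a limit function is differentiable on V; finite
   constants are among the functions l. *)
Definition rho_convergent (V : set (cdspace R r n)) (u : nat -> func) : Prop :=
  (exists2 l : func, forall z, V z -> differentiable l z &
     rho_dist V (u k) l @[k --> \oo] --> 0%E)
  \/ rho_cvg_infty V u.

Definition normal_family (U : set (cdspace R r n)) (F : set func) : Prop :=
  [/\ forall f, F f -> holomorphic U f,
      forall f, F f -> pseudoconformal_or_zero U f &
      forall (u : nat -> func) (V : set (cdspace R r n)),
        (forall k, F (u k)) ->
        V !=set0 -> closed V -> bounded_set V -> V = closure (interior V) ->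
        V `<=` U ->
        exists2 s : nat -> nat, {homo s : i k / (i < k)%N} &
          rho_convergent V (fun k => u (s k))].

End Normality.

(* Main.v *)
Require Import Defs.
From HB Require Import structures.
From mathcomp Require Import all_boot all_order all_algebra.
From mathcomp Require Import all_classical all_reals all_analysis.
From mathcomp Require Import ring lra zify.
Set Implicit Arguments.
Unset Strict Implicit.
Unset Printing Implicit Defensive.
Import Order.TTheory GRing.Theory Num.Theory.
Import numFieldNormedType.Exports.
Local Open Scope classical_set_scope.
Local Open Scope ring_scope.

(* Every f in F is real analytic and, in each variable, its derivative preserves
   orthogonality: a similarity where f is pseudoconformal, zero elsewhere.  The
   algebra has real dimension at least 3, so by Liouville's theorem each slice
   is constant or a Moebius map: differentiating the conformality relation
   twice, the Schwarzian derivative vanishes along every line, hence, for p the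
   inverse square root of the conformal factor, p and p * f are quadratic on
   every line.

   If such a slice has no zero and no pole in a ball of radius rho about z, then
   |f'(z)| <= 2 |f(z)| / rho.  This gives a Harnack inequality for |f| and
   uniform bounds for the Taylor remainders, one coordinate at a time.  Along a
   nonprincipal ultrafilter a sequence in F is therefore either locally bounded
   on all of U, and converges locally uniformly with its derivatives, or tends to
   infinity on all of U, and then so does its inverse to 0.  On a compact set the
   ultrafilter limit is the limit of a subsequence. *)

(** The pseudoconformality condition degenerates: a slice may be a similarity at some points and
    have zero derivative at others, and nothing separates these points beforehand. The Schwarzian
    equation does: where the conformal factor is positive, its inverse square root is a quadratic
    polynomial along a line, hence bounded on a segment, so the factor cannot fall to zero. On a
    ball in its domain, a slice is thus a Moebius map throughout or constant.

    Differentiating the conformality relation twice gives linear equations for the third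
    derivatives. Two orthonormal directions leave them underdetermined; a third one fixes them.

    The omitted value 0 acts through the position of the zero of a Moebius map: if the value at the
    centre is small compared with derivative times radius, and the pole is outside the ball, then
    the zero is inside.

    The bounds concern one coordinate at a time and leave mixed second derivatives uncontrolled.
    Differentials at two points are therefore compared through increments of [f] of a well chosen
    length. An ultrafilter gives limits at all points of [U] at once, so no diagonal extraction over
    a dense set is needed. *)

(** * Euclidean norm *)

Section Dot.
Variables (R : realType) (m : nat).
Implicit Types (x y u v : 'rV[R]_m) (a : R).

Definition dot x y : R := \sum_k x 0 k * y 0 k.

Lemma dotC x y : dot x y = dot y x.
Proof. by apply: eq_bigr => k _; rewrite mulrC. Qed.

Lemma dotDl x y u : dot (x + y) u = dot x u + dot y u.
Proof. by rewrite -big_split; apply: eq_bigr => k _; rewrite mxE mulrDl. Qed.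

Lemma dotDr x y u : dot u (x + y) = dot u x + dot u y.
Proof. by rewrite dotC dotDl !(dotC u). Qed.

Lemma dotZl a x u : dot (a *: x) u = a * dot x u.
Proof. by rewrite mulr_sumr; apply: eq_bigr => k _; rewrite mxE mulrA. Qed.

Lemma dotZr a x u : dot u (a *: x) = a * dot u x.
Proof. by rewrite dotC dotZl dotC. Qed.

Lemma dotNl x u : dot (- x) u = - dot x u.
Proof. by rewrite -scaleN1r dotZl mulN1r. Qed.

Lemma dotNr x u : dot u (- x) = - dot u x.
Proof. by rewrite dotC dotNl dotC. Qed.

Lemma dot0l u : dot 0 u = 0.
Proof. by rewrite -(scale0r 0) dotZl mul0r. Qed.

Lemma dot0r u : dot u 0 = 0.
Proof. by rewrite dotC dot0l. Qed.

Definition dotE := (dotDl, dotDr, dotNl, dotNr, dotZl, dotZr, dot0l, dot0r).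

Lemma dot_ge0 x : 0 <= dot x x.
Proof. by apply: sumr_ge0 => k _; rewrite -expr2 sqr_ge0. Qed.

Lemma dot_coord_le x k : x 0 k ^+ 2 <= dot x x.
Proof.
rewrite /dot (bigD1 k)//= -expr2 lerDl.
by apply: sumr_ge0 => i _; rewrite -expr2 sqr_ge0.
Qed.

Lemma dot_eq0 x : dot x x = 0 -> x = 0.
Proof.
move=> x0; apply/rowP => k; rewrite mxE; apply/eqP.
by rewrite -sqrf_eq0 eq_le sqr_ge0 -x0 dot_coord_le.
Qed.

Lemma dot_gt0 x : x != 0 -> 0 < dot x x.
Proof.
by move=> x0; rewrite lt_def dot_ge0 andbT; apply: contra_neq x0; exact: dot_eq0.
Qed.

Definition len x : R := Num.sqrt (dot x x).

Lemma len_ge0 x : 0 <= len x. Proof. exact: sqrtr_ge0. Qed.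

Lemma len_sqr x : len x ^+ 2 = dot x x.
Proof. by rewrite sqr_sqrtr ?dot_ge0. Qed.

Lemma len0 : len 0 = 0. Proof. by rewrite /len dot0l sqrtr0. Qed.

Lemma len_gt0 x : x != 0 -> 0 < len x.
Proof. by move=> x0; rewrite sqrtr_gt0 dot_gt0. Qed.

Lemma lenZ a x : len (a *: x) = `|a| * len x.
Proof.
by rewrite /len !dotE mulrA -expr2 sqrtrM ?sqr_ge0// sqrtr_sqr.
Qed.

Lemma lenN x : len (- x) = len x.
Proof. by rewrite /len !dotE opprK. Qed.

Lemma lenB x y : len (x - y) = len (y - x).
Proof. by rewrite -lenN opprB. Qed.

Lemma cauchy_schwarz x y : `|dot x y| <= len x * len y.
Proof.
rewrite -ler_sqr ?nnegrE ?mulr_ge0 ?len_ge0 ?normr_ge0//.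
rewrite real_normK ?num_real// exprMn !len_sqr.
have [->|y0] := eqVneq y 0; first by rewrite !dotE expr0n mulr0.
have yy := dot_gt0 y0; have := dot_ge0 (dot y y *: x - dot x y *: y).
rewrite !dotE (dotC y x).
set p := dot x x; set q := dot x y; set s := dot y y in yy *.
move=> h; rewrite -subr_ge0 -(pmulr_rge0 _ yy).
by apply: le_trans h _; rewrite le_eqVlt; apply/orP; left; apply/eqP; ring.
Qed.

Lemma dot_le_len x y : dot x y <= len x * len y.
Proof. exact: le_trans (ler_norm _) (cauchy_schwarz _ _). Qed.

Lemma lenD x y : len (x + y) <= len x + len y.
Proof.
rewrite -ler_sqr ?nnegrE ?addr_ge0 ?len_ge0// sqrrD !len_sqr !dotE (dotC y x).
have := dot_le_len x y; lra.
Qed.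

Lemma lenD_le x y a b : len x <= a -> len y <= b -> len (x + y) <= a + b.
Proof. by move=> xa yb; exact: le_trans (lenD _ _) (lerD xa yb). Qed.

Lemma len_coord x k : `|x 0 k| <= len x.
Proof.
rewrite -ler_sqr ?nnegrE ?len_ge0 ?normr_ge0// len_sqr real_normK ?num_real//.
exact: dot_coord_le.
Qed.

Lemma norm_le_len x : `|x| <= len x.
Proof.
rewrite [leLHS]/Num.norm/= mx_normrE; apply/bigmax_leP; split; first exact: len_ge0.
by move=> [i j] _ /=; rewrite ord1 len_coord.
Qed.

Lemma coord_le_norm (p q : nat) (A : 'M[R]_(p, q)) i j : `|A i j| <= `|A|.
Proof.
rewrite [leRHS]/Num.norm/= mx_normrE.
by apply/bigmax_geP; right; exists (i, j).
Qed.

(** The crude factor [m.+1] is positive even when [m] is 0, so errors can be divided by it. *)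
Lemma len_le_norm x : len x <= m.+1%:R * `|x|.
Proof.
rewrite -ler_sqr ?nnegrE ?mulr_ge0 ?len_ge0 ?normr_ge0// len_sqr exprMn.
apply: (@le_trans _ _ (\sum_(k < m) `|x| ^+ 2)).
  apply: ler_sum => k _; rewrite -expr2 -real_normK ?num_real//.
  by rewrite ler_sqr ?nnegrE ?normr_ge0// coord_le_norm.
rewrite sumr_const card_ord -[leLHS]mulr_natl; apply: ler_wpM2r.
  exact: sqr_ge0.
by rewrite expr2 -natrM ler_nat; nia.
Qed.

End Dot.

(** * Multiplicativity of the norm *)

Section CayleyDicksonTheory.
Variable R : realType.

Lemma cdfst_pair r (a b : cdalg R r) : cdfst (cdpair a b) = a.
Proof. by rewrite /cdfst /cdpair castmx_comp castmx_id row_mxKl. Qed.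

Lemma cdsnd_pair r (a b : cdalg R r) : cdsnd (cdpair a b) = b.
Proof. by rewrite /cdsnd /cdpair castmx_comp castmx_id row_mxKr. Qed.

Lemma cdpair_fst_snd r (x : cdalg R r.+1) : cdpair (cdfst x) (cdsnd x) = x.
Proof. by rewrite /cdpair /cdfst /cdsnd hsubmxK castmx_comp castmx_id. Qed.

Lemma cdpair_ind r (P : cdalg R r.+1 -> Prop) :
  (forall a b, P (cdpair a b)) -> forall x, P x.
Proof. by move=> Pab x; rewrite -(cdpair_fst_snd x). Qed.

Lemma cdpair_lin r s (a b c d : cdalg R r) :
  s *: cdpair a b + cdpair c d = cdpair (s *: a + c) (s *: b + d).
Proof.
rewrite /cdpair; apply/rowP => k; rewrite !(mxE, castmxE)/=.
by case: splitP => j _; rewrite !mxE.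
Qed.

Lemma cdpairD r (a b c d : cdalg R r) :
  cdpair a b + cdpair c d = cdpair (a + c) (b + d).
Proof. by have := cdpair_lin 1 a b c d; rewrite !scale1r. Qed.

Lemma cdpair0 r : cdpair 0 0 = 0 :> cdalg R r.+1.
Proof. by apply: (@addrI _ (cdpair 0 0)); rewrite cdpairD !addr0. Qed.

Lemma cdpairZ r s (a b : cdalg R r) : s *: cdpair a b = cdpair (s *: a) (s *: b).
Proof. by have := cdpair_lin s a b 0 0; rewrite cdpair0 !addr0. Qed.

Lemma cdpairN r (a b : cdalg R r) : - cdpair a b = cdpair (- a) (- b).
Proof. by rewrite -scaleN1r cdpairZ !scaleN1r. Qed.

Lemma dot_pair r (a b c d : cdalg R r) :
  dot (cdpair a b) (cdpair c d) = dot a c + dot b d.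
Proof.
rewrite /dot (reindex_onto (cast_ord (esym (cd_dim r))) (cast_ord (cd_dim r)))/=;
  last by move=> i _; rewrite cast_ordK.
rewrite (eq_bigl xpredT); last by move=> i; rewrite cast_ordKV eqxx.
rewrite big_split_ord; congr (_ + _); apply: eq_bigr => i _;
  rewrite !castmxE/= !cast_ord_comp !cast_ord_id.
- by rewrite !row_mxEl.
- by rewrite !row_mxEr.
Qed.

Lemma cdRe_pair r (a b : cdalg R r) : cdRe (cdpair a b) = cdRe a.
Proof.
rewrite /cdRe /cdpair castmxE !mxE/= !(ord1 (cast_ord _ _)).
case: splitP => j /= j0; last by move: (cd_pos r); lia.
by congr (a _ _); apply: val_inj.
Qed.

Lemma cdconj_pair r (a b : cdalg R r) :
  cdconj (cdpair a b) = cdpair (cdconj a) (- b).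
Proof.
apply/rowP => k; rewrite /cdpair !(mxE, castmxE)/= !(ord1 (cast_ord _ _)).
case: splitP => j /= kj; rewrite !mxE kj//.
by rewrite ifN//; move: (cd_pos r); lia.
Qed.

Lemma cdconjK r (x : cdalg R r) : cdconj (cdconj x) = x.
Proof. by apply/rowP => k; rewrite !mxE; case: eqP => // _; rewrite opprK. Qed.

Lemma cdconj_lin r s (x y : cdalg R r) :
  cdconj (s *: x + y) = s *: cdconj x + cdconj y.
Proof. by apply/rowP => k; rewrite !mxE; case: ifP => // _; rewrite opprD mulrN. Qed.

Lemma cdconj0 r : cdconj 0 = 0 :> cdalg R r.
Proof. by apply/rowP => k; rewrite !mxE oppr0 if_same. Qed.

Lemma cdconjD r (x y : cdalg R r) : cdconj (x + y) = cdconj x + cdconj y.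
Proof. by have := cdconj_lin 1 x y; rewrite !scale1r. Qed.

Lemma cdconjZ r s (x : cdalg R r) : cdconj (s *: x) = s *: cdconj x.
Proof. by have := cdconj_lin s x 0; rewrite cdconj0 !addr0. Qed.

Lemma dot_conj r (x y : cdalg R r) : dot (cdconj x) (cdconj y) = dot x y.
Proof.
by apply: eq_bigr => k _; rewrite !mxE; case: ifP => // _; rewrite mulrNN.
Qed.

Lemma cdmul_pair r (a b c d : cdalg R r) :
  cdmul (cdpair a b) (cdpair c d) =
  cdpair (cdmul a c - cdmul (cdconj d) b) (cdmul d a + cdmul b (cdconj c)).
Proof. by rewrite /= !cdfst_pair !cdsnd_pair. Qed.

(** Both linearities are proved together: the doubling formula contains products with the factors
    exchanged, so each one at level [r.+1] needs the other at level [r]. *)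
Lemma cdmul_linl r s (x x' y : cdalg R r) :
  cdmul (s *: x + x') y = s *: cdmul x y + cdmul x' y
with cdmul_linr r s (x y y' : cdalg R r) :
  cdmul x (s *: y + y') = s *: cdmul x y + cdmul x y'.
Proof.
- case: r x x' y => [|r]; first by move=> x x' y; apply/rowP => k; rewrite !mxE; ring.
  elim/cdpair_ind => a b; elim/cdpair_ind => c d; elim/cdpair_ind => e f.
  rewrite cdpair_lin !cdmul_pair cdpair_lin; congr cdpair.
    by rewrite cdmul_linl cdmul_linr; apply/rowP => k; rewrite !mxE; ring.
  by rewrite cdmul_linl cdmul_linr; apply/rowP => k; rewrite !mxE; ring.
- case: r x y y' => [|r]; first by move=> x x' y; apply/rowP => k; rewrite !mxE; ring.
  elim/cdpair_ind => a b; elim/cdpair_ind => c d; elim/cdpair_ind => e f.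
  rewrite cdpair_lin !cdmul_pair cdpair_lin !cdconj_lin; congr cdpair.
    by rewrite cdmul_linl cdmul_linr; apply/rowP => k; rewrite !mxE; ring.
  by rewrite cdmul_linl cdmul_linr; apply/rowP => k; rewrite !mxE; ring.
Qed.

Lemma cdmulDl r (x x' y : cdalg R r) : cdmul (x + x') y = cdmul x y + cdmul x' y.
Proof. by have := cdmul_linl 1 x x' y; rewrite !scale1r. Qed.

Lemma cdmulDr r (x y y' : cdalg R r) : cdmul x (y + y') = cdmul x y + cdmul x y'.
Proof. by have := cdmul_linr 1 x y y'; rewrite !scale1r. Qed.

Lemma cdmul0l r (y : cdalg R r) : cdmul 0 y = 0.
Proof. by apply: (@addrI _ (cdmul 0 y)); rewrite -cdmulDl !addr0. Qed.

Lemma cdmulZl r s (x y : cdalg R r) : cdmul (s *: x) y = s *: cdmul x y.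
Proof. by have := cdmul_linl s x 0 y; rewrite cdmul0l !addr0. Qed.

Lemma cdReD r (x y : cdalg R r) : cdRe (x + y) = cdRe x + cdRe y.
Proof. by rewrite /cdRe mxE. Qed.

Lemma cdReN r (x : cdalg R r) : cdRe (- x) = - cdRe x.
Proof. by rewrite /cdRe mxE. Qed.

(** This turns [cdabs] and the angle condition into purely Euclidean notions. *)
Lemma cdRe_mul_conj r (x y : cdalg R r) : cdRe (cdmul x (cdconj y)) = dot x y.
Proof.
elim: r x y => [x y|r IH].
  by rewrite /cdRe /= !mxE/= /dot big_ord1 (_ : Ordinal _ = ord0)//; exact: val_inj.
elim/cdpair_ind => a b; elim/cdpair_ind => c d.
rewrite cdconj_pair cdmul_pair cdRe_pair dot_pair cdReD cdReN IH.
have -> : cdmul (cdconj (- d)) b = - cdmul (cdconj d) (cdconj (cdconj b)).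
  by rewrite cdconjK -scaleN1r cdconjZ cdmulZl scaleN1r.
by rewrite cdReN IH dot_conj opprK (dotC d).
Qed.

Lemma cdabsE r (x : cdalg R r) : cdabs x = len x.
Proof. by rewrite /cdabs cdRe_mul_conj. Qed.

(* Writing a quaternion as a pair of pairs of scalars reduces identities to real
   polynomial identities. *)
Definition cdscalar (s : R) : cdalg R 0 := const_mx s.

Lemma cdscalarE (x : cdalg R 0) : x = cdscalar (x 0 0).
Proof. by apply/rowP => -[[|i] Hi]//; rewrite mxE; congr (x _ _); apply: val_inj. Qed.

Lemma cdscalar_ind (P : cdalg R 0 -> Prop) :
  (forall s, P (cdscalar s)) -> forall x, P x.
Proof. by move=> Ps x; rewrite (cdscalarE x). Qed.

Lemma cdscalarD s t : cdscalar s + cdscalar t = cdscalar (s + t).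
Proof. by apply/rowP => k; rewrite !mxE. Qed.

Lemma cdscalarN s : - cdscalar s = cdscalar (- s).
Proof. by apply/rowP => k; rewrite !mxE. Qed.

Lemma cdscalarM s t : cdmul (cdscalar s) (cdscalar t) = cdscalar (s * t).
Proof. by apply/rowP => k; rewrite !mxE. Qed.

Lemma cdconj_scalar s : cdconj (cdscalar s) = cdscalar s.
Proof. by apply/rowP => -[[|i] Hi]//; rewrite !mxE. Qed.

Lemma dot_scalar s t : dot (cdscalar s) (cdscalar t) = s * t.
Proof. by rewrite /dot big_ord1 !mxE. Qed.

Definition cd_coord := (cdmul_pair, cdpairD, cdpairN, cdconj_pair, dot_pair,
  cdscalarD, cdscalarN, cdscalarM, cdconj_scalar, dot_scalar).

(* The two cross terms of |(a + b l)(c + d l)|^2 cancel. *)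
Lemma dot_cross r (a b c d : cdalg R r) : (r <= 2)%N ->
  dot (cdmul a c) (cdmul (cdconj d) b) = dot (cdmul d a) (cdmul b (cdconj c)).
Proof.
case: r a b c d => [|[|[|r]]] a b c d r2; last by exfalso; lia.
- elim/cdscalar_ind: a => a; elim/cdscalar_ind: b => b.
  elim/cdscalar_ind: c => c; elim/cdscalar_ind: d => d.
  by rewrite !cd_coord; ring.
- elim/cdpair_ind: a => a a'; elim/cdpair_ind: b => b b'.
  elim/cdpair_ind: c => c c'; elim/cdpair_ind: d => d d'.
  elim/cdscalar_ind: a => a; elim/cdscalar_ind: b => b.
  elim/cdscalar_ind: c => c; elim/cdscalar_ind: d => d.
  elim/cdscalar_ind: a' => a'; elim/cdscalar_ind: b' => b'.
  elim/cdscalar_ind: c' => c'; elim/cdscalar_ind: d' => d'.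
  by rewrite !cd_coord; ring.
- elim/cdpair_ind: a => a2 a3; elim/cdpair_ind: b => b2 b3.
  elim/cdpair_ind: c => c2 c3; elim/cdpair_ind: d => d2 d3.
  elim/cdpair_ind: a2 => a a'; elim/cdpair_ind: b2 => b b'.
  elim/cdpair_ind: c2 => c c'; elim/cdpair_ind: d2 => d d'.
  elim/cdpair_ind: a3 => e e'; elim/cdpair_ind: b3 => f f'.
  elim/cdpair_ind: c3 => g g'; elim/cdpair_ind: d3 => h h'.
  elim/cdscalar_ind: a => a; elim/cdscalar_ind: b => b.
  elim/cdscalar_ind: c => c; elim/cdscalar_ind: d => d.
  elim/cdscalar_ind: a' => a'; elim/cdscalar_ind: b' => b'.
  elim/cdscalar_ind: c' => c'; elim/cdscalar_ind: d' => d'.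
  elim/cdscalar_ind: e => e; elim/cdscalar_ind: f => f.
  elim/cdscalar_ind: g => g; elim/cdscalar_ind: h => h.
  elim/cdscalar_ind: e' => e'; elim/cdscalar_ind: f' => f'.
  elim/cdscalar_ind: g' => g'; elim/cdscalar_ind: h' => h'.
  by rewrite !cd_coord; ring.
Qed.

(** Multiplicativity passes from level [r] to [r.+1] as long as the cross terms cancel, that is for
    [r <= 2]. It stops at the octonions: sedenions have zero divisors. *)
Lemma dot_mul r (x y : cdalg R r) : (r <= 3)%N ->
  dot (cdmul x y) (cdmul x y) = dot x x * dot y y.
Proof.
elim: r x y => [x y _|r IH].
  by elim/cdscalar_ind: x => s; elim/cdscalar_ind: y => t; rewrite !cd_coord; ring.
elim/cdpair_ind => a b; elim/cdpair_ind => c d r3.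
rewrite cdmul_pair !dot_pair !dotE !IH ?dot_conj; try lia.
rewrite (dotC (cdmul (cdconj d) b) (cdmul a c)) (dotC (cdmul b _) (cdmul d a)).
rewrite dot_cross; last by lia.
by ring.
Qed.

Lemma len_mul r (x y : cdalg R r) : (r <= 3)%N ->
  len (cdmul x y) = len x * len y.
Proof. by move=> r3; rewrite /len dot_mul// sqrtrM ?dot_ge0. Qed.

Lemma len_conj r (x : cdalg R r) : len (cdconj x) = len x.
Proof. by rewrite /len dot_conj. Qed.

End CayleyDicksonTheory.

(** * Differentiation of phrases *)

(** Stated for any proper filter: it serves for partial sums, for difference quotients and for
    limits along an ultrafilter. *)
Lemma cvg_len_le (R : realType) m (T : Type) (G : set_system T) (g : T -> 'rV[R]_m)
    (l : 'rV[R]_m) (C : R) {PG : ProperFilter G} :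
  g @ G --> l -> (\forall k \near G, len (g k) <= C) -> len l <= C.
Proof.
move=> gl gC; apply/ler_addgt0Pr => e e0.
have e1 : 0 < e / m.+1%:R by rewrite divr_gt0.
have /filter_ex [k [gk lk]] : \forall k \near G,
    len (g k) <= C /\ `|l - g k| < e / m.+1%:R.
  near=> k; split; first by near: k.
  by near: k; move/cvgrPdist_lt : gl; exact.
have -> : l = g k + (l - g k) by rewrite addrC subrK.
apply: le_trans (lenD _ _) _; apply: lerD => //.
apply: le_trans (len_le_norm _) _.
by rewrite mulrC -ler_pdivlMr// ltW.
Unshelve. all: by end_near. Qed.

Lemma is_derive_quadratic (R : realType) (V W : normedModType R) (f : V -> W)
    (x v : V) (df : W) (C e : R) : 0 < e ->
  (forall t : R, `|t| <= e -> `|f (x + t *: v) - f x - t *: df| <= C * t ^+ 2) ->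
  is_derive x v f df.
Proof.
move=> e0 fC.
suff H : (fun h => h^-1 *: ((f \o shift x) (h *: v) - f x)) @ 0^' --> df.
  by split; [apply/cvg_ex; exists df | apply/cvg_lim].
apply/cvgrPdist_le => d d0.
have C1 : 0 < `|C| + 1 by rewrite ltr_wpDl.
near=> t.
have t0 : t != 0 by near: t; exact: nbhs_dnbhs_neq.
have te : `|t| <= e.
  near: t; apply: dnbhs0_le => //.
have td : `|t| <= d / (`|C| + 1).
  by near: t; apply: dnbhs0_le; rewrite divr_gt0.
rewrite distrC /=; have -> : t^-1 *: (f (t *: v + x) - f x) - df =
    t^-1 *: (f (x + t *: v) - f x - t *: df).
  by rewrite [in RHS]scalerBr scalerA mulVf// scale1r (addrC x).
rewrite normrZ normfV ler_pdivrMl ?normr_gt0//.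
apply: le_trans (fC _ te) _.
rewrite -[t ^+ 2]real_normK ?num_real// expr2 mulrCA mulrC.
rewrite [leRHS]mulrC ler_wpM2r//.
apply: le_trans (_ : `|C| * `|t| <= _); first by rewrite ler_wpM2r// ler_norm.
rewrite ler_pdivlMr// in td; apply: le_trans td.
by rewrite mulrDr mulr1 mulrC lerDl.
Unshelve. all: by end_near. Qed.

Section FormalExpressions.
Variables (R : realType) (r n : nat).
Hypothesis r3 : (r <= 3)%N.
Local Notation V := (cdspace R r n).
Local Notation K := (cdalg R r).

(** Words are not closed under differentiation, because the product rule yields sums. With [EAdd]
    the derivative of a term is again a term, so termwise differentiation can be iterated. *)
Inductive expr : Type :=
| EConst of K
| EVar of 'I_n
| EConj of 'I_n
| EMul of expr & expr
| EAdd of expr & expr.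

Fixpoint eeval p (z : V) : K :=
  match p with
  | EConst a => a
  | EVar i => row i z
  | EConj i => cdconj (row i z)
  | EMul p q => cdmul (eeval p z) (eeval q z)
  | EAdd p q => eeval p z + eeval q z
  end.

Fixpoint emaj p (rho : R) : R :=
  match p with
  | EConst a => len a
  | EVar i => rho
  | EConj i => rho
  | EMul p q => emaj p rho * emaj q rho
  | EAdd p q => emaj p rho + emaj q rho
  end.

Fixpoint ederiv (v : V) p : expr :=
  match p with
  | EConst a => EConst 0
  | EVar i => EConst (row i v)
  | EConj i => EConst (cdconj (row i v))
  | EMul p q => EAdd (EMul (ederiv v p) q) (EMul p (ederiv v q))
  | EAdd p q => EAdd (ederiv v p) (ederiv v q)
  end.

Definition bounded_rows (x : V) (a : R) := forall j, len (row j x) <= a.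

Lemma bounded_rowsD x y a b :
  bounded_rows x a -> bounded_rows y b -> bounded_rows (x + y) (a + b).
Proof.
by move=> xa yb j; rewrite linearD; apply: le_trans (lenD _ _) (lerD (xa j) (yb j)).
Qed.

Lemma bounded_rowsZ s x a : bounded_rows x a -> bounded_rows (s *: x) (`|s| * a).
Proof. by move=> xa j; rewrite linearZ/= lenZ ler_wpM2l. Qed.

Lemma bounded_rows_le x a b : a <= b -> bounded_rows x a -> bounded_rows x b.
Proof. by move=> ab xa j; exact: le_trans (xa j) ab. Qed.

Lemma bounded_rows0 a : 0 <= a -> bounded_rows 0 a.
Proof. by move=> a0 j; rewrite linear0 len0. Qed.

Lemma bounded_rows_norm x : bounded_rows x ((2 ^ r).+1%:R * `|x|).
Proof.
move=> j; apply: le_trans (len_le_norm _) _; rewrite ler_wpM2l//.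
rewrite [leLHS]/Num.norm/= mx_normrE; apply/bigmax_leP; split => // -[i k] _ /=.
by rewrite mxE coord_le_norm.
Qed.

Lemma emaj_ge0 p s : 0 <= s -> 0 <= emaj p s.
Proof.
by move=> s0; elim: p => //= *; rewrite ?len_ge0 ?mulr_ge0 ?addr_ge0.
Qed.

Lemma eeval_le p x s : 0 <= s -> bounded_rows x s -> len (eeval p x) <= emaj p s.
Proof.
move=> s0 xs; elim: p => //= [i|p Hp q Hq|p Hp q Hq].
- by rewrite len_conj.
- by rewrite len_mul// ler_pM ?len_ge0.
- exact: le_trans (lenD _ _) (lerD _ _).
Qed.

(* A1 and A2 play the part of the first-order term and of the remainder in the
   Taylor expansion of the majorant, whose coefficients are nonnegative. *)
Lemma ederiv_est p s t : 0 <= s -> s < t -> exists A1 A2 : R,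
  [/\ 0 <= A1, 0 <= A2, A1 + A2 + emaj p s <= emaj p t,
      forall v th, 0 <= th -> bounded_rows v (th * (t - s)) ->
        emaj (ederiv v p) s <= th * A1 &
      forall x v th, 0 <= th <= 1 -> bounded_rows x s ->
        bounded_rows v (th * (t - s)) ->
        len (eeval p (x + v) - eeval p x - eeval (ederiv v p) x) <= th ^+ 2 * A2].
Proof.
move=> s0 st; have ts : 0 <= t - s by rewrite subr_ge0 ltW.
elim: p => [a|i|i|p [A1 [A2 [A10 A20 A12 A1P A2P]]] q [B1 [B2 [B10 B20 B12 B1P B2P]]]
  |p [A1 [A2 [A10 A20 A12 A1P A2P]]] q [B1 [B2 [B10 B20 B12 B1P B2P]]]] /=.
- exists 0, 0; split => //; first by rewrite !add0r.
    by move=> v th th0 _; rewrite len0 mulr0.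
  by move=> x v th _ _ _; rewrite !subrr len0 mulr0.
- exists (t - s), 0; split => //; first by rewrite addr0 subrK.
  by move=> x v th _ _ _; rewrite linearD [_ + _ - row i x]addrC addKr subrr len0 mulr0.
- exists (t - s), 0; split => //; first by rewrite addr0 subrK.
    by move=> v th _ vs; rewrite len_conj.
  move=> x v th _ _ _; rewrite linearD cdconjD.
  by rewrite [_ + _ - cdconj (row i x)]addrC addKr subrr len0 mulr0.
- set a := emaj p s in A12 *; set b := emaj q s in B12 *.
  have a0 : 0 <= a by exact: emaj_ge0.
  have b0 : 0 <= b by exact: emaj_ge0.
  (* Expansion of [(a + A1 + A2) * (b + B1 + B2)] without [a * b]: first the terms of order one in
     [th], then all those of order at least two, which [th <= 1] brings down to order two. *)
  exists (A1 * b + a * B1), (A1 * B1 + A2 * b + a * B2 + A1 * B2 + A2 * B1 + A2 * B2).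
  split; rewrite ?addr_ge0 ?mulr_ge0//.
  + apply: le_trans (ler_pM _ _ A12 B12); rewrite ?addr_ge0//.
    by rewrite le_eqVlt; apply/orP; left; apply/eqP; ring.
  + move=> v th th0 vs; rewrite -/a -/b mulrDr; apply: lerD.
      by rewrite mulrA ler_wpM2r// A1P.
    by rewrite mulrCA ler_wpM2l// B1P.
  + move=> x v th /andP[th0 th1] xs vs.
    have th01 : 0 <= th <= 1 by rewrite th0.
    have := A2P x v th th01 xs vs; have := B2P x v th th01 xs vs.
    have : len (eeval (ederiv v p) x) <= th * A1.
      by apply: le_trans (A1P v th th0 vs); exact: eeval_le.
    have : len (eeval (ederiv v q) x) <= th * B1.
      by apply: le_trans (B1P v th th0 vs); exact: eeval_le.
    have : len (eeval p x) <= a by exact: eeval_le.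
    have : len (eeval q x) <= b by exact: eeval_le.
    set P := eeval p x; set Q := eeval q x.
    set dP := eeval (ederiv v p) x; set dQ := eeval (ederiv v q) x.
    set rP := eeval p (x + v) - P - dP; set rQ := eeval q (x + v) - Q - dQ.
    have addBB (u w c : K) : u = w + c + (u - w - c).
      by apply/rowP => k; rewrite !mxE; ring.
    have -> : eeval p (x + v) = P + dP + rP by exact: addBB.
    have -> : eeval q (x + v) = Q + dQ + rQ by exact: addBB.
    move=> Qb Pa dQb dPa rQb rPa.
    have -> : cdmul (P + dP + rP) (Q + dQ + rQ) - cdmul P Q -
        (cdmul dP Q + cdmul P dQ) =
      cdmul dP dQ + cdmul rP Q + cdmul P rQ + cdmul dP rQ + cdmul rP dQ + cdmul rP rQ.
      by rewrite !cdmulDl !cdmulDr; apply/rowP => k; rewrite !mxE; ring.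
    have lM (u w : K) (c d : R) : len u <= c -> len w <= d -> len (cdmul u w) <= c * d.
      by move=> uc wd; rewrite (len_mul _ _ r3) ler_pM ?len_ge0.
    have th2 c : 0 <= c -> th ^+ 2 * th * c <= th ^+ 2 * c.
      by move=> c0; rewrite -mulrA ler_wpM2l ?sqr_ge0// ler_piMl.
    have th4 c : 0 <= c -> th ^+ 2 * th ^+ 2 * c <= th ^+ 2 * c.
      by move=> c0; rewrite -mulrA ler_wpM2l ?sqr_ge0// ler_piMl// exprn_ile1.
    rewrite !mulrDr.
    do ?apply: lenD_le.
    * by apply: le_trans (lM _ _ _ _ dPa dQb) _; rewrite expr2 mulrACA.
    * by apply: le_trans (lM _ _ _ _ rPa Qb) _; rewrite mulrA.
    * by apply: le_trans (lM _ _ _ _ Pa rQb) _; rewrite mulrCA.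
    * apply: le_trans (lM _ _ _ _ dPa rQb) (le_trans _ (th2 _ _)); last exact: mulr_ge0.
      by rewrite mulrACA [th * _]mulrC.
    * apply: le_trans (lM _ _ _ _ rPa dQb) (le_trans _ (th2 _ _)); last exact: mulr_ge0.
      by rewrite mulrACA.
    * apply: le_trans (lM _ _ _ _ rPa rQb) (le_trans _ (th4 _ _)); last exact: mulr_ge0.
      by rewrite mulrACA.
- exists (A1 + B1), (A2 + B2); split; rewrite ?addr_ge0//.
  + apply: le_trans (lerD A12 B12).
    by rewrite le_eqVlt; apply/orP; left; apply/eqP; ring.
  + by move=> v th th0 vs; rewrite mulrDr lerD ?A1P ?B1P.
  + move=> x v th th01 xs vs; rewrite mulrDr.
    apply: le_trans (lerD (A2P x v th th01 xs vs) (B2P x v th th01 xs vs)).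
    apply: le_trans (lenD _ _); rewrite le_eqVlt; apply/orP; left; apply/eqP.
    by congr len; apply/rowP => k; rewrite !mxE; ring.
Qed.

Lemma ederiv_swap v w p z :
  eeval (ederiv v (ederiv w p)) z = eeval (ederiv w (ederiv v p)) z.
Proof.
elim: p => //= [p -> q ->|p -> q ->//].
by apply/rowP => k; rewrite !mxE; ring.
Qed.

Lemma ederiv_lin a v w p z :
  eeval (ederiv (a *: v + w) p) z = a *: eeval (ederiv v p) z + eeval (ederiv w p) z.
Proof.
elim: p => //= [?|i|i|p -> q ->|p -> q ->].
- by rewrite scaler0 addr0.
- by rewrite linearP.
- by rewrite linearP cdconj_lin.
- by rewrite cdmul_linl cdmul_linr; apply/rowP => k; rewrite !mxE; ring.
- by apply/rowP => k; rewrite !mxE; ring.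
Qed.

End FormalExpressions.

Lemma cvg_series_len (R : realType) m (u : nat -> 'rV[R]_m) (b : nat -> R) :
  (forall k, len (u k) <= b k) -> cvgn (series b) -> cvgn (series u).
Proof.
move=> ub cb; have : cvgn [normed series u].
  apply: series_le_cvg cb => k //=.
    exact: le_trans (len_ge0 _) (ub k).
  exact: le_trans (norm_le_len _) (ub k).
move=> /cauchy_cvgP/cauchy_seriesP u_ncvg.
apply/cauchy_cvgP/cauchy_seriesP => e /u_ncvg.
apply: filterS => k /=; rewrite ger0_norm ?sumr_ge0//.
by apply: le_lt_trans; apply: ler_norm_sum.
Qed.

Section Analytic.
Variables (R : realType) (r n : nat).
Hypothesis r3 : (r <= 3)%N.
Local Notation V := (cdspace R r n).
Local Notation K := (cdalg R r).
Implicit Types (f : V -> K) (P : nat -> expr R r n).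

Definition expands P f z0 rho :=
  [/\ 0 < rho, cvgn (series (fun k => emaj (P k) rho)) &
      forall x s, s < rho -> bounded_rows x s ->
        series (fun k => eeval (P k) x) @ \oo --> f (z0 + x)].

Lemma ederiv0 (p : expr R r n) z : eeval (ederiv 0 p) z = 0.
Proof.
have := ederiv_lin 1 0 0 p z; rewrite scaler0 addr0 scale1r => /eqP.
by rewrite -subr_eq subrr => /eqP.
Qed.

Lemma ederivZ a v (p : expr R r n) z :
  eeval (ederiv (a *: v) p) z = a *: eeval (ederiv v p) z.
Proof. by rewrite -[a *: v]addr0 ederiv_lin ederiv0 addr0. Qed.

Lemma bounded_rows_scale (v : V) (d : R) : 0 < d ->
  exists2 c, 0 < c & bounded_rows v (c * d).
Proof.
move=> d0; have B0 : 0 < (2 ^ r).+1%:R * `|v| + 1 by rewrite ltr_wpDl// mulr_ge0.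
exists (((2 ^ r).+1%:R * `|v| + 1) / d); first exact: divr_gt0.
rewrite divfK ?gt_eqF//; apply: bounded_rows_le (bounded_rows_norm v).
by rewrite lerDl.
Qed.

(** A Cauchy estimate: the first-order coefficient [A1] at radius [s] is at most the majorant at
    radius [rho], and [c] measures the size of [v] against [rho - s]. *)
Lemma cvg_emaj_ederiv P v s rho : 0 <= s -> s < rho ->
  cvgn (series (fun k => emaj (P k) rho)) ->
  cvgn (series (fun k => emaj (ederiv v (P k)) s)).
Proof.
move=> s0 srho cP; have d0 : 0 < rho - s by rewrite subr_gt0.
have [c c0 vc] := bounded_rows_scale v d0.
have cP' : cvgn (series (fun k => c * emaj (P k) rho)).
  have -> : series (fun k => c * emaj (P k) rho) =
      c \*: series (fun k => emaj (P k) rho).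
    by apply/funext => N; rewrite /series/= scaler_sumr.
  exact: is_cvgZl_tmp.
apply: series_le_cvg cP' => k.
- exact: emaj_ge0.
- by rewrite mulr_ge0 ?(ltW c0)// emaj_ge0// (le_trans s0)// ltW.
- have [A1 [A2 [A10 A20 A12 A1P _]]] := ederiv_est r3 (P k) s0 srho.
  apply: le_trans (A1P v c (ltW c0) vc) _; rewrite ler_wpM2l ?(ltW c0)//.
  apply: le_trans A12; rewrite -addrA lerDl addr_ge0// emaj_ge0//.
Qed.

(** The Taylor remainders of the terms add up to at most [th ^+ 2] times the sum of the majorants,
    whatever the number of terms, so the bound survives in the limit. *)
Lemma expands_is_derive P f z0 rho s x v : expands P f z0 rho ->
  0 <= s -> s < rho -> bounded_rows x s ->
  is_derive (z0 + x) v f (limn (series (fun k => eeval (ederiv v (P k)) x))) /\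
  cvgn (series (fun k => eeval (ederiv v (P k)) x)).
Proof.
move=> [rho0 cP Pf] s0 srho xs; have d0 : 0 < rho - s by rewrite subr_gt0.
have [c c0 vc] := bounded_rows_scale v d0.
have cD : cvgn (series (fun k => eeval (ederiv v (P k)) x)).
  have le_maj k : len (eeval (ederiv v (P k)) x) <= emaj (ederiv v (P k)) s.
    exact: eeval_le.
  exact: (cvg_series_len le_maj (cvg_emaj_ederiv s0 srho cP)).
split; last exact: cD.
set D := limn _.
set M := limn (series (fun k => emaj (P k) rho)).
(* For such [t] one has [th <= 1/2], so [x + t *: v] stays in the polydisc whose radius is halfway
   between [s] and [rho], where the expansion of [f] is valid. *)
have e0 : 0 < (2 * c)^-1 by rewrite invr_gt0 mulr_gt0.
apply: (is_derive_quadratic (C := c ^+ 2 * M) e0) => t te.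
apply: le_trans (norm_le_len _) _.
pose th := `|t| * c.
have th0 : 0 <= th by rewrite mulr_ge0// ltW.
have th2 : th <= 2^-1.
  by rewrite /th -ler_pdivlMr//; apply: le_trans te _; rewrite invfM.
have vth : bounded_rows (t *: v) (th * (rho - s)).
  by rewrite /th -mulrA; exact: bounded_rowsZ.
have xv : bounded_rows (x + t *: v) (s + 2^-1 * (rho - s)).
  apply: bounded_rowsD => //; apply: bounded_rows_le vth.
  by rewrite ler_wpM2r// ltW.
have lim3 : series (fun k => eeval (P k) (x + t *: v)) -
    series (fun k => eeval (P k) x) -
    t \*: series (fun k => eeval (ederiv v (P k)) x) @ \oo -->
    f (z0 + x + t *: v) - f (z0 + x) - t *: D.
  apply: cvgB; first apply: cvgB.
  - rewrite -addrA; apply: Pf xv.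
    lra.
  - exact: Pf xs.
  - exact: cvgZl_tmp.
apply: (cvg_len_le lim3); apply: nearW => N.
have -> : (series (fun k => eeval (P k) (x + t *: v)) -
    series (fun k => eeval (P k) x) -
    t \*: series (fun k => eeval (ederiv v (P k)) x)) N =
  \sum_(0 <= k < N) (eeval (P k) (x + t *: v) - eeval (P k) x -
    eeval (ederiv (t *: v) (P k)) x).
  rewrite !sumrB; congr (_ - _); rewrite [LHS]scaler_sumr.
  by apply: eq_bigr => k _; rewrite ederivZ.
apply: le_trans (_ : \sum_(0 <= k < N) th ^+ 2 * emaj (P k) rho <= _).
  elim: N => [|N IH]; first by rewrite !big_nil len0.
  rewrite !big_nat_recr//=; apply: lenD_le IH _.
  have [A1 [A2 [A10 A20 A12 _ A2P]]] := ederiv_est r3 (P N) s0 srho.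
  apply: le_trans (A2P x (t *: v) th _ xs vth) _.
    by rewrite th0/=; apply: le_trans th2 _; lra.
  rewrite ler_wpM2l ?sqr_ge0//; apply: le_trans A12.
  by rewrite -addrA addrCA lerDl addr_ge0// emaj_ge0.
rewrite -mulr_sumr /th exprMn real_normK ?num_real// [leRHS]mulrAC (mulrC (t ^+ 2)).
apply: ler_wpM2l; first by rewrite mulr_ge0 ?sqr_ge0.
apply: nondecreasing_cvgn_le cP _ => //.
by apply: nondecreasing_series => k _ _; rewrite emaj_ge0 ?ltW.
Qed.

Lemma expands_derive P f z0 rho s v : expands P f z0 rho -> 0 < s -> s < rho ->
  expands (fun k => ederiv v (P k)) ('D_v f) z0 s.
Proof.
move=> /[dup] Pf [rho0 cP _] s0 srho; split => //.
  exact: cvg_emaj_ederiv (ltW s0) srho cP.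
move=> x s' s's xs'; have xs : bounded_rows x s by apply: bounded_rows_le xs'; exact: ltW.
by have [[_ ->] cD] := expands_is_derive v Pf (ltW s0) srho xs.
Qed.

Definition analytic (O : set V) f := forall z, O z -> exists P rho, expands P f z rho.

Lemma analytic_derive O f v : analytic O f -> analytic O ('D_v f).
Proof.
move=> Of z Oz; have [P [rho /[dup] Pf [rho0 _ _]]] := Of z Oz.
exists (fun k => ederiv v (P k)), (rho / 2).
by apply: expands_derive Pf _ _; lra.
Qed.

Lemma analytic_is_derive O f v z : analytic O f -> O z -> is_derive z v f ('D_v f z).
Proof.
move=> Of Oz; have [P [rho /[dup] Pf [rho0 _ _]]] := Of z Oz.
apply/derivableP.
have [] := expands_is_derive v Pf (lexx 0) rho0 (bounded_rows0 _ (lexx 0)).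
by rewrite addr0 => -[].
Qed.

Lemma expands_deriveE P f z rho v : expands P f z rho ->
  series (fun k => eeval (ederiv v (P k)) 0) @ \oo --> 'D_v f z.
Proof.
move=> /[dup] Pf [rho0 _ _].
have [+ cD] := expands_is_derive v Pf (lexx 0) rho0 (bounded_rows0 _ (lexx 0)).
by rewrite addr0 => -[_ ->].
Qed.

(** Both iterated derivatives are sums of termwise differentiated series, and these agree term by
    term by [ederiv_swap]. *)
Lemma analytic_swap O f v w z : analytic O f -> O z ->
  'D_v ('D_w f) z = 'D_w ('D_v f) z.
Proof.
move=> Of Oz; have [P [rho /[dup] Pf [rho0 _ _]]] := Of z Oz.
have h0 : 0 < rho / 2 by lra.
have h1 : rho / 2 < rho by lra.
have := expands_deriveE (v := v) (expands_derive w Pf h0 h1).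
have := expands_deriveE (v := w) (expands_derive v Pf h0 h1).
under eq_fun do rewrite ederiv_swap.
by move=> H1 H2; exact: (norm_cvg_unique H2 H1).
Qed.

Lemma analytic_derive_lin O f a v w z : analytic O f -> O z ->
  'D_(a *: v + w) f z = a *: 'D_v f z + 'D_w f z.
Proof.
move=> Of Oz; have [P [rho Pf]] := Of z Oz.
rewrite -(cvg_lim (@norm_hausdorff _ _) (expands_deriveE (v := a *: v + w) Pf)).
apply: cvg_lim; first exact: norm_hausdorff.
have -> : series (fun k => eeval (ederiv (a *: v + w) (P k)) 0) =
   a \*: series (fun k => eeval (ederiv v (P k)) 0) +
   series (fun k => eeval (ederiv w (P k)) 0).
  apply/funext => N; rewrite [RHS](_ : _ = a *: \sum_(0 <= k < N) eeval (ederiv v (P k)) 0 +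
    \sum_(0 <= k < N) eeval (ederiv w (P k)) 0)// scaler_sumr -big_split/=.
  by apply: eq_bigr => k _; rewrite ederiv_lin.
by apply: cvgD; [apply: cvgZl_tmp|]; exact: expands_deriveE Pf.
Qed.

End Analytic.

(** * From phrases to directional derivatives *)

Section Words.
Variables (R : realType) (r : nat).
Hypothesis r3 : (r <= 3)%N.
Local Notation K := (cdalg R r).

Fixpoint expr_of_word n (w : word R r n) : expr R r n :=
  match w with
  | WConst a => EConst n a
  | WVar i => EVar R r i
  | WConj i => EConj R r i
  | WMul u v => EMul (expr_of_word u) (expr_of_word v)
  end.

Lemma weval_expr n (w : word R r n) z : weval w z = eeval (expr_of_word w) z.
Proof. by elim: w => //= u -> v ->. Qed.

Lemma wmaj_expr n (w : word R r n) s : wmaj w s = emaj (expr_of_word w) s.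
Proof. by elim: w => //= [a|u -> v ->//]; exact: cdabsE. Qed.

Definition setrow0 n (j : 'I_n) (h : K) : cdspace R r n :=
  \matrix_(i, k) (if i == j then h 0 k else 0).

Lemma row_setrow0 n (j i : 'I_n) h : row i (setrow0 j h) = if i == j then h else 0.
Proof. by apply/rowP => k; rewrite !mxE; case: ifP => // _; rewrite mxE. Qed.

Lemma setrow0_lin n (j : 'I_n) a h k :
  setrow0 j (a *: h + k) = a *: setrow0 j h + setrow0 j k.
Proof.
by apply/matrixP => i l; rewrite !mxE; case: ifP => // _; rewrite mulr0 addr0.
Qed.

Lemma setrow0_0 n (j : 'I_n) : setrow0 j 0 = 0.
Proof. by apply/matrixP => i l; rewrite !mxE if_same. Qed.

Lemma setrow0D n (j : 'I_n) h k : setrow0 j (h + k) = setrow0 j h + setrow0 j k.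
Proof. by have := setrow0_lin j 1 h k; rewrite !scale1r. Qed.

Lemma setrow0Z n (j : 'I_n) a h : setrow0 j (a *: h) = a *: setrow0 j h.
Proof. by have := setrow0_lin j a h 0; rewrite setrow0_0 !addr0. Qed.

Lemma setrow0_id (h : cdspace R r 1) : setrow0 0 h = h.
Proof. by apply/matrixP => i l; rewrite !mxE !ord1. Qed.

Lemma setrowE n (j : 'I_n) z h : setrow j z (row j z + h) = z + setrow0 j h.
Proof. by apply/matrixP => i l; rewrite !mxE; case: eqP => [->|_]; rewrite ?addr0. Qed.

Lemma sum_setrow0 n (h : cdspace R r n) : \sum_(j < n) setrow0 j (row j h) = h.
Proof.
apply/matrixP => i k; rewrite summxE (bigD1 i)//= !mxE eqxx big1 ?addr0// => j ji.
by rewrite mxE eq_sym (negPf ji).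
Qed.

Lemma wdz_wdzbar n (j : 'I_n) (w : word R r n) x h :
  wdz j w x h + wdzbar j w x h = eeval (ederiv (setrow0 j h) (expr_of_word w)) x.
Proof.
elim: w => /= [a|i|i|u <- v <-]; rewrite ?addr0 ?add0r//.
- by rewrite row_setrow0.
- by rewrite row_setrow0; case: ifP => //; rewrite cdconj0.
- by rewrite !weval_expr !cdmulDl !cdmulDr; apply/rowP => k; rewrite !mxE; ring.
Qed.

Lemma represents_expands n (phi : phrase R r n) f z0 rho : represents phi f z0 rho ->
  expands (fun k => expr_of_word (phi k)) f z0 rho.
Proof.
move=> [rho0 cphi phif]; split => //.
  by under eq_fun do rewrite -wmaj_expr.
move=> x s srho xs; have := phif (z0 + x).
rewrite addrAC subrr add0r; under eq_fun do rewrite weval_expr.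
apply=> j; rewrite addrAC subrr add0r cdabsE.
exact: le_lt_trans srho.
Qed.

Lemma holomorphic_analytic n (U : set (cdspace R r n)) f :
  holomorphic U f -> analytic U f.
Proof.
move=> fU z Uz; have [_ [phi [rho [phif _]]]] := fU z Uz.
by exists (fun k => expr_of_word (phi k)), rho; exact: represents_expands.
Qed.

(** The two formal operators add up to the directional derivative, and the conjugate one is zero at
    [z]. *)
Lemma superpartial_derive n f (j : 'I_n) (z : cdspace R r n) L h :
  superpartial f j z L -> 'D_(setrow0 j h) f z = L h.
Proof.
move=> [phi [rho [phif phibar phidz]]].
have H := expands_deriveE r3 (v := setrow0 j h) (represents_expands phif).
have H' := cvgD (phidz h) (phibar h); rewrite addr0 subrr in H'.
have E : series (fun k => eeval (ederiv (setrow0 j h) (expr_of_word (phi k))) 0) =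
    series (fun k => wdz j (phi k) 0 h) + series (fun k => wdzbar j (phi k) 0 h).
  apply/funext => N; rewrite [RHS](_ : _ = \sum_(0 <= k < N) wdz j (phi k) 0 h +
    \sum_(0 <= k < N) wdzbar j (phi k) 0 h)// -big_split/=.
  by apply: eq_bigr => k _; rewrite wdz_wdzbar.
by rewrite E in H; exact: (norm_cvg_unique H (H' _)).
Qed.

Lemma derive_slice n (f : cdspace R r n -> K) j z (h : K) :
  'D_h (slice f j z) (row j z) = 'D_(setrow0 j h) f z.
Proof.
rewrite /derive; apply: (congr1 (fun g => lim (g @ 0^'))); apply/funext => t /=; rewrite /slice.
rewrite [_ + row j z]addrC setrowE setrow0Z [z + _]addrC; congr (_ *: (_ - f _)).
by have := setrowE j z 0; rewrite setrow0_0 !addr0.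
Qed.

(** Only this consequence of the angle condition is kept, because it also holds where the derivative
    is zero; [orthogonal_similarity] recovers the conformal factor from it. *)
Lemma pseudoconformal_orthogonal n (U : set (cdspace R r n)) f z (j : 'I_n) (h k : K) :
  pseudoconformal_or_zero U f -> U z -> dot h k = 0 ->
  dot ('D_(setrow0 j h) f z) ('D_(setrow0 j k) f z) = 0.
Proof.
move=> pf Uz hk; have [[_ [L [pL angle _ _]]]|p0] := pf j z Uz; last first.
  by rewrite (superpartial_derive _ p0) dot0l.
have DL l : 'D_(setrow0 j l) f z = L l.
  by rewrite -derive_slice -(superpartial_derive l pL) setrow0_id.
rewrite !DL; have := angle h k; rewrite !cdRe_mul_conj hk mulr0 !cdabsE.
have [->|h0] := eqVneq h 0; first by rewrite linear0 dot0l.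
have [->|k0] := eqVneq k 0; first by rewrite linear0 dot0r.
by move/eqP; rewrite !mulf_eq0 !(gt_eqF (len_gt0 _))// !orbF => /eqP.
Qed.

End Words.

(** * Jets of conformal maps *)

Lemma is_derive_coord (R : realType) (V : normedModType R) m (f : V -> 'rV[R]_m)
    (x v : V) df k : is_derive x v f df -> is_derive x v (fun y => f y 0 k) (df 0 k).
Proof.
move=> [fx <-].
have H : (fun t : R => t^-1 *: (((fun y => f y 0 k) \o shift x) (t *: v) - f x 0 k))
    @ 0^' --> ('D_v f x) 0 k.
  rewrite [X in X @ _](_ : _ = (fun M : 'rV[R]_m => M 0 k) \o
    (fun t : R => t^-1 *: ((f \o shift x) (t *: v) - f x))).
    exact: cvg_comp fx (@coord_continuous R 1 m 0 k ('D_v f x)).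
  by apply/funext => t; rewrite /= !mxE.
by split; [apply/cvg_ex; exists (('D_v f x) 0 k) | exact: cvg_lim H].
Qed.

Lemma is_derive_dot (R : realType) (V : normedModType R) m (f g : V -> 'rV[R]_m)
    (x v : V) df dg : is_derive x v f df -> is_derive x v g dg ->
  is_derive x v (fun y => dot (f y) (g y)) (dot df (g x) + dot (f x) dg).
Proof.
move=> fx gx.
have fk k := is_derive_coord k fx; have gk k := is_derive_coord k gx.
have H := is_derive_sum (fun k => is_deriveM (fk k) (gk k)).
have -> : (fun y => dot (f y) (g y)) =
    \sum_(k < m) ((fun y => f y 0 k) * (fun y => g y 0 k)).
  by apply/funext => y; rewrite fct_sumE.
apply: is_derive_eq H _; rewrite /dot -big_split/=; apply: eq_bigr => k _.
by rewrite -[LHS]/(_ * _ + _ * _); ring.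
Qed.

(** Used to differentiate identities valid on all of [U], such as the conformality relation. *)
Lemma is_derive_open_eq (R : realType) (V W : normedModType R) (O : set V)
    (f g : V -> W) (z v : V) a b : open O -> O z -> (forall y, O y -> f y = g y) ->
  is_derive z v f a -> is_derive z v g b -> a = b.
Proof.
move=> oO Oz fg fa [_ <-].
have H : \forall y \near z, f y = g y.
  by apply: filterS (open_nbhs_nbhs (conj oO Oz)) => y; exact: fg.
by have [_ ->] := near_eq_is_derive H fa.
Qed.

(** The matrix with columns [e] and [h] has rank at most two, hence a nonzero left kernel. This is
    where Liouville's theorem uses dimension at least three. *)
Lemma orthonormal_third (R : realType) m (e h : 'rV[R]_m) : (2 < m)%N ->
  exists k, [/\ dot k k = 1, dot e k = 0 & dot h k = 0].
Proof.
move=> m2; pose A := row_mx e^T h^T.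
have : kermx A != 0.
  rewrite -mxrank_eq0 mxrank_ker -lt0n subn_gt0.
  by apply: leq_ltn_trans (rank_leq_col A) _.
case/rowV0Pn => v /sub_kermxP vA v0.
move: vA; rewrite mul_mx_row -row_mx0 => /eq_row_mx[ve vh].
have dotM (u : 'rV[R]_m) : v *m u^T = 0 -> dot u v = 0.
  move/matrixP/(_ 0 0); rewrite !mxE dotC => <-.
  by apply: eq_bigr => i _; rewrite mxE.
exists ((len v)^-1 *: v); rewrite !dotE (dotM _ ve) (dotM _ vh) !mulr0; split => //.
by rewrite mulrA -invfM -expr2 len_sqr mulVf// gt_eqF// dot_gt0.
Qed.

Section Similarity.
Variables (R : realType) (m : nat) (L : 'rV[R]_m -> 'rV[R]_m).
Hypothesis Llin : forall a h k, L (a *: h + k) = a *: L h + L k.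

Lemma simil0 : L 0 = 0.
Proof.
have := Llin 1 0 0; rewrite scaler0 addr0 scale1r => /eqP.
by rewrite -subr_eq subrr => /eqP.
Qed.

Lemma similD h k : L (h + k) = L h + L k.
Proof. by rewrite -[h in LHS]scale1r Llin scale1r. Qed.

Lemma similZ a h : L (a *: h) = a *: L h.
Proof. by rewrite -[a *: h]addr0 Llin simil0 addr0. Qed.

Lemma similN h : L (- h) = - L h.
Proof. by rewrite -scaleN1r similZ scaleN1r. Qed.

(** For [h] and [k] of equal length, [h + k] is orthogonal to [h - k], so their images have equal
    length too. Comparing [h] with [len h *: e] gives the factor, and polarization the products. *)
Lemma orthogonal_similarity e : dot e e = 1 ->
  (forall h k, dot h k = 0 -> dot (L h) (L k) = 0) ->
  forall h k, dot (L h) (L k) = dot (L e) (L e) * dot h k.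
Proof.
move=> e1 Lorth.
have eqlen h k : dot h h = dot k k -> dot (L h) (L h) = dot (L k) (L k).
  move=> hk; have := Lorth (h + k) (h - k).
  rewrite !(similD, similN) !dotE (dotC k h) (dotC (L k) (L h)) => H.
  by apply/eqP; rewrite -subr_eq0; apply/eqP; rewrite -H ?hk; ring.
have sqr h : dot (L h) (L h) = dot (L e) (L e) * dot h h.
  rewrite (eqlen h (len h *: e)); last by rewrite !dotE e1 mulr1 -expr2 len_sqr.
  by rewrite similZ !dotE mulrA -expr2 len_sqr mulrC.
move=> h k; have := sqr (h + k).
rewrite similD !dotE (dotC k h) (dotC (L k)) (sqr h) (sqr k); lra.
Qed.

Variable lam : R.
Hypothesis lam_gt0 : 0 < lam.
Hypothesis Lsim : forall h k, dot (L h) (L k) = lam * dot h k.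

Lemma similarity_surj v : exists h, L h = v.
Proof.
pose M := \matrix_(i < m) L (delta_mx 0 i).
have LM h : L h = h *m M.
  rewrite [in LHS](row_sum_delta h) mulmx_sum_row.
  elim/big_ind2 : _ => [|x1 x2 y1 y2 <- <-|i _].
  - exact: simil0.
  - exact: similD.
  - by rewrite similZ rowK.
(* The matrix of a similarity satisfies [M M^T = lam], and a right inverse of a square matrix is
   also a left inverse. *)
have MM : M *m (lam^-1 *: M^T) = 1%:M.
  rewrite -scalemxAr; apply/matrixP => i k; rewrite !mxE.
  have := Lsim (delta_mx 0 i) (delta_mx 0 k).
  rewrite [X in X = _ -> _](_ : _ = \sum_l M i l * M^T l k); last first.
    by apply: eq_bigr => l _; rewrite !mxE.
  move=> ->; rewrite mulrA (mulVf (lt0r_neq0 lam_gt0)) mul1r /dot (bigD1 i)//= big1.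
    by rewrite !mxE !eqxx addr0 mul1r.
  by move=> l li; rewrite !mxE (negPf li) mul0r.
exists (v *m (lam^-1 *: M^T)).
by rewrite LM -mulmxA (mulmx1C MM) mulmx1.
Qed.

Lemma similarity_test u v : (forall h, dot u (L h) = dot v (L h)) -> u = v.
Proof.
move=> uv; have [h hE] := similarity_surj (u - v).
apply/eqP; rewrite -subr_eq0; apply/eqP; apply: dot_eq0.
by rewrite -{2}hE !dotE uv subrr.
Qed.

End Similarity.

(* L, B and C stand for the first three derivatives of a conformal map at a
   point; E1 and E2 are the derivatives of the conformality relation. *)
Section ConformalJet.
Variables (R : realType) (m : nat).
Local Notation E := 'rV[R]_m.
Variables (L : E -> E) (B : E -> E -> E) (C : E -> E -> E -> E).
Variables (lam : R) (be : E -> R) (mu : E -> E -> R) (e0 : E).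
Hypothesis m2 : (2 < m)%N.
Hypothesis Llin : forall a h k, L (a *: h + k) = a *: L h + L k.
Hypothesis BC : forall h k, B h k = B k h.
Hypothesis C12 : forall p l h, C p l h = C l p h.
Hypothesis C23 : forall p l h, C p l h = C p h l.
Hypothesis lam_gt0 : 0 < lam.
Hypothesis e01 : dot e0 e0 = 1.
Hypothesis E0 : forall h k, dot (L h) (L k) = lam * dot h k.
Hypothesis E1 : forall l h k,
  dot (B l h) (L k) + dot (L h) (B l k) = 2 * be l * dot h k.
Hypothesis E2 : forall p l h k,
  dot (C p l h) (L k) + dot (B l h) (B p k) + (dot (B p h) (B l k)
    + dot (L h) (C p l k)) = 2 * mu p l * dot h k.

(** The same cyclic combination as in the Koszul formula for the Levi-Civita connection; the
    symmetry of [B] cancels the other products. *)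
Lemma koszul h k l :
  dot (B h k) (L l) = be k * dot h l + be h * dot k l - be l * dot h k.
Proof.
have := E1 l h k; have := E1 k h l; have := E1 h l k.
rewrite !(dotC (L _)) (BC l h) (BC l k) (BC k h) (dotC l k); lra.
Qed.

(** This is [L b] for the vector [b] that represents the linear form [be], as [dot_pole] shows.
    Divided by [2 * lam ^+ 2] it becomes the vector [g] of the Moebius map, whose pole is the
    inverse point of [g]. *)
Definition jet_pole := (2 * be e0) *: L e0 - lam *: B e0 e0.
Local Notation ga := jet_pole.

Lemma dot_pole l : dot ga (L l) = lam * be l.
Proof. by rewrite /ga !dotE koszul E0 e01; ring. Qed.

Lemma second_jet h k :
  lam *: B h k = be k *: L h + be h *: L k - dot h k *: ga.
Proof.
apply: (similarity_test Llin lam_gt0 E0) => l.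
move: (jet_pole) dot_pole => g gL.
by rewrite !dotE gL koszul !E0; ring.
Qed.

Lemma dot_second_jet h k p q : lam * dot (B h k) (B p q) =
  be k * be q * dot h p + be k * be p * dot h q + be h * be q * dot k p
  + be h * be p * dot k q - 2 * (dot p q * (be h * be k))
  - 2 * (dot h k * (be p * be q)) + dot h k * dot p q * (dot ga ga / lam).
Proof.
move: (jet_pole) dot_pole second_jet => g gL BL.
apply: (mulfI (lt0r_neq0 lam_gt0)).
have -> : lam * (lam * dot (B h k) (B p q)) = dot (lam *: B h k) (lam *: B p q).
  by rewrite dotZl dotZr.
rewrite !BL !dotE !E0 !(dotC (L _) g) !gL.
by field; exact: lt0r_neq0.
Qed.

Lemma third_jet_normal e h : dot e e = 1 -> dot h h = 1 -> dot e h = 0 ->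
  lam * dot (C e e e) (L h) = - 3 * (be e * be h).
Proof.
move=> e1 h1 eh; have [k [k1 ek hk]] := orthonormal_third e h m2.
have on := (eh, ek, hk, e1, h1, k1, etrans (dotC h e) eh, etrans (dotC k e) ek,
  etrans (dotC k h) hk).
have c1 := C23 e h e; have c2 := etrans (C12 h e e) c1.
have c3 := C12 k e k; have c4 := etrans (C23 k k e) c3.
have c5 := C12 k h k; have c6 := etrans (C23 k k h) c5.
have c7 := C23 e k h; have c8 := etrans (C12 k e h) c7.
have c9 := C12 h e k; have c10 := etrans (C23 h k e) c9.
have c11 := etrans (C12 k h e) c10.
(* The unknowns are products of [C] with [L]. The four instances involving [k] determine [mu e h];
   the two in [e] and [h] alone then give the product sought. *)
have := E2 e e e h; have := E2 e h e e; have := E2 e h k k.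
have := E2 h k e k; have := E2 e k h k; have := E2 k k e h.
rewrite !(dotC (L _)) !(c1, c2, c3, c4, c5, c6, c7, c8, c9, c10, c11).
rewrite !(BC h e) !(BC k e) !(BC k h) !on !mulr0 !mulr1.
rewrite ?(dotC (B e h) (B e e)) ?(dotC (B h k) (B e k)) ?(dotC (B k k) (B e h)).
have := dot_second_jet e e e h; have := dot_second_jet e k h k.
have := dot_second_jet e h k k.
rewrite !on.
set s1 := dot (B e h) (B k k); set s2 := dot (B e k) (B h k).
set s3 := dot (B e e) (B e h).
move=> q1 q2 q3 w1 w2 w3 w4 w5 w6.
have -> : dot (C e e e) (L h) = s1 - s2 - s3 by lra.
rewrite !mulrDr !mulrN; lra.
Qed.

Lemma third_jet_tangent e : dot e e = 1 ->
  lam * dot (C e e e) (L e) = 3 * be e ^+ 2 - 3 / 2 * (dot ga ga / lam).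
Proof.
move=> e1; have [h [h1 eh _]] := orthonormal_third e e m2.
have [k [k1 ek hk]] := orthonormal_third e h m2.
have on := (eh, ek, hk, e1, h1, k1, etrans (dotC h e) eh, etrans (dotC k e) ek,
  etrans (dotC k h) hk).
have c1 := C23 e h e; have c2 := etrans (C12 h e e) c1.
have c3 := C12 k e k; have c4 := etrans (C23 k k e) c3.
have c5 := C12 k h k; have c6 := etrans (C23 k k h) c5.
have d1 := C23 e k e; have d2 := etrans (C12 k e e) d1.
have d3 := C12 h e h; have d4 := etrans (C23 h h e) d3.
have d5 := C23 h k h; have d6 := etrans (C12 k h h) d5.
have := E2 e e e e; have := E2 e e h h; have := E2 e e k k.
have := E2 h h e e; have := E2 h h k k; have := E2 k k e e; have := E2 k k h h.
have := E2 e h e h; have := E2 e k e k; have := E2 h k h k.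
rewrite !(dotC (L _)) !(c1, c2, c3, c4, c5, c6, d1, d2, d3, d4, d5, d6).
rewrite !(BC h e) !(BC k e) !(BC k h) !on !mulr0 !mulr1.
have := dot_second_jet e e e e; have := dot_second_jet e h e h.
have := dot_second_jet e k e k; have := dot_second_jet h k h k.
have := dot_second_jet e e h h; have := dot_second_jet e e k k.
have := dot_second_jet h h k k.
rewrite !on ?(dotC (B h h) (B e e)) ?(dotC (B k k) (B e e)) ?(dotC (B k k) (B h h)).
move: (dot ga ga / lam) => G.
set s1 := dot (B h h) (B k k); set s2 := dot (B e e) (B k k).
set s3 := dot (B e e) (B h h); set s4 := dot (B h k) (B h k).
set s5 := dot (B e k) (B e k); set s6 := dot (B e h) (B e h).
set s7 := dot (B e e) (B e e).
move=> q1 q2 q3 q4 q5 q6 q7 w1 w2 w3 w4 w5 w6 w7 w8 w9 w10.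
(* Eliminating [C] within a pair of directions leaves [mu e e + mu h h = s6 - s3], and likewise
   [s5 - s2] for [e, k] and [s4 - s1] for [h, k]. Three such sums determine [mu e e]; with only two
   directions there would be a single one. *)
have -> : dot (C e e e) (L e) = (s6 - s3 + s5 - s2 - s4 + s1) / 2 - s7 by lra.
rewrite mulrBr mulrA !mulrDr !mulrN; lra.
Qed.

(** Reduces an identity of vectors to the tangent and normal components, the two cases computed
    above. *)
Lemma frame_test X e : dot e e = 1 -> dot X (L e) = 0 ->
  (forall h, dot h h = 1 -> dot e h = 0 -> dot X (L h) = 0) -> X = 0.
Proof.
move=> e1 Xe Xh; apply: (similarity_test Llin lam_gt0 E0) => q; rewrite dot0l.
pose q' := q - dot e q *: e.
have -> : q = dot e q *: e + q' by rewrite addrC subrK.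
rewrite Llin dotDr dotZr Xe mulr0 add0r.
have [->|q'0] := eqVneq q' 0; first by rewrite (simil0 Llin) dot0r.
have lq : len q' != 0 by rewrite gt_eqF// len_gt0.
have -> : q' = len q' *: ((len q')^-1 *: q') by rewrite scalerA mulfV// scale1r.
rewrite (similZ Llin) dotZr Xh ?mulr0//.
  by rewrite dotZl dotZr mulrA -invfM -expr2 len_sqr mulVf// gt_eqF// dot_gt0.
by rewrite dotZr /q' dotDr dotNr dotZr e1 mulr1 subrr mulr0.
Qed.

Lemma dot_second e : dot e e = 1 -> lam * dot (B e e) (B e e) = dot ga ga / lam.
Proof. by move=> e1; rewrite dot_second_jet e1; ring. Qed.

(* The Schwarzian derivative along the line of direction e vanishes. *)
Lemma third_jet e : dot e e = 1 ->
  lam *: C e e e = (3 * be e) *: B e e - (3 / 2 * dot (B e e) (B e e)) *: L e.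
Proof.
move=> e1; apply/eqP; rewrite -subr_eq0; apply/eqP.
have lBB := dot_second e1.
apply: (frame_test e1) => [|h h1 eh]; rewrite !dotE.
- rewrite third_jet_tangent// koszul E0 !e1.
  have -> : 3 / 2 * dot (B e e) (B e e) * (lam * 1) =
    3 / 2 * (lam * dot (B e e) (B e e)) by ring.
  by rewrite lBB; field; exact: lt0r_neq0.
- by rewrite third_jet_normal// koszul E0 eh e1; ring.
Qed.

Lemma dot_first_second e : dot e e = 1 -> dot (L e) (B e e) = be e.
Proof. by move=> e1; rewrite dotC koszul e1; ring. Qed.

End ConformalJet.

(** * Vanishing Schwarzian along a line *)

Section LineODE.
Variable R : realType.
Implicit Types (f g h : R -> R) (x s t : R).

Lemma is_derive1D f g x a b : is_derive x 1 f a -> is_derive x 1 g b ->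
  is_derive x 1 (fun y => f y + g y) (a + b).
Proof. by move=> ? ?; exact: is_deriveD. Qed.

Lemma is_derive1M f g x a b : is_derive x 1 f a -> is_derive x 1 g b ->
  is_derive x 1 (fun y => f y * g y) (a * g x + f x * b).
Proof.
move=> fa gb; apply: is_derive_eq (is_deriveM fa gb) _.
by rewrite -[LHS]/(_ * _ + _ * _); ring.
Qed.

Lemma is_derive1Ml c g x b : is_derive x 1 g b ->
  is_derive x 1 (fun y => c * g y) (c * b).
Proof. by move=> gb; exact: is_deriveZ. Qed.

Lemma is_derive1Mr c g x b : is_derive x 1 g b ->
  is_derive x 1 (fun y => g y * c) (b * c).
Proof.
move=> gb; have -> : (fun y => g y * c) = (fun y => c * g y).
  by apply/funext => y; rewrite mulrC.
by rewrite mulrC; exact: is_derive1Ml.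
Qed.

Lemma is_derive1_linear c x : is_derive x 1 (fun y => y * c) c.
Proof.
by rewrite -[X in is_derive _ _ _ X]mul1r; apply: is_derive1Mr; exact: is_derive_id.
Qed.

Lemma is_derive1_square c x : is_derive x 1 (fun y => y * y * c) (2 * x * c).
Proof.
apply: is_derive_eq (is_derive1Mr c (is_derive1M (is_derive_id x _) (is_derive_id x _))) _.
by rewrite mul1r mulr1 mulr_natl mulr2n.
Qed.

Lemma is_derive_zero_const g t : 0 <= t ->
  (forall s, 0 <= s <= t -> is_derive s 1 g 0) -> g t = g 0.
Proof.
move=> t0 dg; have [||c _] := @MVT_segment R g (fun=> 0) 0 t t0.
- by move=> s; rewrite in_itv/= => /andP[s0 st]; apply: dg; rewrite !ltW.
- apply: derivable_within_continuous => s; rewrite in_itv/= => st.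
  by have [] := dg s st.
- by rewrite mul0r => /eqP; rewrite subr_eq0 => /eqP.
Qed.

Lemma taylor_quadratic h h1 h2 (T : R) :
  (forall t, 0 <= t < T -> is_derive t 1 h (h1 t)) ->
  (forall t, 0 <= t < T -> is_derive t 1 h1 (h2 t)) ->
  (forall t, 0 <= t < T -> is_derive t 1 h2 0) ->
  forall t, 0 <= t < T -> h t = h 0 + t * h1 0 + t ^+ 2 / 2 * h2 0.
Proof.
move=> dh dh1 dh2.
have c2 t : 0 <= t < T -> h2 t = h2 0.
  move=> /andP[t0 tT]; apply: is_derive_zero_const => // s /andP[s0 st].
  by apply: dh2; rewrite s0 (le_lt_trans st).
have c1 t : 0 <= t < T -> h1 t = h1 0 + t * h2 0.
  move=> /andP[t0 tT].
  suff : h1 t + t * (- h2 0) = h1 0 + 0 * (- h2 0) by rewrite mul0r; lra.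
  apply: (@is_derive_zero_const (fun s => h1 s + s * (- h2 0))) => // s /andP[s0 st].
  have sT : 0 <= s < T by rewrite s0 (le_lt_trans st).
  by apply: is_derive_eq (is_derive1D (dh1 s sT) (is_derive1_linear _ s)) _; rewrite c2// subrr.
move=> t /andP[t0 tT].
suff : h t + (t * (- h1 0) + t * t * (- (h2 0 / 2))) =
    h 0 + (0 * (- h1 0) + 0 * 0 * (- (h2 0 / 2))).
  by rewrite !mul0r expr2; lra.
apply: (@is_derive_zero_const
  (fun s => h s + (s * (- h1 0) + s * s * (- (h2 0 / 2))))) => // s /andP[s0 st].
have sT : 0 <= s < T by rewrite s0 (le_lt_trans st).
apply: is_derive_eq (is_derive1D (dh s sT) (is_derive1D
  (is_derive1_linear _ s) (is_derive1_square _ s))) _.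
by rewrite c1//; field.
Qed.

Variables (m : nat) (rho : R) (F F1 F2 F3 : R -> 'rV[R]_m).
Let lam t := dot (F1 t) (F1 t).
Let a t := dot (F1 t) (F2 t).
Let s t := dot (F2 t) (F2 t).
Hypothesis dF : forall t, 0 <= t < rho -> is_derive t 1 F (F1 t).
Hypothesis dF1 : forall t, 0 <= t < rho -> is_derive t 1 F1 (F2 t).
Hypothesis dF2 : forall t, 0 <= t < rho -> is_derive t 1 F2 (F3 t).
Hypothesis schwarz : forall t, 0 <= t < rho -> 0 < lam t ->
  lam t *: F3 t = (3 * a t) *: F2 t - (3 / 2 * s t) *: F1 t.

Let p t := (Num.sqrt (lam t))^-1.
(** The first two derivatives of [p], the second already simplified by [schwarz]: it contains no
    [F3], and its own derivative is zero. *)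
Let p1 t := - (a t * (p t * (p t * p t))).
Let p2 t := 2^-1 * (s t * (p t * (p t * p t))).

Lemma schwarz_dot t u : 0 <= t < rho -> 0 < lam t ->
  dot u (F3 t) = (3 * a t * dot u (F2 t) - 3 / 2 * s t * dot u (F1 t)) * (p t * p t).
Proof.
move=> tr l0; apply: (mulfI (lt0r_neq0 l0)).
have -> : lam t * dot u (F3 t) = dot u (lam t *: F3 t) by rewrite dotZr.
rewrite schwarz// /p -invfM -expr2 sqr_sqrtr ?(ltW l0)//.
rewrite dotDr dotNr !dotZr; field; exact: lt0r_neq0.
Qed.

Lemma lam_derive t : 0 <= t < rho -> is_derive t 1 lam (2 * a t).
Proof.
move=> tr; apply: is_derive_eq (is_derive_dot (dF1 tr) (dF1 tr)) _.
by rewrite dotC /a; ring.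
Qed.

Lemma p_derive t : 0 <= t < rho -> 0 < lam t -> is_derive t 1 p (p1 t).
Proof.
move=> tr l0; have sl0 : Num.sqrt (lam t) != 0 by rewrite gt_eqF// sqrtr_gt0.
have d1 : is_derive t 1 (Num.sqrt \o lam) ((2 * Num.sqrt (lam t))^-1 * (2 * a t)).
  by apply: is_derive1_comp; [exact: is_derive1_sqrt | exact: lam_derive].
apply: is_derive_eq (is_deriveV _ d1) _ => //.
rewrite -[LHS]/(- Num.sqrt (lam t) ^- 2 * ((2 * Num.sqrt (lam t))^-1 * (2 * a t))).
rewrite /p1 /p; field.
by rewrite sl0.
Qed.

Lemma p3_derive t : 0 <= t < rho -> 0 < lam t ->
  is_derive t 1 (fun t => p t * (p t * p t)) (3 * p1 t * (p t * p t)).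
Proof.
move=> tr l0; have dp := p_derive tr l0.
by apply: is_derive_eq (is_derive1M dp (is_derive1M dp dp)) _; ring.
Qed.

Lemma lam_p t : 0 < lam t -> lam t * (p t * p t) = 1.
Proof.
move=> l0; rewrite /p -invfM -expr2 sqr_sqrtr ?ltW// mulfV//; exact: lt0r_neq0.
Qed.

Lemma p1_derive t : 0 <= t < rho -> 0 < lam t -> is_derive t 1 p1 (p2 t).
Proof.
move=> tr l0; have da := is_derive_dot (dF1 tr) (dF2 tr).
have dn := is_derive1Ml (-1) (is_derive1M da (p3_derive tr l0)).
have -> : p1 = (fun t => -1 * (dot (F1 t) (F2 t) * (p t * (p t * p t)))).
  by apply/funext => y; rewrite mulN1r.
apply: is_derive_eq dn _.
rewrite schwarz_dot// -/(lam t) -/(a t) -/(s t) /p2 /p1.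
have -> : (3 * a t * a t - 3 / 2 * s t * lam t) * (p t * p t) =
  3 * a t * a t * (p t * p t) - 3 / 2 * s t * (lam t * (p t * p t)) by ring.
by rewrite lam_p//; field.
Qed.

Lemma p2_derive t : 0 <= t < rho -> 0 < lam t -> is_derive t 1 p2 0.
Proof.
move=> tr l0; have ds := is_derive_dot (dF2 tr) (dF2 tr).
apply: is_derive_eq (is_derive1Ml 2^-1 (is_derive1M ds (p3_derive tr l0))) _.
rewrite (dotC (F3 t)) schwarz_dot// (dotC (F2 t) (F1 t)) -/(a t) -/(s t) /p1.
by field.
Qed.

(** The second-order Taylor polynomial at 0 of [p t / p 0], that is of the square root of
    [lam 0 / lam t]. *)
Let P t := 1 - a 0 / lam 0 * t + s 0 / (4 * lam 0) * t ^+ 2.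

Section PositiveInterval.
Variable T : R.
Hypothesis Trho : T <= rho.
Hypothesis lam_gt0 : forall t, 0 <= t < T -> 0 < lam t.

Let in_rho t : 0 <= t < T -> 0 <= t < rho.
Proof. by move=> /andP[-> /lt_le_trans ->]. Qed.

Let zero_in t : 0 <= t < T -> 0 <= (0 : R) < T.
Proof. by move=> /andP[t0 tT]; rewrite lexx (le_lt_trans t0). Qed.

Lemma p_quadratic t : 0 <= t < T -> p t = p 0 * P t.
Proof.
move=> tT; have T0 := zero_in tT.
have dp u : 0 <= u < T -> is_derive u 1 p (p1 u).
  by move=> uT; apply: p_derive; [exact: in_rho | exact: lam_gt0].
have dp1 u : 0 <= u < T -> is_derive u 1 p1 (p2 u).
  by move=> uT; apply: p1_derive; [exact: in_rho | exact: lam_gt0].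
have dp2 u : 0 <= u < T -> is_derive u 1 p2 0.
  by move=> uT; apply: p2_derive; [exact: in_rho | exact: lam_gt0].
rewrite (taylor_quadratic dp dp1 dp2 tT).
have l0 := lam_gt0 T0.
have pp : p 0 * p 0 = (lam 0)^-1.
  by apply: (mulfI (lt0r_neq0 l0)); rewrite lam_p// mulfV ?lt0r_neq0.
rewrite /p1 /p2 pp /P; field; exact: lt0r_neq0.
Qed.

Lemma P_gt0 t : 0 <= t < T -> 0 < P t.
Proof.
move=> tT; have T0 := zero_in tT.
have p0 : 0 < p 0 by rewrite invr_gt0 sqrtr_gt0 lam_gt0.
have : 0 < p t by rewrite invr_gt0 sqrtr_gt0 lam_gt0.
by rewrite p_quadratic// pmulr_rgt0.
Qed.

Lemma line_formula t : 0 <= t < T ->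
  P t *: (F t - F 0) = t *: F1 0 + t ^+ 2 *: (2^-1 *: F2 0 - (a 0 / lam 0) *: F1 0).
Proof.
move=> tT; have T0 := zero_in tT.
have l0 := lam_gt0 T0.
have p0 : p 0 != 0 by rewrite gt_eqF// invr_gt0 sqrtr_gt0.
have pp : p 0 * p 0 = (lam 0)^-1.
  by apply: (mulfI (lt0r_neq0 l0)); rewrite lam_p// mulfV ?lt0r_neq0.
apply/rowP => i.
pose f u := F u 0 i; pose f1 u := F1 u 0 i; pose f2 u := F2 u 0 i.
have N : p t * f t = p 0 * f 0 + t * (p1 0 * f 0 + p 0 * f1 0)
    + t ^+ 2 / 2 * (p2 0 * f 0 + 2 * (p1 0 * f1 0) + p 0 * f2 0).
  apply: (@taylor_quadratic (fun u => p u * f u) (fun u => p1 u * f u + p u * f1 u)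
    (fun u => p2 u * f u + 2 * (p1 u * f1 u) + p u * f2 u) T) => // u uT;
    have ur := in_rho uT; have lu := lam_gt0 uT;
    have dp := p_derive ur lu; have dp1 := p1_derive ur lu; have dp2 := p2_derive ur lu;
    have df := is_derive_coord i (dF ur); have df1 := is_derive_coord i (dF1 ur);
    have df2 := is_derive_coord i (dF2 ur).
  - exact: is_derive1M.
  - apply: is_derive_eq (is_derive1D (is_derive1M dp1 df) (is_derive1M dp df1)) _.
    by rewrite /f /f1 /f2; cbv beta; ring.
  (* As [p] has third derivative zero, that of [p * f] is [3 * p2 * f1 + 3 * p1 * f2 + p * f3];
     multiplied by [lam u], it vanishes by [schwarz] and [lam u * (p u * p u) = 1]. *)
  - apply: is_derive_eq (is_derive1D (is_derive1D (is_derive1M dp2 df)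
      (is_derive1Ml 2 (is_derive1M dp1 df1))) (is_derive1M dp df2)) _.
    have := congr1 (fun M : 'rV[R]_m => M 0 i) (schwarz ur lu); rewrite /= !mxE => E.
    rewrite /f /f1 /f2; cbv beta; apply: (mulfI (lt0r_neq0 lu)).
    have -> : lam u * (0 * F u 0 i + p2 u * F1 u 0 i + 2 * (p2 u * F1 u 0 i
        + p1 u * F2 u 0 i) + (p1 u * F2 u 0 i + p u * F3 u 0 i)) =
      3 * lam u * (p2 u * F1 u 0 i + p1 u * F2 u 0 i) + p u * (lam u * F3 u 0 i) by ring.
    rewrite E /p1 /p2.
    have -> : 3 * lam u * (2^-1 * (s u * (p u * (p u * p u))) * F1 u 0 i
        + - (a u * (p u * (p u * p u))) * F2 u 0 i) =
      (lam u * (p u * p u)) * (3 * (2^-1 * (s u * p u) * F1 u 0 i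
        - (a u * p u) * F2 u 0 i)) by ring.
    by rewrite lam_p// mulr0; field.
rewrite !mxE -/(f t) -/(f 0) -/(f1 0) -/(f2 0).
have pt := p_quadratic tT.
have -> : P t * (f t - f 0) = (p t * f t - p t * f 0) / p 0 by rewrite pt; field.
rewrite N pt /p1 /p2 pp /P; field.
by rewrite p0 lt0r_neq0.
Qed.

End PositiveInterval.

Lemma lam_continuous t : 0 <= t < rho -> {for t, continuous lam}.
Proof.
move=> tr; apply: differentiable_continuous; apply/derivable1_diffP.
by have [] := lam_derive tr.
Qed.

(* Before the first zero of lam, the function 1 / sqrt lam is a bounded
   polynomial. *)
Lemma lam_gt0_everywhere : 0 < lam 0 -> forall t, 0 <= t < rho -> 0 < lam t.
Proof.
move=> l0 t1 /andP[t10 t1r]; rewrite lt_def dot_ge0 andbT; apply/eqP => lt1.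
pose Z := [set t | 0 <= t /\ (t < rho /\ lam t = 0)].
have Z1 : Z t1 by [].
have lbZ : lbound Z 0 by move=> u [].
have hZ : has_inf Z by split; [exists t1 | exists 0].
set T := inf Z.
have T0 : 0 <= T by exact: lb_le_inf hZ.1 lbZ.
have Tt1 : T <= t1 by apply: (ge_inf hZ.2).
have Tr : 0 <= T < rho by rewrite T0 (le_lt_trans Tt1).
have pos t : 0 <= t < T -> 0 < lam t.
  move=> /andP[t0 tT]; rewrite lt_def dot_ge0 andbT; apply/eqP => lt0.
  suff : T <= t by rewrite leNgt tT.
  apply: (ge_inf hZ.2); by split=> //; split=> //; apply: lt_trans tT _; case/andP: Tr.
have lT : lam T = 0.
  apply/eqP; apply/negPn/negP => lTn0.
  have lTp : 0 < lam T by rewrite lt_def lTn0 dot_ge0.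
  have /cvgrPdist_lt/(_ _ lTp)/nbhs_ballP[e /= e0 eb] := lam_continuous Tr.
  have [u [u0 [ur lu]] uT] := @inf_adherent _ Z e e0 hZ.
  have uT' : T <= u by apply: (ge_inf hZ.2); split.
  have : `|lam T - lam u| < lam T.
    by apply: eb; rewrite /ball/= distrC ger0_norm ?subr_ge0// ltrBlDl.
  by rewrite lu subr0 gtr0_norm// ltxx.
have T0' : 0 < T.
  by rewrite lt_def T0 andbT; apply: contraTneq l0 => T0'; rewrite -leNgt -[X in lam X]T0' lT.
have TT : 0 <= (0 : R) < T by rewrite lexx.
pose A := a 0 / lam 0; pose B := s 0 / (4 * lam 0).
pose M := 1 + `|A| * T + `|B| * T ^+ 2.
have PM t : 0 <= t < T -> P t <= M.
  move=> /andP[t0 tT]; rewrite /P /M -/A -/B lerD//.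
    rewrite lerD2l -mulNr; apply: le_trans (_ : `|A| * t <= _).
      by rewrite ler_wpM2r// -normrN ler_norm.
    by rewrite ler_wpM2l// ltW.
  apply: le_trans (_ : `|B| * t ^+ 2 <= _).
    by rewrite ler_wpM2r ?sqr_ge0// ler_norm.
  by rewrite ler_wpM2l// ler_sqr ?nnegrE// ltW.
have M0 : 0 < M by apply: lt_le_trans (PM 0 TT); apply: P_gt0 TT => //; case/andP: Tr => _ /ltW.
have p0 : 0 < p 0 by rewrite invr_gt0 sqrtr_gt0.
have d0 : 0 < (p 0 * M * (p 0 * M))^-1 by rewrite invr_gt0 !mulr_gt0.
have TrW : T <= rho by case/andP: Tr => _ /ltW.
have /cvgrPdist_lt/(_ _ d0)/nbhs_ballP[e /= e0 eb] := lam_continuous Tr.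
(* A point just before [T] where continuity forces [lam u] below the inverse square of [p 0 * M],
   although [lam u * p u ^+ 2 = 1] and [p u <= p 0 * M]. The first argument of the maximum keeps [u]
   nonnegative. *)
pose u := Num.max (T / 2) (T - e / 2).
have uT : 0 <= u < T by rewrite /u le_max gt_max; apply/andP; split; [apply/orP; left; lra|lra].
have : `|lam T - lam u| < (p 0 * M * (p 0 * M))^-1.
  apply: eb; rewrite /ball/=.
  have : T - e / 2 <= u by rewrite /u le_max lexx orbT.
  by case/andP: uT => u0 uT; rewrite ger0_norm ?subr_ge0 ?(ltW uT)//; lra.
rewrite lT sub0r normrN ger0_norm ?dot_ge0//.
apply/negP; rewrite -leNgt -[X in X <= _]mul1r ler_pdivrMr ?mulr_gt0//.
rewrite -(lam_p (pos u uT)) ler_wpM2l ?dot_ge0// (p_quadratic TrW pos uT).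
have Pu := P_gt0 TrW pos uT.
by rewrite ler_pM ?mulr_ge0 ?(ltW p0) ?(ltW Pu)// ler_pM2l// PM.
Qed.

Theorem line_moebius : 0 < lam 0 -> forall t, 0 <= t < rho ->
  [/\ 0 < lam t, 0 < P t &
  P t *: (F t - F 0) = t *: F1 0 + t ^+ 2 *: (2^-1 *: F2 0 - (a 0 / lam 0) *: F1 0)].
Proof.
move=> l0 t tr; have pos := lam_gt0_everywhere l0.
split; [exact: pos | exact: P_gt0 pos t tr | exact: line_formula pos t tr].
Qed.

End LineODE.

Lemma is_derive_line (R : realType) (V W : normedModType R) (f : V -> W) (z v : V)
    (t : R) d : is_derive (z + t *: v) v f d ->
  is_derive t 1 (fun s : R => f (z + s *: v)) d.
Proof.
have E : (fun h : R => h^-1 *: (((fun s : R => f (z + s *: v)) \o shift t) (h *: 1)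
      - f (z + t *: v))) =
    (fun h : R => h^-1 *: ((f \o shift (z + t *: v)) (h *: v) - f (z + t *: v))).
  apply/funext => h /=; congr (_ *: (f _ - _)).
  by rewrite -[h *: 1]/(h * 1) mulr1 scalerDl addrCA.
move=> [fd <-]; split; first by rewrite /derivable E.
by rewrite /derive E.
Qed.

(** * Moebius maps without zero or pole in a ball *)

(* phi is the Moebius map x |-> w + (y - |y|^2 g) / Q y with y = L x, whose pole
   is y = g / |g|^2.  It vanishes in the ball of radius rho as soon as
   2 |w| < sqrt lam * rho. *)
Section MoebiusBounds.
Variables (R : realType) (m : nat) (L phi : 'rV[R]_m -> 'rV[R]_m).
Variables (g w : 'rV[R]_m) (lam rho : R).
Hypothesis Llin : forall a h k, L (a *: h + k) = a *: L h + L k.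
Hypothesis lam_gt0 : 0 < lam.
Hypothesis Lsim : forall h k, dot (L h) (L k) = lam * dot h k.
Hypothesis rho_gt0 : 0 < rho.
Let Q y := 1 - 2 * dot g y + dot g g * dot y y.
Hypothesis Q_gt0 : forall x, len x < rho -> 0 < Q (L x).
Hypothesis phiE : forall x, len x < rho ->
  Q (L x) *: (phi x - w) = L x - dot (L x) (L x) *: g.
Hypothesis phi_neq0 : forall x, len x < rho -> phi x <> 0.
Let S := Num.sqrt lam * rho.

Let sl_gt0 : 0 < Num.sqrt lam. Proof. by rewrite sqrtr_gt0. Qed.
Let S_gt0 : 0 < S. Proof. exact: mulr_gt0. Qed.

Lemma len_simil x : len (L x) = Num.sqrt lam * len x.
Proof. by rewrite /len Lsim sqrtrM// ltW. Qed.

Lemma simil_ball y : len y < S -> exists2 x, L x = y & len x < rho.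
Proof.
move=> yS; have [x xy] := similarity_surj Llin lam_gt0 Lsim y.
by exists x => //; move: yS; rewrite -xy len_simil /S ltr_pM2l.
Qed.

(** Otherwise the pole, of length [1 / len g], lies in the image of the ball under [L]; there [Q] is
    positive, but it vanishes at the pole. *)
Lemma pole_bound : len g * S <= 1.
Proof.
rewrite leNgt; apply/negP => gS.
have g0 : g != 0 by apply: contraTneq gS => ->; rewrite len0 mul0r -leNgt.
have lg : 0 < len g by exact: len_gt0.
pose y := (dot g g)^-1 *: g.
have ly : len y < S.
  rewrite /y lenZ -len_sqr normfV ger0_norm ?sqr_ge0//.
  have -> : (len g ^+ 2)^-1 * len g = (len g)^-1 by field; rewrite gt_eqF.
  by rewrite -[X in X < _]mul1r ltr_pdivrMr// mulrC.
have [x xy xr] := simil_ball ly; have := Q_gt0 xr.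
rewrite xy /Q /y !dotE; have := dot_gt0 g0; set q := dot g g => q0.
have -> : 1 - 2 * (q^-1 * q) + q * (q^-1 * (q^-1 * q)) = 0.
  by field; rewrite gt_eqF.
by rewrite ltxx.
Qed.

Lemma Q_ge y : (1 - len g * len y) ^+ 2 <= Q y.
Proof.
rewrite /Q -!len_sqr; have := dot_le_len g y.
have -> : (1 - len g * len y) ^+ 2 =
  1 - 2 * (len g * len y) + len g ^+ 2 * len y ^+ 2 by ring.
lra.
Qed.

Lemma value_bound : S <= 2 * len w.
Proof.
rewrite leNgt; apply/negP => wS.
have gw : len g * len w <= 2^-1.
  have := pole_bound; have := len_ge0 g; have := len_ge0 w => w0 g0 gS.
  have : len g * (2 * len w) <= len g * S by rewrite ler_wpM2l// ltW.
  by lra.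
have [v vE] : exists v, v = - w by exists (- w).
pose q := 1 + 2 * dot g v + dot g g * dot v v.
(* Since [len g * len w <= 1/2], the lower bound [Q_ge] applies with [1 - len g * len w >= 1/2]. *)
have q4 : 4^-1 <= q.
  have := Q_ge w; rewrite /Q /q vE !dotE opprK => H.
  have : (2^-1) ^+ 2 <= (1 - len g * len w) ^+ 2.
    by rewrite ler_sqr ?nnegrE ?subr_ge0; lra.
  lra.
have q0 : 0 < q by lra.
have qn : q != 0 by rewrite gt_eqF.
(* The zero of [phi]. The map [y |-> (y - dot y y *: g) / Q y] is an inversion, a translation by
   [- g] and an inversion again, so its inverse has the same form with [- g] for [g]; here it is
   evaluated at [v = - w]. *)
pose y := q^-1 *: (v + dot v v *: g).
have yy : dot y y = dot v v / q.
  rewrite /y !dotE (dotC v g) -[RHS]/(dot v v / q).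
  apply: (mulfI (mulf_neq0 qn qn)); set G := dot g g; set gv := dot g v; set vv := dot v v.
  transitivity (vv * q); last by field.
  by rewrite /q -/gv -/G -/vv; field; move: qn; rewrite /q -/gv -/G -/vv; lra.
have gy : dot g y = (dot g v + dot v v * dot g g) / q.
  by rewrite /y !dotE mulrC.
have ly : len y < S.
  rewrite -ltr_sqr ?nnegrE ?len_ge0 ?(ltW S_gt0)// len_sqr yy ltr_pdivrMr//.
  rewrite vE !dotE opprK -len_sqr.
  have : (2 * len w) ^+ 2 < S ^+ 2.
    by rewrite ltr_sqr ?nnegrE ?mulr_ge0 ?len_ge0// ltW.
  have : S ^+ 2 * 4^-1 <= S ^+ 2 * q by rewrite ler_wpM2l// sqr_ge0.
  by rewrite exprMn; lra.
have [x xy xr] := simil_ball ly.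
have QE : Q y = q^-1.
  rewrite /Q gy yy; apply: (mulfI qn); rewrite mulfV//.
  transitivity (q - 2 * (dot g v + dot v v * dot g g) + dot g g * dot v v).
    by field.
  by rewrite /q; ring.
have := phiE xr; rewrite xy QE yy => H.
apply: (phi_neq0 xr); apply/eqP; rewrite -[phi x](subrK w) addr_eq0; apply/eqP.
apply: (scalerI (invr_neq0 qn)); rewrite H /y -vE.
by rewrite scalerDr scalerA [q^-1 * _]mulrC addrK.
Qed.

(** On the half ball [len g * len y <= 1/2], hence [Q y >= 1/4]. Then [len (phi x - w) <= 2 * len y
    <= S <= 2 * len w], and adding [len w] gives the 3. For the remainder, the numerator contributes
    4, the bound on [Q] another 4, and [S <= 2 * len w] the last factor 2 of 32. *)
Lemma moebius_est x : len x <= rho / 2 ->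
  len (phi x) <= 3 * len w /\
  len (phi x - w - L x) <= 32 * len w * (len x / rho) ^+ 2.
Proof.
move=> x2; have xr : len x < rho by have := rho_gt0; lra.
set y := L x.
have ly : len y = Num.sqrt lam * len x by rewrite /y len_simil.
have yS : len y <= S / 2.
  by rewrite ly /S -mulrA ler_wpM2l// ltW.
have g0 := len_ge0 g; have y0 := len_ge0 y; have gS := pole_bound.
have gy : len g * len y <= 2^-1.
  have : len g * len y <= len g * (S / 2) by rewrite ler_wpM2l.
  lra.
have Q4 : 4^-1 <= Q y.
  apply: le_trans (Q_ge y); have : (2^-1) ^+ 2 <= (1 - len g * len y) ^+ 2.
    by rewrite ler_sqr ?nnegrE ?subr_ge0; lra.
  lra.
have Q0 : 0 < Q y by lra.
have wS := value_bound.
have H : Q y *: (phi x - w) = y - dot y y *: g by exact: phiE.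
split.
- suff : len (phi x - w) <= 2 * len w.
    by move=> Hd; rewrite -[phi x](subrK w); apply: le_trans (lenD _ _) _; lra.
  apply: le_trans wS; apply: le_trans (_ : 2 * len y <= _); last lra.
  have E : Q y * len (phi x - w) ^+ 2 = len y ^+ 2.
    apply: (mulfI (lt0r_neq0 Q0)); transitivity ((Q y * len (phi x - w)) ^+ 2).
      by ring.
    rewrite -[Q y in LHS]ger0_norm ?(ltW Q0)// -lenZ H !len_sqr !dotE (dotC y g) /Q.
    by ring.
  rewrite -ler_sqr ?nnegrE ?mulr_ge0 ?len_ge0// exprMn -E.
  have : 4^-1 * len (phi x - w) ^+ 2 <= Q y * len (phi x - w) ^+ 2.
    by rewrite ler_wpM2r// sqr_ge0.
  lra.
- have E : Q y *: (phi x - w - y) =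
      (2 * dot g y) *: y - dot y y *: g - (dot g g * dot y y) *: y.
    by rewrite scalerBr H /Q; apply/rowP => k; rewrite !mxE; ring.
  have N : Q y * len (phi x - w - y) <= 4 * (len g * len y ^+ 2).
    rewrite -[Q y in leLHS]ger0_norm ?(ltW Q0)// -lenZ E.
    have -> : 4 * (len g * len y ^+ 2) =
      2 * (len g * len y ^+ 2) + len g * len y ^+ 2 + len g * len y ^+ 2 by ring.
    do ?apply: lenD_le.
    + rewrite lenZ normrM (ger0_norm (ler0n _ 2)) -mulrA ler_wpM2l//.
      by rewrite expr2 mulrA ler_wpM2r// cauchy_schwarz.
    + by rewrite lenN lenZ ger0_norm ?dot_ge0// -len_sqr mulrC.
    + rewrite lenN lenZ ger0_norm ?mulr_ge0 ?dot_ge0// -!len_sqr.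
      have -> : len g ^+ 2 * len y ^+ 2 * len y =
        (len g * len y) * (len g * len y ^+ 2) by ring.
      rewrite ler_piMl ?mulr_ge0 ?sqr_ge0//; lra.
  have N4 : len (phi x - w - y) <= 16 * (len g * len y ^+ 2).
    have : 4^-1 * len (phi x - w - y) <= Q y * len (phi x - w - y).
      by rewrite ler_wpM2r// len_ge0.
    lra.
  apply: le_trans N4 _.
  have -> : 16 * (len g * len y ^+ 2) = 16 * (len g * S) * S * (len x / rho) ^+ 2.
    by rewrite ly /S; field; rewrite gt_eqF.
  apply: ler_wpM2r; first exact: sqr_ge0.
  have : 16 * (len g * S) * S <= 16 * 1 * S.
    by rewrite ler_wpM2r ?(ltW S_gt0)// ler_wpM2l.
  lra.
Qed.

Lemma moebius_derive_est x : len (L x) <= 2 * len w * (len x / rho).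
Proof.
rewrite len_simil; have := value_bound => H.
have -> : Num.sqrt lam * len x = S * (len x / rho).
  by rewrite /S; field; rewrite gt_eqF.
by rewrite ler_wpM2r// divr_ge0 ?len_ge0// ltW.
Qed.

End MoebiusBounds.

(** * Estimates in one variable *)

(** Translates the coefficients of [line_formula], given by derivatives along the line, into the
    vector [g] of a Moebius map. *)
Lemma pole_form (R : realType) m (l b p : 'rV[R]_m) (lam be t : R) : lam != 0 ->
  dot l l = lam -> dot p l = lam * be -> lam *: b = be *: l + be *: l - p ->
  lam * dot b b = dot p p / lam ->
  let g := (2 * lam ^+ 2)^-1 *: p in
  1 - 2 * dot g (t *: l) + dot g g * dot (t *: l) (t *: l) =
    1 - be / lam * t + dot b b / (4 * lam) * t ^+ 2 /\
  t *: l + t ^+ 2 *: (2^-1 *: b - (be / lam) *: l) =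
    t *: l - dot (t *: l) (t *: l) *: g.
Proof.
move=> ln ll pl bE bb g; split.
  have -> : dot b b = dot p p / lam ^+ 2 by apply: (mulfI ln); rewrite bb; field.
  by rewrite /g !dotE ll pl; field.
have -> : b = lam^-1 *: (be *: l + be *: l - p).
  by apply: (scalerI ln); rewrite bE scalerA mulfV// scale1r.
rewrite /g !dotE ll; apply/rowP => i; rewrite !mxE.
by field.
Qed.

Section ConformalByRows.
Variables (R : realType) (r n : nat).
Hypothesis r1 : (1 < r)%N.
Hypothesis r3 : (r <= 3)%N.
Local Notation V := (cdspace R r n).
Local Notation K := (cdalg R r).
Variables (U : set V) (f : V -> K).
Hypothesis openU : open U.
Hypothesis fan : analytic U f.
Hypothesis forth : forall (j : 'I_n) z h k, U z -> dot h k = 0 ->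
  dot ('D_(setrow0 j h) f z) ('D_(setrow0 j k) f z) = 0.

Let e0 : K := cdgen R r 0.

Lemma dot_cdgen0 : dot e0 e0 = 1.
Proof.
rewrite /dot (bigD1 (Ordinal (cd_pos r)))//= !mxE/= mulr1 big1 ?addr0// => k k0.
rewrite !mxE (_ : (k : nat) == 0%N = false) ?mul0r//.
by apply: contra_neqF k0 => /eqP k0; apply: val_inj.
Qed.

Section Row.
Variable j : 'I_n.
Let L z h := 'D_(setrow0 j h) f z.
Let B z h k := 'D_(setrow0 j h) (fun y => L y k) z.
Let C z p h k := 'D_(setrow0 j p) (fun y => B y h k) z.
(** The conformal factor is read off at the fixed vector [e0], which makes its differentiability
    evident; [be] is half its derivative and [mu] the derivative of [be]. *)
Let lam z := dot (L z e0) (L z e0).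
Let be z l := dot (B z l e0) (L z e0).
Let mu z p l := dot (C z p l e0) (L z e0) + dot (B z l e0) (B z p e0).

Lemma row_derive_lin z a h k : U z -> L z (a *: h + k) = a *: L z h + L z k.
Proof. by move=> Uz; rewrite /L setrow0_lin; exact: analytic_derive_lin Uz. Qed.

Lemma row_is_derive1 z v h : U z ->
  is_derive z (setrow0 j v) (fun y => L y h) (B z v h).
Proof. by move=> Uz; exact: analytic_is_derive (analytic_derive r3 _ fan) Uz. Qed.

Lemma row_is_derive2 z v h k : U z ->
  is_derive z (setrow0 j v) (fun y => B y h k) (C z v h k).
Proof.
move=> Uz; apply: (analytic_is_derive r3 (O := U)) => //.
exact: analytic_derive (analytic_derive r3 _ fan).
Qed.

Lemma row_swap2 z h k : U z -> B z h k = B z k h.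
Proof. by move=> Uz; exact: analytic_swap fan Uz. Qed.

Lemma row_swap12 z p h k : U z -> C z p h k = C z h p k.
Proof. by move=> Uz; exact: analytic_swap (analytic_derive r3 _ fan) Uz. Qed.

Lemma row_swap23 z p h k : U z -> C z p h k = C z p k h.
Proof.
move=> Uz; apply: (is_derive_open_eq openU Uz (fun y Uy => row_swap2 h k Uy)).
  exact: row_is_derive2.
exact: row_is_derive2.
Qed.

Lemma row_conformal0 z h k : U z -> dot (L z h) (L z k) = lam z * dot h k.
Proof.
move=> Uz; apply: orthogonal_similarity dot_cdgen0 _ _ _.
- by move=> a u v; exact: row_derive_lin.
- by move=> u v; exact: forth.
Qed.

Lemma row_lam_derive z v : U z -> is_derive z (setrow0 j v) lam (2 * be z v).
Proof.
move=> Uz; have d := row_is_derive1 v e0 Uz.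
by apply: is_derive_eq (is_derive_dot d d) _; rewrite (dotC (L z e0)) /be; ring.
Qed.

Lemma row_be_derive z v l : U z ->
  is_derive z (setrow0 j v) (fun y => be y l) (mu z v l).
Proof.
by move=> Uz; exact: is_derive_dot (row_is_derive2 v l e0 Uz) (row_is_derive1 v e0 Uz).
Qed.

Lemma row_conformal1 z l h k : U z ->
  dot (B z l h) (L z k) + dot (L z h) (B z l k) = 2 * be z l * dot h k.
Proof.
move=> Uz; have E y : U y -> dot (L y h) (L y k) = dot h k * lam y.
  by move=> Uy; rewrite row_conformal0// mulrC.
rewrite mulrC; apply: (is_derive_open_eq openU Uz E).
  exact: is_derive_dot (row_is_derive1 l h Uz) (row_is_derive1 l k Uz).
exact: is_deriveZ (row_lam_derive l Uz).
Qed.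

Lemma row_conformal2 z p l h k : U z ->
  dot (C z p l h) (L z k) + dot (B z l h) (B z p k) + (dot (B z p h) (B z l k)
    + dot (L z h) (C z p l k)) = 2 * mu z p l * dot h k.
Proof.
move=> Uz; have E y : U y -> dot (B y l h) (L y k) + dot (L y h) (B y l k) =
    (2 * dot h k) * be y l.
  by move=> Uy; rewrite row_conformal1//; ring.
have -> : 2 * mu z p l * dot h k = (2 * dot h k) * mu z p l by ring.
apply: (is_derive_open_eq openU Uz E).
  have d1 m := row_is_derive1 p m Uz; have d2 m := row_is_derive2 p l m Uz.
  exact: is_deriveD (is_derive_dot (d2 h) (d1 k)) (is_derive_dot (d1 h) (d2 k)).
exact: is_deriveZ (row_be_derive p l Uz).
Qed.

Let pole z := jet_pole (L z) (B z) (lam z) (be z) e0.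

Lemma two_lt_dim : (2 < 2 ^ r)%N.
Proof. by case: r r1 => [|[|s]]// _; rewrite !expnS; have := cd_pos s; lia. Qed.

Lemma row_dot12 y e : U y -> dot e e = 1 -> dot (L y e) (B y e e) = be y e.
Proof.
move=> Uy; apply: dot_first_second.
- exact: (fun h k => row_swap2 h k Uy).
- exact: (fun l h k => row_conformal1 l h k Uy).
Qed.

Lemma row_schwarz y e : U y -> dot e e = 1 -> 0 < lam y ->
  lam y *: C y e e e = (3 * be y e) *: B y e e
    - (3 / 2 * dot (B y e e) (B y e e)) *: L y e.
Proof.
move=> Uy e1 ly; exact: (third_jet two_lt_dim
  (fun a h k => row_derive_lin a h k Uy) (fun h k => row_swap2 h k Uy)
  (fun p l h => row_swap12 p l h Uy) (fun p l h => row_swap23 p l h Uy)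
  ly dot_cdgen0 (fun h k => row_conformal0 h k Uy)
  (fun l h k => row_conformal1 l h k Uy) (fun p l h k => row_conformal2 p l h k Uy) e1).
Qed.

Lemma row_second y e : U y -> dot e e = 1 -> 0 < lam y ->
  lam y * dot (B y e e) (B y e e) = dot (pole y) (pole y) / lam y.
Proof.
move=> Uy e1 ly; exact: (dot_second (fun a h k => row_derive_lin a h k Uy)
  (fun h k => row_swap2 h k Uy) ly dot_cdgen0 (fun h k => row_conformal0 h k Uy)
  (fun l h k => row_conformal1 l h k Uy) e1).
Qed.

Lemma row_second_jet y e : U y -> dot e e = 1 -> 0 < lam y ->
  lam y *: B y e e = be y e *: L y e + be y e *: L y e - dot e e *: pole y.
Proof.
move=> Uy e1 ly; exact: (second_jet (fun a h k => row_derive_lin a h k Uy)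
  (fun h k => row_swap2 h k Uy) ly dot_cdgen0 (fun h k => row_conformal0 h k Uy)
  (fun l h k => row_conformal1 l h k Uy) e e).
Qed.

Lemma row_dot_pole y h : U y -> dot (pole y) (L y h) = lam y * be y h.
Proof.
move=> Uy; exact: (dot_pole (fun h k => row_swap2 h k Uy) dot_cdgen0
  (fun h k => row_conformal0 h k Uy) (fun l h k => row_conformal1 l h k Uy) h).
Qed.

Lemma row_line z e rho : dot e e = 1 -> 0 < lam z ->
  (forall t, 0 <= t < rho -> U (z + t *: setrow0 j e)) ->
  forall t, 0 <= t < rho ->
  let g := (2 * lam z ^+ 2)^-1 *: pole z in
  let Q := 1 - 2 * dot g (t *: L z e) + dot g g * dot (t *: L z e) (t *: L z e) in
  [/\ 0 < lam (z + t *: setrow0 j e), 0 < Q &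
    Q *: (f (z + t *: setrow0 j e) - f z) =
    t *: L z e - dot (t *: L z e) (t *: L z e) *: g].
Proof.
move=> e1 lz Ut t tr.
have r0 : 0 <= (0 : R) < rho by case/andP: tr => t0 tr; rewrite lexx (le_lt_trans t0).
have Uz : U z by have := Ut 0 r0; rewrite scale0r addr0.
pose v := setrow0 j e.
have lamE y : U y -> dot (L y e) (L y e) = lam y.
  by move=> Uy; rewrite row_conformal0// e1 mulr1.
pose F (s : R) := f (z + s *: v); pose F1 (s : R) := L (z + s *: v) e.
pose F2 (s : R) := B (z + s *: v) e e; pose F3 (s : R) := C (z + s *: v) e e e.
have dF s : 0 <= s < rho -> is_derive s 1 F (F1 s).
  by move=> sr; apply: is_derive_line; exact: analytic_is_derive fan (Ut s sr).
have dF1 s : 0 <= s < rho -> is_derive s 1 F1 (F2 s).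
  move=> sr; apply: (@is_derive_line _ _ _ (fun y => L y e)).
  exact: row_is_derive1 (Ut s sr).
have dF2 s : 0 <= s < rho -> is_derive s 1 F2 (F3 s).
  move=> sr; apply: (@is_derive_line _ _ _ (fun y => B y e e)).
  exact: row_is_derive2 (Ut s sr).
have sch s : 0 <= s < rho -> 0 < dot (F1 s) (F1 s) ->
    dot (F1 s) (F1 s) *: F3 s = (3 * dot (F1 s) (F2 s)) *: F2 s
      - (3 / 2 * dot (F2 s) (F2 s)) *: F1 s.
  move=> sr; have Us := Ut s sr; rewrite /F1 /F2 /F3 lamE// row_dot12// => ls.
  exact: row_schwarz.
have z0 : z + 0 *: v = z by rewrite scale0r addr0.
have F0E : F 0 = f z by rewrite /F z0.
have F10E : F1 0 = L z e by rewrite /F1 z0.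
have F20E : F2 0 = B z e e by rewrite /F2 z0.
have l0 : 0 < dot (F1 0) (F1 0) by rewrite F10E lamE.
have FtE : F t = f (z + t *: v) by [].
have F1tE : F1 t = L (z + t *: v) e by [].
have := line_moebius dF dF1 dF2 sch l0 tr.
clearbody F F1 F2 F3; clear dF dF1 dF2 sch l0.
rewrite FtE F1tE F0E F10E F20E (lamE _ Uz) (lamE _ (Ut t tr)).
have fs := row_dot12 Uz e1; have ss := row_second Uz e1 lz.
have sj := row_second_jet Uz e1 lz; have gL := row_dot_pole e Uz.
have ln : lam z != 0 by rewrite gt_eqF.
rewrite fs; clearbody pole be mu lam C B L.
have le : dot (L z e) (L z e) = lam z by exact: lamE.
rewrite e1 scale1r in sj.
have [QE NE] := pole_form t ln le gL sj ss.
by move=> [lt Qt FE] g Q; rewrite /Q /g QE -NE -FE.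
Qed.

Section Ball.
Variables (z : V) (rho : R).
Hypothesis rho_gt0 : 0 < rho.
Hypothesis ballU : forall x, len x < rho -> U (z + setrow0 j x).

Let Uz : U z.
Proof. by have := ballU (x := 0); rewrite len0 setrow0_0 addr0; apply. Qed.

Lemma unit_direction (x : K) : x != 0 ->
  dot ((len x)^-1 *: x) ((len x)^-1 *: x) = 1 /\ x = len x *: ((len x)^-1 *: x).
Proof.
move=> x0; have lx : len x != 0 by rewrite gt_eqF// len_gt0.
rewrite !dotE mulrA -invfM -expr2 len_sqr mulVf ?gt_eqF ?dot_gt0//.
by rewrite scalerA mulfV// scale1r.
Qed.

Lemma row_zero_at (y : V) h : U y -> lam y = 0 -> L y h = 0.
Proof.
by move=> Uy ly; apply: dot_eq0; have := row_conformal0 h h Uy; rewrite ly mul0r.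
Qed.

(** By [row_line], positivity of [lam] propagates along segments. From a far end with [lam] positive
    it would travel back to [z] in direction [- e]. *)
Lemma row_lam_zero e s : dot e e = 1 -> lam z = 0 -> 0 <= s < rho ->
  lam (z + s *: setrow0 j e) = 0.
Proof.
move=> e1 lz sr; apply/eqP/negPn/negP => ls.
have lp : 0 < lam (z + s *: setrow0 j e) by rewrite lt_def ls dot_ge0.
have ne1 : dot (- e) (- e) = 1 by rewrite dotNl dotNr opprK.
have le : len e = 1 by rewrite /len e1 sqrtr1.
have Ut t : 0 <= t < rho -> U (z + s *: setrow0 j e + t *: setrow0 j (- e)).
  move=> tr; rewrite -addrA -!setrow0Z -setrow0D; apply: ballU.
  have -> : s *: e + t *: - e = (s - t) *: e by rewrite scalerBl scalerN.
  rewrite lenZ le mulr1 ltr_norml; move: sr tr => /andP[s0 sr] /andP[t0 tr].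
  by apply/andP; split; lra.
have [+ _ _] := row_line ne1 lp Ut sr.
by rewrite -addrA -!setrow0Z -setrow0D scalerN subrr setrow0_0 addr0 lz ltxx.
Qed.

Lemma row_const x : lam z = 0 -> len x < rho -> f (z + setrow0 j x) = f z.
Proof.
move=> lz xr; have [->|x0] := eqVneq x 0; first by rewrite setrow0_0 addr0.
have [] := unit_direction x0; set e := _ *: x => e1 xe.
have lx : 0 < len x by exact: len_gt0.
rewrite xe setrow0Z; apply/rowP => i; set v := setrow0 j e.
transitivity (f (z + 0 *: v) 0 i); last by rewrite scale0r addr0.
apply: (@is_derive_zero_const _ (fun s => f (z + s *: v) 0 i)); first exact: ltW.
move=> s /andP[s0 sx]; have sr : 0 <= s < rho by rewrite s0 (le_lt_trans sx).
have Us : U (z + s *: v).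
  rewrite -setrow0Z; apply: ballU.
  by rewrite lenZ ger0_norm// /len e1 sqrtr1 mulr1; case/andP: sr.
have := is_derive_coord i (is_derive_line (analytic_is_derive r3 v fan Us)).
have -> : 'D_v f (z + s *: v) = 0.
  by apply: (row_zero_at e Us); exact: row_lam_zero.
by rewrite mxE.
Qed.

Hypothesis f_neq0 : forall y, U y -> f y <> 0.

(** If [lam z = 0] the slice is constant on the ball; otherwise it is a Moebius map there and has
    neither zero nor pole. *)
Lemma row_est :
  (forall h, len (L z h) <= 2 * len (f z) * (len h / rho)) /\
  forall x, len x <= rho / 2 -> len (f (z + setrow0 j x)) <= 3 * len (f z) /\
    len (f (z + setrow0 j x) - f z - L z x) <= 32 * len (f z) * (len x / rho) ^+ 2.
Proof.
have [lz|lz] := eqVneq (lam z) 0.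
  split=> [h|x x2].
    by rewrite (row_zero_at h Uz lz) len0 !mulr_ge0 ?invr_ge0 ?len_ge0// ltW.
  have xr : len x < rho by have := rho_gt0; lra.
  rewrite (row_const lz xr) (row_zero_at x Uz lz) subrr subr0 len0.
  split; first by have := len_ge0 (f z); lra.
  by rewrite mulr_ge0 ?sqr_ge0// mulr_ge0 ?len_ge0.
have lp : 0 < lam z by rewrite lt_def lz dot_ge0.
pose g := (2 * lam z ^+ 2)^-1 *: pole z.
(* The formulas along the rays from [z] fit together into one Moebius map, since [g] does not depend
   on the direction. *)
have key x : len x < rho ->
    0 < 1 - 2 * dot g (L z x) + dot g g * dot (L z x) (L z x) /\
    (1 - 2 * dot g (L z x) + dot g g * dot (L z x) (L z x)) *:
      (f (z + setrow0 j x) - f z) = L z x - dot (L z x) (L z x) *: g.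
  move=> xr; have lin a h k := row_derive_lin a h k Uz.
  have [->|x0] := eqVneq x 0.
    rewrite setrow0_0 addr0 (simil0 lin) !dot0r subrr scaler0 scale0r subr0.
    by rewrite !mulr0 subr0 addr0.
  have [] := unit_direction x0; set e := _ *: x => e1 xe.
  have tr : 0 <= len x < rho by rewrite len_ge0.
  have Ut t : 0 <= t < rho -> U (z + t *: setrow0 j e).
    move=> /andP[t0 tr']; rewrite -setrow0Z; apply: ballU.
    by rewrite lenZ ger0_norm// /len e1 sqrtr1 mulr1.
  have [_ Qp QE] := row_line e1 lp Ut tr.
  by rewrite -(similZ lin) -setrow0Z -xe in Qp QE.
have phi0 x : len x < rho -> f (z + setrow0 j x) <> 0.
  by move=> xr; apply: f_neq0; exact: ballU.
have lin a h k := row_derive_lin a h k Uz.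
have sim h k := row_conformal0 h k Uz.
have Qp x xr := proj1 (key x xr); have QE x xr := proj2 (key x xr).
split.
  exact: (moebius_derive_est (phi := fun x => f (z + setrow0 j x)) lin lp sim rho_gt0 Qp QE phi0).
exact: (moebius_est (phi := fun x => f (z + setrow0 j x)) lin lp sim rho_gt0 Qp QE phi0).
Qed.

End Ball.

End Row.
End ConformalByRows.

(** * Estimates in several variables *)

Section SeveralVariables.
Variables (R : realType) (r n : nat).
Local Notation V := (cdspace R r n).
Local Notation K := (cdalg R r).
Implicit Types (x y z h : V).

(** A norm adapted to moving one coordinate at a time: the steps from [z] to [z + h] have total
    length exactly [sumlen h]. *)
Definition sumlen x : R := \sum_(j < n) len (row j x).

Lemma sumlen_ge0 x : 0 <= sumlen x.
Proof. by apply: sumr_ge0 => j _; exact: len_ge0. Qed.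

Lemma sumlenD x y : sumlen (x + y) <= sumlen x + sumlen y.
Proof.
by rewrite -big_split; apply: ler_sum => j _; rewrite linearD; exact: lenD.
Qed.

Lemma sumlenN x : sumlen (- x) = sumlen x.
Proof. by apply: eq_bigr => j _; rewrite linearN lenN. Qed.

Lemma sumlenB x y : sumlen (x - y) = sumlen (y - x).
Proof. by rewrite -sumlenN opprB. Qed.

Lemma sumlen0 : sumlen 0 = 0.
Proof. by rewrite /sumlen big1// => j _; rewrite linear0 len0. Qed.

Lemma sumlen_tri y x z : sumlen (x - z) <= sumlen (x - y) + sumlen (y - z).
Proof. by rewrite -[x - z](subrKA y); exact: sumlenD. Qed.

Lemma len_row_le x j : len (row j x) <= sumlen x.
Proof.
by rewrite /sumlen (bigD1 j)//= lerDl; apply: sumr_ge0 => i _; exact: len_ge0.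
Qed.

Lemma sumlen_setrow0 (j : 'I_n) (a : K) : sumlen (setrow0 j a) = len a.
Proof.
rewrite /sumlen (bigD1 j)//= row_setrow0 eqxx big1 ?addr0// => i ij.
by rewrite row_setrow0 (negPf ij) len0.
Qed.

Lemma norm_le_sumlen x : `|x| <= sumlen x.
Proof.
rewrite [leLHS]/Num.norm/= mx_normrE; apply/bigmax_leP; split.
  exact: sumlen_ge0.
move=> [i k] _ /=; apply: le_trans (len_row_le x i).
by have := len_coord (row i x) k; rewrite mxE.
Qed.

Lemma sumlen_le_norm : exists2 c : R, 0 < c & forall x, sumlen x <= c * `|x|.
Proof.
exists (n%:R * (2 ^ r).+1%:R + 1); first by rewrite ltr_wpDl// mulr_ge0.
move=> x; apply: le_trans (_ : \sum_(j < n) (2 ^ r).+1%:R * `|x| <= _).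
  by apply: ler_sum => j _; exact: bounded_rows_norm.
rewrite sumr_const card_ord -[leLHS]mulr_natl mulrDl mulrA mul1r lerDl.
exact: normr_ge0.
Qed.

Lemma len_sum (u : nat -> K) N : len (\sum_(i < N) u i) <= \sum_(i < N) len (u i).
Proof.
elim: N => [|N IH]; first by rewrite !big_ord0 len0.
by rewrite !big_ord_recr/=; apply: lenD_le.
Qed.

Definition path_point z h i : V := z + \sum_(j < n | (j < i)%N) setrow0 j (row j h).

Lemma path_point0 z h : path_point z h 0 = z.
Proof. by rewrite /path_point big1 ?addr0. Qed.

Lemma path_point_end z h : path_point z h n = z + h.
Proof.
rewrite /path_point -[in RHS](sum_setrow0 h); congr (_ + _).
by apply: eq_bigl => j; rewrite ltn_ord.
Qed.

Lemma path_pointS z h (i : 'I_n) :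
  path_point z h i.+1 = path_point z h i + setrow0 i (row i h).
Proof.
rewrite /path_point -addrA; congr (_ + _).
rewrite (bigD1 i)/= ?leqnn// addrC; congr (_ + _).
by apply: eq_bigl => j; rewrite ltnS andbC ltn_neqAle.
Qed.

Lemma path_point_near z h i : sumlen (path_point z h i - z) <= sumlen h.
Proof.
rewrite addrAC subrr add0r.
apply: le_trans (_ : \sum_(j < n | (j < i)%N) len (row j h) <= _).
  elim/big_ind2 : _ => [|x1 x2 y1 y2 xy1 xy2|j _]; first by rewrite sumlen0.
    exact: le_trans (sumlenD _ _) (lerD xy1 xy2).
  by rewrite sumlen_setrow0.
rewrite /sumlen [leRHS](bigID (fun j : 'I_n => (j < i)%N))/= lerDl.
by apply: sumr_ge0 => j _; exact: len_ge0.
Qed.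

Lemma path_point_ball z0 z h i d d' : sumlen (z - z0) <= d -> sumlen h <= d' ->
  sumlen (path_point z h i - z0) <= d + d'.
Proof.
move=> zd hd; apply: le_trans (sumlen_tri z _ _) _.
by rewrite addrC lerD// (le_trans (path_point_near z h i)).
Qed.

(** The conclusions of [row_est] in terms of the Frechet differential: all that is retained of
    conformality from here on. *)
Definition slice_bounded (U : set V) (f : V -> K) :=
  (forall z, U z -> differentiable f z) /\
  forall (j : 'I_n) z rho, 0 < rho ->
    (forall a, len a < rho -> U (z + setrow0 j a)) ->
    (forall a, len ('d f z (setrow0 j a)) <= 2 * len (f z) * (len a / rho)) /\
    forall a, len a <= rho / 2 ->
      len (f (z + setrow0 j a)) <= 3 * len (f z) /\
      len (f (z + setrow0 j a) - f z - 'd f z (setrow0 j a)) <=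
        32 * len (f z) * (len a / rho) ^+ 2.

Section LocalEstimates.
Variables (U : set V) (f : V -> K).
Hypothesis fU : slice_bounded U f.

(** Every point of the path is within [d / 2] of [z], so a coordinate ball of radius [d] is
    available there; each of the [n] steps is at most half that radius and costs a factor 3. *)
Lemma harnack z d h : 0 < d -> (forall y, sumlen (y - z) < 2 * d -> U y) ->
  sumlen h <= d / 2 -> len (f (z + h)) <= 3 ^+ n * len (f z).
Proof.
move=> d0 zU hd; rewrite -path_point_end.
suff H i : (i <= n)%N -> len (f (path_point z h i)) <= 3 ^+ i * len (f z).
  exact: H.
elim: i => [_|i IH iln]; first by rewrite path_point0 mul1r.
have -> : path_point z h i.+1 = path_point z h i +
    setrow0 (Ordinal iln) (row (Ordinal iln) h) by exact: (path_pointS z h (Ordinal iln)).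
have [] := fU.2 (Ordinal iln) (path_point z h i) d d0.
  move=> a ad; apply: zU; rewrite addrAC; apply: le_lt_trans (sumlenD _ _) _.
  rewrite sumlen_setrow0; have := path_point_near z h i; lra.
move=> _ /(_ (row (Ordinal iln) h))[].
  exact: le_trans (len_row_le _ _) hd.
move=> + _; move/le_trans; apply; rewrite exprS -mulrA ler_wpM2l//.
by apply: IH; exact: ltnW.
Qed.

Variables (z0 : V) (d C : R).
Hypothesis d0 : 0 < d.
Hypothesis ballU : forall y, sumlen (y - z0) <= 2 * d -> U y.
Hypothesis fC : forall y, sumlen (y - z0) <= d -> len (f y) <= C.

Let C0 : 0 <= C.
Proof. by apply: le_trans (fC (y := z0) _); rewrite ?len_ge0// subrr sumlen0 ltW. Qed.

Lemma row_derive_le y j a : sumlen (y - z0) <= d ->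
  len ('d f y (setrow0 j a)) <= 2 * C / d * len a.
Proof.
move=> yd; have [|+ _] := fU.2 j y d d0.
  move=> b bd; apply: ballU; rewrite addrAC; apply: le_trans (sumlenD _ _) _.
  rewrite sumlen_setrow0; lra.
move=> /(_ a)/le_trans; apply.
rewrite mulrA mulrAC ler_wpM2r ?len_ge0// ler_wpM2r ?invr_ge0 ?(ltW d0)//.
by rewrite ler_wpM2l// fC.
Qed.

Lemma row_remainder_le y j a : sumlen (y - z0) <= d -> len a <= d / 2 ->
  len (f (y + setrow0 j a) - f y - 'd f y (setrow0 j a)) <=
    32 * C / d ^+ 2 * len a ^+ 2.
Proof.
move=> yd ad; have [|_] := fU.2 j y d d0.
  move=> b bd; apply: ballU; rewrite addrAC; apply: le_trans (sumlenD _ _) _.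
  rewrite sumlen_setrow0; lra.
move=> /(_ a ad)[_]/le_trans; apply.
rewrite exprMn exprVn mulrA mulrAC ler_wpM2r ?sqr_ge0// ler_wpM2r ?invr_ge0 ?sqr_ge0//.
by rewrite ler_wpM2l// fC.
Qed.

Let A := 2 * C / d.
Let B := 32 * C / d ^+ 2.
Let A0 : 0 <= A. Proof. by rewrite !mulr_ge0 ?invr_ge0 ?(ltW d0). Qed.
Let B0 : 0 <= B. Proof. by rewrite !mulr_ge0 ?invr_ge0 ?sqr_ge0. Qed.

Lemma derive_le y h : sumlen (y - z0) <= d -> len ('d f y h) <= A * sumlen h.
Proof.
move=> yd; rewrite -[in leLHS](sum_setrow0 h) linear_sum mulr_sumr.
elim/big_ind2 : _ => [|x1 x2 y1 y2 xy1 xy2|j _]; first by rewrite len0.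
  exact: lenD_le.
exact: row_derive_le.
Qed.

Lemma increment_le y h : sumlen (y - z0) <= d / 2 -> sumlen h <= d / 2 ->
  len (f (y + h) - f y) <= (A + B * d) * sumlen h.
Proof.
move=> yd hd; rewrite -path_point_end -[in f y](path_point0 y h).
rewrite -(telescope_sumr (fun i => f (path_point y h i)) (leq0n n)) big_mkord.
apply: le_trans (len_sum
  (fun i => f (path_point y h i.+1) - f (path_point y h i)) n) _; rewrite mulr_sumr.
apply: ler_sum => i _; rewrite path_pointS.
set p := path_point y h i; set a := row i h.
have pd : sumlen (p - z0) <= d.
  by have := path_point_ball i yd hd; lra.
have ad : len a <= d / 2 by apply: le_trans hd; exact: len_row_le.
rewrite -[f _ - f p](subrK ('d f p (setrow0 i a))) mulrDl addrC.
apply: lenD_le; first exact: row_derive_le.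
apply: le_trans (row_remainder_le i pd ad) _; rewrite -/B expr2 mulrA -mulrA -[leRHS]mulrA.
apply: ler_wpM2l B0 _ _ _; apply: ler_wpM2r (len_ge0 a) _ _ _.
by have := d0; lra.
Qed.

(** On a vector of length [s], the difference of the linear parts is a second difference of [f] up
    to two remainders [B * s ^+ 2]. Dividing by [s] leaves an error [2 * B * s], small for small
    [s], and a term controlled by [y' - y]. *)
Lemma row_linear_near (T T' : {linear V -> K}) y y' j a s : 0 < s -> s <= d / 4 ->
  sumlen (y - z0) <= d / 4 -> sumlen (y' - z0) <= d / 4 ->
  (forall b, len b <= d / 2 ->
    len (f (y + setrow0 j b) - f y - T (setrow0 j b)) <= B * len b ^+ 2) ->
  (forall b, len b <= d / 2 ->
    len (f (y' + setrow0 j b) - f y' - T' (setrow0 j b)) <= B * len b ^+ 2) ->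
  len (T' (setrow0 j a) - T (setrow0 j a)) <=
    (2 * (A + B * d) * sumlen (y' - y) / s + 2 * B * s) * len a.
Proof.
move=> s0 sd yd y'd RT RT'; have [->|a0] := eqVneq a 0.
  by rewrite setrow0_0 (linear0 T) (linear0 T') subr0 len0 mulr0.
have la : 0 < len a by exact: len_gt0.
pose e := (s / len a) *: a; set v := setrow0 j e.
have le : len e = s.
  by rewrite /e lenZ ger0_norm ?divr_ge0 ?len_ge0 ?(ltW s0)// divfK ?gt_eqF.
have lv : sumlen v = s by rewrite sumlen_setrow0.
have va : setrow0 j a = (len a / s) *: v.
  rewrite /v /e -!setrow0Z scalerA mulrA divfK ?gt_eqF//.
  by rewrite mulfV ?gt_eqF// scale1r.
have TZ c x : T (c *: x) = c *: T x by rewrite linearZ.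
have TZ' c x : T' (c *: x) = c *: T' x by rewrite linearZ.
rewrite va TZ TZ' -scalerBr lenZ ger0_norm ?divr_ge0 ?(ltW s0) ?(ltW la)//.
have ed : len e <= d / 2 by lra.
have R1 := RT e ed; have R2 := RT' e ed; rewrite -/v le in R1 R2.
have yy : sumlen (y' - y) <= d / 2.
  by apply: le_trans (sumlen_tri z0 _ _) _; rewrite (sumlenB z0 y); lra.
have L1 : len (f y' - f y) <= (A + B * d) * sumlen (y' - y).
  rewrite -[in f y'](subrK y y') [y' - y + y]addrC.
  by apply: increment_le => //; lra.
have L2 : len (f (y' + v) - f (y + v)) <= (A + B * d) * sumlen (y' - y).
  have -> : y' + v = (y + v) + (y' - y).
    by apply/matrixP => i k; rewrite !mxE; ring.
  apply: increment_le => //; rewrite addrAC; apply: le_trans (sumlenD _ _) _; lra.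
have H : len (T' v - T v) <= 2 * (A + B * d) * sumlen (y' - y) + 2 * B * s ^+ 2.
  have -> : T' v - T v = (f (y' + v) - f (y + v)) + - (f y' - f y)
      + - (f (y' + v) - f y' - T' v) + (f (y + v) - f y - T v).
    by apply/rowP => i; rewrite !mxE; ring.
  have -> : 2 * (A + B * d) * sumlen (y' - y) + 2 * B * s ^+ 2 =
    (A + B * d) * sumlen (y' - y) + (A + B * d) * sumlen (y' - y)
    + B * s ^+ 2 + B * s ^+ 2 by ring.
  by do 3 ?apply: lenD_le; rewrite ?lenN.
apply: le_trans (_ : len a / s * (2 * (A + B * d) * sumlen (y' - y) + 2 * B * s ^+ 2) <= _).
  by rewrite ler_wpM2l// divr_ge0 ?len_ge0 ?(ltW s0).
rewrite le_eqVlt; apply/orP; left; apply/eqP; field.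
by rewrite gt_eqF.
Qed.

Lemma row_derive_near y y' j a s : 0 < s -> s <= d / 4 ->
  sumlen (y - z0) <= d / 4 -> sumlen (y' - z0) <= d / 4 ->
  len ('d f y' (setrow0 j a) - 'd f y (setrow0 j a)) <=
    (2 * (A + B * d) * sumlen (y' - y) / s + 2 * B * s) * len a.
Proof.
move=> s0 sd yd y'd.
have yd1 : sumlen (y - z0) <= d by lra.
have y'd1 : sumlen (y' - z0) <= d by lra.
apply: (row_linear_near a s0 sd yd y'd).
  by move=> b bd; exact: row_remainder_le.
by move=> b bd; exact: row_remainder_le.
Qed.

End LocalEstimates.

End SeveralVariables.

Lemma len_chain (R : realType) m (a b c : 'rV[R]_m) s t :
  len (a - b) <= s -> len (c - a) <= t -> len (c - b) <= s + t.
Proof. by move=> ab ca; rewrite -[c - b](subrKA a) addrC; exact: lenD_le. Qed.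

(** * Uniform equicontinuity of values and differentials *)

Section Equicontinuity.
Variables (R : realType) (r n : nat).
Local Notation V := (cdspace R r n).
Local Notation K := (cdalg R r).
Variables (U : set V) (z0 : V) (d : R).
Hypothesis d0 : 0 < d.
Hypothesis ballU : forall y, sumlen (y - z0) < 4 * d -> U y.

Lemma ball_harnack (f : V -> K) y : slice_bounded U f -> sumlen (y - z0) <= d ->
  len (f y) <= 3 ^+ n * len (f z0).
Proof.
move=> fU yd; have -> : y = z0 + (y - z0) by rewrite addrC subrK.
apply: (harnack fU (d := 2 * d)); first by have := d0; lra.
  by move=> x xd; apply: ballU; lra.
by lra.
Qed.

Lemma ball_harnack_inv (f : V -> K) y : slice_bounded U f -> sumlen (y - z0) <= d / 2 ->
  len (f z0) <= 3 ^+ n * len (f y).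
Proof.
move=> fU yd; rewrite -[in f z0](subrK y z0) addrC.
apply: (harnack fU d0) => [x xd|]; last by rewrite sumlenB.
apply: ballU; apply: le_lt_trans (sumlen_tri y _ _) _.
by have := d0; lra.
Qed.

Lemma center_derive_le (f : V -> K) h : slice_bounded U f ->
  len ('d f z0 h) <= 2 * (3 ^+ n * len (f z0)) / d * sumlen h.
Proof.
move=> fU; apply: (derive_le fU d0 (z0 := z0)).
- by move=> y yd; apply: ballU; have := d0; lra.
- by move=> y; exact: ball_harnack.
- by rewrite subrr sumlen0 ltW.
Qed.

(** The increment telescopes along the coordinate path; at each step [row_derive_near] carries the
    partial differential back from the path point to [y]. *)
Lemma remainder_sum_le (f : V -> K) C s y h : slice_bounded U f ->
  (forall y, sumlen (y - z0) <= d -> len (f y) <= C) ->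
  0 < s -> s <= d / 4 -> sumlen (y - z0) <= d / 8 -> sumlen h <= d / 8 ->
  len (f (y + h) - f y - 'd f y h) <=
    (2 * (2 * C / d + 32 * C / d ^+ 2 * d) * sumlen h / s
      + 2 * (32 * C / d ^+ 2) * s + 32 * C / d ^+ 2 * sumlen h) * sumlen h.
Proof.
move=> fU fC s0 sd yd hd; set A := 2 * C / d; set B := 32 * C / d ^+ 2.
have ballU2 x : sumlen (x - z0) <= 2 * d -> U x.
  by move=> xd; apply: ballU; have := d0; lra.
have C0 : 0 <= C.
  by apply: le_trans (fC z0 _); rewrite ?len_ge0// subrr sumlen0 ltW.
have A0 : 0 <= A by rewrite !mulr_ge0 ?invr_ge0 ?(ltW d0).
have B0 : 0 <= B by rewrite !mulr_ge0 ?invr_ge0 ?sqr_ge0.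
pose p i := path_point y h i.
have near i : sumlen (p i - z0) <= d / 4.
  by have := path_point_ball i yd hd; rewrite -/(p i); lra.
have yd4 : sumlen (y - z0) <= d / 4 by have := d0; lra.
have dnear (i : 'I_n) : len ('d f (p i) (setrow0 i (row i h)) - 'd f y (setrow0 i (row i h))) <=
    (2 * (A + B * d) * sumlen h / s + 2 * B * s) * len (row i h).
  apply: le_trans (row_derive_near fU d0 ballU2 fC i (row i h) s0 sd yd4 (near i)) _.
  rewrite ler_wpM2r ?len_ge0// lerD2r ler_wpM2r ?invr_ge0 ?(ltW s0)//.
  rewrite ler_wpM2l ?path_point_near// mulr_ge0// addr_ge0// mulr_ge0//.
  exact: ltW.
have rem (i : 'I_n) : len (f (p i.+1) - f (p i) - 'd f (p i) (setrow0 i (row i h))) <=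
    B * sumlen h * len (row i h).
  have ad : len (row i h) <= d / 2.
    by have := len_row_le h i; have := d0; lra.
  have pd : sumlen (p i - z0) <= d by have := near i; have := d0; lra.
  rewrite /p path_pointS; apply: le_trans (row_remainder_le fU d0 ballU2 fC i pd ad) _.
  rewrite -/B expr2 mulrA ler_wpM2r ?len_ge0// ler_wpM2l// len_row_le//.
have E : f (y + h) - f y - 'd f y h =
    \sum_(i < n) (f (p i.+1) - f (p i) - 'd f y (setrow0 i (row i h))).
  rewrite sumrB -linear_sum/= sum_setrow0; congr (_ - _).
  rewrite -(big_mkord xpredT (fun i => f (p i.+1) - f (p i))).
  by rewrite (telescope_sumr (fun i => f (p i)) (leq0n n)) /p path_point0 path_point_end.
rewrite E mulr_sumr.
elim/big_ind2 : _ => [|x1 x2 y1 y2 xy1 xy2|i _]; first by rewrite len0.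
  exact: lenD_le.
rewrite mulrDl; exact: len_chain (dnear i) (rem i).
Qed.

Lemma equicontinuity M e : 0 <= M -> 0 < e -> exists2 eta, 0 < eta &
  forall f : V -> K, slice_bounded U f -> len (f z0) <= M ->
  forall y y', sumlen (y - z0) <= d / 8 -> sumlen (y' - z0) <= d / 8 ->
    sumlen (y' - y) < eta ->
  [/\ len (f y' - f y) <= e,
      forall h, len ('d f y' h - 'd f y h) <= e * sumlen h &
      len (f y' - f y - 'd f y (y' - y)) <= e * sumlen (y' - y)].
Proof.
move=> M0 e0; pose C := 3 ^+ n * M.
have C0 : 0 <= C by rewrite mulr_ge0.
pose A := 2 * C / d; pose B := 32 * C / d ^+ 2; pose Q := A + B * d.
have A0 : 0 <= A by rewrite !mulr_ge0 ?invr_ge0 ?(ltW d0).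
have B0 : 0 <= B by rewrite !mulr_ge0 ?invr_ge0 ?sqr_ge0.
have Q0 : 0 <= Q by rewrite addr_ge0// mulr_ge0// ltW.
(* [s] is fixed before [eta] and brings [2 * B * s] below [e / 2]; [eta] then brings the quotient by
   [s] and the term in [B] below [e / 4] each. The summands 1 keep the denominators positive. *)
pose s := Num.min (d / 4) (e / (4 * (B + 1))).
have s0 : 0 < s by rewrite lt_min !divr_gt0//; have := d0; lra.
have sd : s <= d / 4 by rewrite ge_min lexx.
have sB : 2 * B * s <= e / 2.
  have : s <= e / (4 * (B + 1)) by rewrite ge_min lexx orbT.
  rewrite ler_pdivlMr; last by lra.
  by have := ltW s0; lra.
pose eta := Num.min (Num.min (d / 8) (e / (Q + 1)))
  (Num.min (s * e / (8 * (Q + 1))) (e / (4 * (B + 1)))).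
have eta0 : 0 < eta.
  by rewrite !lt_min !divr_gt0 ?mulr_gt0//; have := d0; lra.
have eta1 : eta <= d / 8 by rewrite !ge_min lexx.
have eta2 : eta * (Q + 1) <= e.
  rewrite -ler_pdivlMr; last by lra.
  by rewrite !ge_min lexx ?orbT.
have eta3 : eta * (8 * (Q + 1)) <= s * e.
  rewrite -ler_pdivlMr; last by lra.
  by rewrite !ge_min lexx ?orbT.
have eta4 : eta * (4 * (B + 1)) <= e.
  rewrite -ler_pdivlMr; last by lra.
  by rewrite !ge_min lexx ?orbT.
exists eta => // f fU fM y y' yd y'd yy.
have fC x : sumlen (x - z0) <= d -> len (f x) <= C.
  by move=> xd; apply: le_trans (ball_harnack fU xd) _; rewrite ler_wpM2l.
have ballU2 x : sumlen (x - z0) <= 2 * d -> U x.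
  by move=> xd; apply: ballU; have := d0; lra.
have N0 := sumlen_ge0 (y' - y).
have Qs : 2 * Q * sumlen (y' - y) / s <= e / 4.
  rewrite ler_pdivrMr//.
  have : sumlen (y' - y) * (8 * (Q + 1)) <= s * e.
    by apply: le_trans eta3; rewrite ler_wpM2r ?(ltW yy)//; lra.
  by have := mulr_ge0 N0 Q0; lra.
have Bs : B * sumlen (y' - y) <= e / 4.
  have : sumlen (y' - y) * (4 * (B + 1)) <= e.
    by apply: le_trans eta4; rewrite ler_wpM2r ?(ltW yy)//; lra.
  by lra.
have yE : y' = y + (y' - y) by rewrite addrC subrK.
split.
- have yd2 : sumlen (y - z0) <= d / 2 by have := d0; lra.
  have yyd2 : sumlen (y' - y) <= d / 2 by have := d0; lra.
  have := increment_le fU d0 ballU2 fC yd2 yyd2.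
  rewrite -yE -/A -/B -/Q => /le_trans; apply; apply: le_trans eta2.
  have : sumlen (y' - y) * (Q + 1) <= eta * (Q + 1).
    by rewrite ler_wpM2r ?(ltW yy)//; lra.
  lra.
- have yd4 : sumlen (y - z0) <= d / 4 by have := d0; lra.
  have y'd4 : sumlen (y' - z0) <= d / 4 by have := d0; lra.
  have key j a := row_derive_near fU d0 ballU2 fC j a s0 sd yd4 y'd4.
  move: key; generalize ('d f y) ('d f y') => T T' key h.
  have sumT (S : {linear V -> K}) : S h = \sum_j S (setrow0 j (row j h)).
    by rewrite -linear_sum sum_setrow0.
  rewrite (sumT T) (sumT T') -sumrB mulr_sumr.
  elim/big_ind2 : _ => [|x1 x2 y1 y2 xy1 xy2|i _]; first by rewrite len0.
    exact: lenD_le.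
  apply: le_trans (key i (row i h)) _; rewrite ler_wpM2r ?len_ge0// -/A -/B -/Q.
  by lra.
- have yyd : sumlen (y' - y) <= d / 8 by apply: le_trans eta1; exact: ltW.
  have := remainder_sum_le fU fC s0 sd yd yyd.
  rewrite -yE /= => /le_trans; apply; rewrite ler_wpM2r// -/A -/B -/Q.
  by lra.
Qed.

End Equicontinuity.

(** * Limits along an ultrafilter *)

Lemma differentiable_remainder (R : realType) (V W : normedModType R) (f : V -> W)
    (x : V) (T : V -> W) (C : R) :
  (forall a u v, T (a *: u + v) = a *: T u + T v) ->
  (forall h, `|T h| <= C * `|h|) ->
  (forall e, 0 < e -> exists2 s, 0 < s & forall h, `|h| < s ->
    `|f (x + h) - f x - T h| <= e * `|h|) ->
  differentiable f x /\ forall h, 'd f x h = T h.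
Proof.
move=> Tlin TC Tf.
pose T' : {linear V -> W} := HB.pack T (GRing.isLinear.Build _ _ _ _ T Tlin).
have cT : continuous T'.
  apply: bounded_linear_continuous; apply/linear_boundedP.
  exists C; split; first exact: num_real.
  by move=> M CM y; apply: le_trans (TC y) _; rewrite ler_wpM2r// ltW.
have oT : f \o shift x = cst (f x) + T' +o_ 0 id.
  apply/eqaddoP => e e0; have [s s0 sT] := Tf e e0.
  apply/nbhs_normP; exists s => //= h.
  rewrite /ball_/= sub0r normrN => hs.
  have := sT h hs; rewrite -addrA -opprD [x + h]addrC.
  exact.
have dE := diff_unique cT oT.
by split; [apply/diff_locallyP; rewrite dE | move=> h; rewrite dE].
Qed.

Lemma differentiable_cdinv (R : realType) r (a : cdalg R r) : a != 0 ->
  differentiable (@cdinv R r) a.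
Proof.
move=> a0.
have coord k : differentiable (fun x : cdalg R r => x 0 k) a.
  exact: differentiable_coord.
have dd : differentiable (fun x : cdalg R r => dot x x) a.
  have -> : (fun x : cdalg R r => dot x x) =
      \sum_(k < 2 ^ r) ((fun x : cdalg R r => x 0 k) * (fun x : cdalg R r => x 0 k)).
    by apply/funext => x; rewrite fct_sumE.
  by apply: differentiable_sum => k; exact: differentiableM.
have -> : @cdinv R r = \sum_(k < 2 ^ r) (fun x : cdalg R r =>
    ((fun y => (dot y y)^-1) * (fun y : cdalg R r => y 0 k)) x *:
      (cdconj (delta_mx 0 k : cdalg R r))).
  apply/funext => x; rewrite fct_sumE /cdinv cdabsE len_sqr.
  rewrite [in cdconj x](row_sum_delta x) -[X in _ *: cdconj X]/(\sum_k _) .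
  have cdconj_sum (F : 'I_(2 ^ r) -> cdalg R r) :
      cdconj (\sum_k F k) = \sum_k cdconj (F k).
    elim/big_ind2 : _ => [|x1 x2 y1 y2 <- <-|//]; [exact: cdconj0 | exact: cdconjD].
  rewrite cdconj_sum scaler_sumr; apply: eq_bigr => k _.
  by rewrite cdconjZ scalerA.
apply: differentiable_sum => k; apply: differentiableZl; apply: differentiableM => //.
by apply: differentiableV => //; rewrite gt_eqF// dot_gt0.
Qed.

Lemma len_cdinv (R : realType) r (a : cdalg R r) : len (cdinv a) = (len a)^-1.
Proof.
rewrite /cdinv cdabsE lenZ len_conj normfV ger0_norm ?sqr_ge0//.
(* At 0 both sides are 0, by the convention on the inverse of 0. *)
have [->|a0] := eqVneq a 0; first by rewrite len0 expr0n invr0 mul0r.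
by field; rewrite gt_eqF// len_gt0.
Qed.

Lemma len_cdinvB (R : realType) r (a b : cdalg R r) : a != 0 -> b != 0 ->
  len (cdinv a - cdinv b) = len (a - b) / (len a * len b).
Proof.
move=> a0 b0; have la := len_gt0 a0; have lb := len_gt0 b0.
rewrite /cdinv !cdabsE -!cdconjZ -scaleN1r -cdconjZ -cdconjD len_conj.
have l0 : 0 <= len (a - b) / (len a * len b) by rewrite divr_ge0 ?len_ge0// mulr_ge0 ?len_ge0.
rewrite /len -[RHS]ger0_norm// -sqrtr_sqr; congr Num.sqrt.
rewrite exprMn exprVn exprMn !len_sqr !dotE (dotC b a).
have := dot_gt0 a0; have := dot_gt0 b0.
move: (dot a a) (dot b b) (dot a b) => p q s q0 p0; field.
by rewrite !gt_eqF.
Qed.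

Lemma diff_le (R : realType) (V : normedModType R) m (f : V -> 'rV[R]_m) (x v : V) (C s : R) :
  0 < s -> differentiable f x ->
  (forall t : R, `|t| < s -> len (f (x + t *: v) - f x) <= C * `|t|) ->
  len ('d f x v) <= C.
Proof.
move=> s0 df fC; rewrite -deriveE//.
have [H _] : is_derive x v f ('D_v f x) by apply/derivableP; exact: diff_derivable.
apply: (cvg_len_le H); near=> t.
have t0 : t != 0 by near: t; exact: nbhs_dnbhs_neq.
rewrite lenZ normfV ler_pdivrMl ?normr_gt0//= [t *: v + x]addrC [leRHS]mulrC.
by apply: fC; near: t; exact: dnbhs0_lt.
Unshelve. all: by end_near. Qed.

(** The image of [G] charges a compact cube, hence has a cluster point, and an ultrafilter converges
    to each of its cluster points. *)
Lemma ultra_cvg_bounded (R : realType) m (G : set_system nat) (g : nat -> 'rV[R]_m)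
    (M : R) : UltraFilter G -> G [set k | len (g k) <= M] ->
  exists l : 'rV[R]_m, g @ G --> l.
Proof.
move=> UG gM; have PG : ProperFilter G by exact: ultra_proper.
have cA : compact [set v : 'rV[R]_m | forall i, `[- M, M]%classic (v ord0 i)].
  by apply: (@rV_compact R m (fun=> `[- M, M]%classic)) => i; exact: segment_compact.
have GA : (g @ G) [set v : 'rV[R]_m | forall i, `[- M, M]%classic (v ord0 i)].
  apply: (@filterS _ G _ _ _ _ gM) => k /= gk i; rewrite in_itv/= -ler_norml.
  exact: le_trans (len_coord _ _) gk.
have [l [_ cl]] := cA (g @ G) (fmap_proper_filter g PG) GA; exists l => N Nl.
have [//|GN] := in_ultra_setVsetC (g @^-1` N) UG.
by have [y [yN Ny]] := cl (~` N) N GN Nl.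
Qed.

Section Covering.
Variables (R : realType) (r n : nat).
Local Notation V := (cdspace R r n).
Local Notation K := (cdalg R r).

Lemma open_sumlen_ball (U : set V) z : open U -> U z ->
  exists2 d : R, 0 < d & forall y, sumlen (y - z) < 4 * d -> U y.
Proof.
move=> oU Uz; have /nbhs_normP[e /= e0 eU] := open_nbhs_nbhs (conj oU Uz).
exists (e / 4); first by rewrite divr_gt0.
move=> y yz; apply: eU; rewrite /ball_/= distrC; apply: le_lt_trans (norm_le_sumlen _) _.
by lra.
Qed.

Lemma near_sumlen (z : V) (e : R) : 0 < e -> \forall y \near z, sumlen (y - z) < e.
Proof.
move=> e0; have [c c0 cN] := @sumlen_le_norm R r n.
apply/nbhs_normP; exists (e / c) => /=; first exact: divr_gt0.
move=> y; rewrite /ball_/= distrC ltr_pdivlMr// mulrC.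
by apply: le_lt_trans; exact: cN.
Qed.

Lemma linear_delta_le (S : V -> K) (e : R) h : 0 <= e ->
  (forall a u v, S (a *: u + v) = a *: S u + S v) ->
  (forall i k, len (S (delta_mx i k)) <= e) ->
  len (S h) <= e * (n * 2 ^ r)%:R * sumlen h.
Proof.
move=> e0 Slin Se.
have S0 : S 0 = 0.
  have := Slin 1 0 0; rewrite scaler0 addr0 scale1r => /eqP.
  by rewrite -subr_eq subrr => /eqP.
have SZ a u : S (a *: u) = a *: S u by rewrite -[a *: u]addr0 Slin S0 addr0.
have SD u v : S (u + v) = S u + S v by rewrite -[u in LHS]scale1r Slin scale1r.
rewrite [in leLHS](matrix_sum_delta h).
have -> : e * (n * 2 ^ r)%:R * sumlen h =
    \sum_(i < n) \sum_(k < 2 ^ r) e * sumlen h.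
  by rewrite !sumr_const !card_ord -mulrnA [(2 ^ r * n)%N]mulnC -[RHS]mulr_natr mulrAC.
elim/big_ind2 : _ => [|x1 x2 y1 y2 xy1 xy2|i _]; first by rewrite S0 len0.
  by rewrite SD; exact: lenD_le.
elim/big_ind2 : _ => [|x1 x2 y1 y2 xy1 xy2|k _]; first by rewrite S0 len0.
  by rewrite SD; exact: lenD_le.
rewrite SZ lenZ mulrC ler_pM ?len_ge0//.
apply: le_trans (len_row_le h i).
by have := len_coord (row i h) k; rewrite mxE.
Qed.

Variables (U : set V) (u : nat -> V -> K) (G : set_system nat).
Hypothesis openU : open U.
Hypothesis UG : UltraFilter G.
Hypothesis uU : forall k, slice_bounded U (u k).

Definition ultra_bounded z := exists M, G [set k | len (u k z) <= M].

(** The Harnack inequality in both directions, with a constant that does not depend on [k]. *)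
Lemma ultra_bounded_near z : U z -> exists2 d : R, 0 < d &
  forall y, sumlen (y - z) < d -> U y /\ (ultra_bounded y <-> ultra_bounded z).
Proof.
move=> Uz; have [d d0 dU] := open_sumlen_ball openU Uz.
exists (d / 2); first by rewrite divr_gt0.
move=> y yd; split; first by apply: dU; lra.
split=> -[M GM].
  exists (3 ^+ n * M); apply: filterS GM => k /= kM.
  apply: le_trans (ball_harnack_inv d0 dU (uU k) (ltW yd)) _.
  by rewrite ler_wpM2l.
exists (3 ^+ n * M); apply: filterS GM => k /= kM.
have yd1 : sumlen (y - z) <= d by lra.
apply: le_trans (ball_harnack d0 dU (uU k) yd1) _.
by rewrite ler_wpM2l.
Qed.

Lemma ultra_bounded_dichotomy : connected U ->
  (forall z, U z -> ultra_bounded z) \/ (forall z, U z -> ~ ultra_bounded z).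
Proof.
move=> cU; pose A := [set z | U z /\ ultra_bounded z].
have [A0|A0] := pselect (A !=set0); last first.
  by right=> z Uz bz; apply: A0; exists z.
left; have oA : open A.
  rewrite openE => z [Uz bz]; have [d d0 dU] := ultra_bounded_near Uz.
  apply: filterS (near_sumlen z d0) => y yd.
  by have [Uy iy] := dU y yd; split=> //; apply/iy.
have oB : open [set z | U z /\ ~ ultra_bounded z].
  rewrite openE => z [Uz bz]; have [d d0 dU] := ultra_bounded_near Uz.
  apply: filterS (near_sumlen z d0) => y yd.
  by have [Uy iy] := dU y yd; split=> // /iy.
suff AU : A = U by move=> z; rewrite -AU => -[].
apply: cU => //.
- by exists A => //; apply/seteqP; split=> z; [move=> [] | case].
- exists (~` [set z | U z /\ ~ ultra_bounded z]); first exact: open_closedC.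
  apply/seteqP; split=> z [Uz bz]; split=> //; first by case.
  by apply: contrapT => nb; exact: bz.
Qed.

Section BoundedCase.
Hypothesis ub : forall z, U z -> ultra_bounded z.

(** Where no limit exists these are default values; they are only evaluated at points of [U]. *)
Let l z : K := lim ((fun k => u k z) @ G).
Let T z h : K := lim ((fun k => 'd (u k) z h) @ G).

Lemma ultra_cvg_value z : U z -> (fun k => u k z) @ G --> l z.
Proof.
move=> Uz; have [M GM] := ub Uz.
by have [l' /cvgP] := ultra_cvg_bounded UG GM.
Qed.

Lemma ultra_derive_bound z : U z -> exists C : R,
  G [set k | forall h, len ('d (u k) z h) <= C * sumlen h].
Proof.
move=> Uz; have [M GM] := ub Uz; have [d d0 dU] := open_sumlen_ball openU Uz.
exists (2 * (3 ^+ n * M) / d); apply: filterS GM => k /= kM h.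
apply: le_trans (center_derive_le d0 dU h (uU k)) _.
rewrite ler_wpM2r ?sumlen_ge0// ler_wpM2r ?invr_ge0 ?(ltW d0)//.
by rewrite ler_wpM2l// ler_wpM2l.
Qed.

Lemma ultra_cvg_derive z h : U z -> (fun k => 'd (u k) z h) @ G --> T z h.
Proof.
move=> Uz; have [C GC] := ultra_derive_bound Uz.
have GC' : G [set k | len ('d (u k) z h) <= C * sumlen h].
  by apply: filterS GC => k; exact.
by have [l' /cvgP] := ultra_cvg_bounded UG GC'.
Qed.

Lemma ultra_derive_lin z a h h' : U z -> T z (a *: h + h') = a *: T z h + T z h'.
Proof.
move=> Uz.
have H := ultra_cvg_derive (h := a *: h + h') Uz.
have H' := cvgD (cvgZl_tmp (k := a) (ultra_cvg_derive (h := h) Uz)) (ultra_cvg_derive (h := h') Uz).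
have E : (fun k => 'd (u k) z (a *: h + h')) =
    a \*: (fun k => 'd (u k) z h) + (fun k => 'd (u k) z h').
  apply/funext => k; rewrite -[RHS]/(a *: 'd (u k) z h + 'd (u k) z h').
  by generalize ('d (u k) z) => S; rewrite linearP.
by rewrite E in H; exact: (norm_cvg_unique H (H' _ _)).
Qed.

Lemma ultra_equicontinuity z e : U z -> 0 < e -> exists2 eta, 0 < eta &
  (forall y, sumlen (y - z) < eta -> U y) /\
  G [set k | forall y, sumlen (y - z) < eta -> [/\ len (u k y - u k z) <= e,
      forall h, len ('d (u k) y h - 'd (u k) z h) <= e * sumlen h &
      len (u k y - u k z - 'd (u k) z (y - z)) <= e * sumlen (y - z)]].
Proof.
move=> Uz e0; have [M0 GM0] := ub Uz; have [d d0 dU] := open_sumlen_ball openU Uz.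
pose M := Num.max 0 M0; have MM : 0 <= M by rewrite le_max lexx.
have GM : G [set k | len (u k z) <= M].
  by apply: filterS GM0 => k /= kM; rewrite le_max kM orbT.
have [eta eta0 etaP] := equicontinuity d0 dU MM e0.
exists (Num.min eta (d / 8)); first by rewrite lt_min eta0 divr_gt0.
split=> [y|]; first by rewrite lt_min => /andP[_ yd]; apply: dU; lra.
apply: filterS GM => k /= kM y; rewrite lt_min => /andP[ye yd].
apply: (etaP _ (uU k) kM) => //; last exact: ltW.
by rewrite subrr sumlen0 divr_ge0// ltW.
Qed.

Lemma limit_equicontinuity z e : U z -> 0 < e -> exists2 eta, 0 < eta &
  forall y, sumlen (y - z) < eta -> [/\ len (l y - l z) <= e,
      forall h, len (T y h - T z h) <= e * sumlen h &
      len (l y - l z - T z (y - z)) <= e * sumlen (y - z)].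
Proof.
move=> Uz e0; have [eta eta0 [etaU Geta]] := ultra_equicontinuity Uz e0.
exists eta => // y yeta; have Uy := etaU y yeta.
have cy := ultra_cvg_value Uy; have cz := ultra_cvg_value Uz.
split.
- by apply: (cvg_len_le (cvgB cy cz)); apply: filterS Geta => k /(_ y yeta)[].
- move=> h.
  apply: (cvg_len_le (cvgB (ultra_cvg_derive (h := h) Uy)
    (ultra_cvg_derive (h := h) Uz))).
  by apply: filterS Geta => k /(_ y yeta)[_ + _]; apply.
- apply: (cvg_len_le (cvgB (cvgB cy cz) (ultra_cvg_derive (h := y - z) Uz))).
  by apply: filterS Geta => k /(_ y yeta)[].
Qed.

(** The bound on the remainders is uniform in [k], so it passes to the limit and identifies [T z] as
    the differential of [l]. *)
Lemma limit_differentiable z : U z ->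
  differentiable l z /\ forall h, 'd l z h = T z h.
Proof.
move=> Uz; have [C GC] := ultra_derive_bound Uz.
have [c c0 cN] := @sumlen_le_norm R r n.
apply: (@differentiable_remainder _ _ _ l z (T z) (`|C| * c)).
- by move=> a h h'; exact: ultra_derive_lin.
- move=> h; apply: le_trans (norm_le_len _) _.
  apply: (cvg_len_le (ultra_cvg_derive (h := h) Uz)).
  apply: filterS GC => k /(_ h) kC.
  apply: le_trans kC _; apply: le_trans (_ : `|C| * sumlen h <= _).
    by rewrite ler_wpM2r ?sumlen_ge0// ler_norm.
  by rewrite -mulrA ler_wpM2l.
- move=> e e0; have ec0 : 0 < e / c by exact: divr_gt0.
  have [eta eta0 etaP] := limit_equicontinuity Uz ec0.
  exists (eta / c) => [|h]; first exact: divr_gt0.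
  rewrite ltr_pdivlMr// => hs.
  have hE : z + h - z = h by rewrite addrAC subrr add0r.
  have [] := etaP (z + h); first by rewrite hE; apply: le_lt_trans (cN h) _; rewrite mulrC.
  rewrite hE => _ _ H; apply: le_trans (norm_le_len _) _; apply: le_trans H _.
  rewrite -mulrA ler_wpM2l ?(ltW e0)// ler_pdivrMl//; exact: cN.
Qed.

Lemma limit_locally_uniform z e : U z -> 0 < e ->
  \forall y \near z & k \near G, len (u k y - l y) <= e /\
    forall h, len ('d (u k) y h - 'd l y h) <= e * sumlen h.
Proof.
move=> Uz e0; have e3 : 0 < e / 3 by exact: divr_gt0.
have [eta eta0 [etaU Geta]] := ultra_equicontinuity Uz e3.
have [eta' eta'0 etaP] := limit_equicontinuity Uz e3.
pose N : R := (n * 2 ^ r)%:R; pose e' := e / 3 / (N + 1).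
have N0 : 0 <= N by [].
have e'0 : 0 < e' by rewrite divr_gt0// ltr_wpDl.
have G1 : G [set k | len (u k z - l z) <= e / 3].
  have /cvgrPdist_lt/(_ _ (divr_gt0 e3 (ltr0Sn R (2 ^ r)))) := ultra_cvg_value Uz.
  apply: filterS => k /= kd; rewrite lenB; apply: le_trans (len_le_norm _) _.
  by rewrite mulrC -ler_pdivlMr// ltW.
(* Differentials at [z] converge vector by vector. On the finitely many elementary matrices the
   convergence is simultaneous, and [linear_delta_le] extends it to all [h] at the cost of the
   factor [N] built into [e']. *)
have G2 : G [set k | forall i : 'I_n * 'I_(2 ^ r),
    len ('d (u k) z (delta_mx i.1 i.2) - T z (delta_mx i.1 i.2)) <= e'].
  apply: filter_forall => i.
  have := ultra_cvg_derive (h := delta_mx i.1 i.2) Uz.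
  move=> /cvgrPdist_lt/(_ _ (divr_gt0 e'0 (ltr0Sn R (2 ^ r)))).
  apply: filterS => k /= kd; rewrite lenB; apply: le_trans (len_le_norm _) _.
  by rewrite mulrC -ler_pdivlMr// ltW.
exists ([set y | sumlen (y - z) < Num.min eta eta'],
  [set k | (forall y, sumlen (y - z) < eta -> [/\ len (u k y - u k z) <= e / 3,
      forall h, len ('d (u k) y h - 'd (u k) z h) <= e / 3 * sumlen h &
      len (u k y - u k z - 'd (u k) z (y - z)) <= e / 3 * sumlen (y - z)]) /\
    (len (u k z - l z) <= e / 3 /\ forall i : 'I_n * 'I_(2 ^ r),
    len ('d (u k) z (delta_mx i.1 i.2) - T z (delta_mx i.1 i.2)) <= e')]).
  split; first by apply: near_sumlen; rewrite lt_min eta0.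
  exact: filterI Geta (filterI G1 G2).
case=> y k /= [+ [Gk [Gk1 Gk2]]]; rewrite lt_min => /andP[ye ye'].
have [k1 k2 _] := Gk y ye; have [l1 l2 _] := etaP y ye'.
have Uy := etaU y ye.
have [_ dl] := limit_differentiable Uy.
split.
  have := len_chain Gk1 k1; rewrite lenB in l1 => H.
  by have := len_chain l1 H; lra.
move=> h.
apply: (eq_ind_r (fun v => is_true (len ('d (u k) y h - v) <= e * sumlen h)) _ (dl h)).
have k3 : len ('d (u k) z h - T z h) <= e / 3 * sumlen h.
  have Tl a h1 h2 := @ultra_derive_lin z a h1 h2 Uz.
  move: Gk2 Tl; generalize ('d (u k) z) (T z) => S S' Sd S'l.
  apply: le_trans (_ : e' * N * sumlen h <= _).
    apply: (@linear_delta_le (fun h => S h - S' h)); first exact: ltW.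
      move=> a h1 h2; rewrite S'l linearP.
      by apply/rowP => i; rewrite !mxE; ring.
    by move=> i j; exact: (Sd (i, j)).
  rewrite ler_wpM2r ?sumlen_ge0// /e' mulrAC ler_pdivrMr ?ltr_wpDl//.
  by rewrite ler_wpM2l ?(ltW e3)// lerDl.
have l3 : len (T z h - T y h) <= e / 3 * sumlen h by rewrite lenB; exact: l2.
apply: le_trans (len_chain l3 (len_chain k3 (k2 h))) _.
by rewrite le_eqVlt; apply/orP; left; apply/eqP; field.
Qed.

Lemma bounded_case : exists l' : V -> K,
  (forall z, U z -> differentiable l' z) /\
  forall W : set V, compact W -> W `<=` U -> forall e, 0 < e ->
    G [set k | forall y, W y -> len (u k y - l' y) <= e /\
      forall h, len ('d (u k) y h - 'd l' y h) <= e * sumlen h].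
Proof.
exists l; split; first by move=> z /limit_differentiable[].
move=> W /compact_near_coveringP cW WU e e0.
apply: (cW _ G (fun k y => len (u k y - l y) <= e /\
    forall h, len ('d (u k) y h - 'd l y h) <= e * sumlen h)).
by move=> z Wz; apply: limit_locally_uniform => //; exact: WU.
Qed.

End BoundedCase.

End Covering.

(** * Sequences tending to infinity *)

Section InfiniteLimit.
Variables (R : realType) (r n : nat).
Local Notation V := (cdspace R r n).
Local Notation K := (cdalg R r).

(** Of the three factors [3 ^+ n], one bounds [f] from above in the increment and two bound it from
    below at the two points of a difference quotient of the inverse; 34 is [2 + 32] from
    [increment_le]. *)
Lemma inverse_local_le (U : set V) (f : V -> K) (z : V) (d : R) : 0 < d ->
  (forall y, sumlen (y - z) < 4 * d -> U y) -> slice_bounded U f ->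
  (forall y, U y -> f y != 0) -> forall y, sumlen (y - z) <= d / 4 ->
  len (cdinv (f y)) <= 3 ^+ n / len (f z) /\
  forall h, len ('d (fun x => cdinv (f x)) y h) <=
    34 * (3 ^+ n) ^+ 3 / (d * len (f z)) * sumlen h.
Proof.
move=> d0 dU fU f0 y yd; set c : R := 3 ^+ n.
have Uz : U z by apply: dU; rewrite subrr sumlen0 mulr_gt0.
have Lz : 0 < len (f z) by apply: len_gt0; exact: f0.
have low x : sumlen (x - z) <= d / 2 -> 0 < len (f x) /\ (len (f x))^-1 <= c / len (f z).
  move=> xd; have Ux : U x by apply: dU; lra.
  have Lx : 0 < len (f x) by apply: len_gt0; exact: f0.
  split=> //; rewrite ler_pdivlMr// ler_pdivrMl// mulrC.
  exact: (ball_harnack_inv d0 dU fU xd).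
have yd2 : sumlen (y - z) <= d / 2 by lra.
have Uy : U y by apply: dU; lra.
have [Ly lowy] := low y yd2.
split=> [|h]; first by rewrite len_cdinv.
have N0 := sumlen_ge0 h; have N1 : 0 < sumlen h + 1 by lra.
(* For such [t] the vector [t *: h] has size at most [d / 4]; the summand 1 covers [h = 0]. *)
apply: (@diff_le _ _ _ _ _ _ _ (d / (4 * (sumlen h + 1)))).
- by rewrite divr_gt0// mulr_gt0.
- apply: (@differentiable_comp _ _ _ _ f (@cdinv R r)); first exact: fU.1.
  by apply: differentiable_cdinv; exact: f0.
move=> t td.
have th : sumlen (t *: h) = `|t| * sumlen h.
  by rewrite /sumlen mulr_sumr; apply: eq_bigr => j _; rewrite linearZ/= lenZ.
have thd : sumlen (t *: h) <= d / 4.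
  rewrite th; move: td; rewrite ltr_pdivlMr ?mulr_gt0// => td.
  have : 0 <= `|t| by []; lra.
have ythd : sumlen (y + t *: h - z) <= d / 2.
  by rewrite addrAC; apply: le_trans (sumlenD _ _) _; lra.
have [Lyt lowyt] := low _ ythd.
have Uyt : U (y + t *: h) by apply: dU; lra.
rewrite len_cdinvB; [|exact: f0|exact: f0].
have ballU2 x : sumlen (x - z) <= 2 * d -> U x by move=> xd; apply: dU; lra.
have fC x : sumlen (x - z) <= d -> len (f x) <= c * len (f z).
  by move=> xd; exact: (ball_harnack d0 dU fU).
have thd2 : sumlen (t *: h) <= d / 2 by lra.
have inc := increment_le fU d0 ballU2 fC yd2 thd2.
rewrite invfM mulrA.
apply: le_trans (_ : (2 * (c * len (f z)) / d + 32 * (c * len (f z)) / d ^+ 2 * d)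
  * sumlen (t *: h) * (c / len (f z)) * (c / len (f z)) <= _).
  apply: ler_pM => //; rewrite ?invr_ge0 ?mulr_ge0 ?len_ge0 ?invr_ge0 ?len_ge0//.
  by apply: ler_pM => //; rewrite ?invr_ge0 ?len_ge0.
rewrite th le_eqVlt; apply/orP; left; apply/eqP; field.
by rewrite !gt_eqF.
Qed.

Variables (U : set V) (u : nat -> V -> K) (G : set_system nat).
Hypothesis openU : open U.
Hypothesis UG : UltraFilter G.
Hypothesis uU : forall k, slice_bounded U (u k).
Hypothesis unb : forall z, U z -> ~ ultra_bounded u G z.
Hypothesis u_neq0 : forall k z, U z -> u k z != 0.

Lemma ultra_large z M : U z -> G [set k | M < len (u k z)].
Proof.
move=> Uz; have [H|] := in_ultra_setVsetC [set k | len (u k z) <= M] UG.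
  by case: (unb Uz); exists M.
by apply: filterS => k /= /negP; rewrite -ltNge.
Qed.

Lemma inverse_locally_uniform z e : U z -> 0 < e ->
  \forall y \near z & k \near G, len (cdinv (u k y)) <= e /\
    forall h, len ('d (fun x => cdinv (u k x)) y h) <= e * sumlen h.
Proof.
move=> Uz e0; have [d d0 dU] := open_sumlen_ball openU Uz.
pose c : R := 3 ^+ n.
exists ([set y | sumlen (y - z) < d / 4],
  [set k | Num.max (c / e) (34 * c ^+ 3 / (d * e)) < len (u k z)]).
  by split; [apply: near_sumlen; rewrite divr_gt0 | exact: ultra_large].
case=> y k /= [yd]; rewrite gt_max => /andP[ce de].
have Lz : 0 < len (u k z) by apply: len_gt0; exact: u_neq0.
have [H1 H2] := inverse_local_le d0 dU (uU k) (@u_neq0 k) (ltW yd).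
split.
  apply: le_trans H1 _; rewrite ler_pdivrMr// mulrC -ler_pdivrMr//; exact: ltW.
move=> h; apply: le_trans (H2 h) _; rewrite ler_wpM2r ?sumlen_ge0//.
rewrite ler_pdivrMr ?mulr_gt0//; move: de; rewrite ltr_pdivrMr ?mulr_gt0//.
have -> : e * (d * len (u k z)) = len (u k z) * (d * e) by ring.
exact: ltW.
Qed.

Lemma unbounded_case (W : set V) e : compact W -> W `<=` U -> 0 < e ->
  G [set k | forall y, W y -> len (cdinv (u k y)) <= e /\
    forall h, len ('d (fun x => cdinv (u k x)) y h) <= e * sumlen h].
Proof.
move=> /compact_near_coveringP cW WU e0.
apply: (cW _ G (fun k y => len (cdinv (u k y)) <= e /\
    forall h, len ('d (fun x => cdinv (u k x)) y h) <= e * sumlen h)).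
by move=> z Wz; apply: inverse_locally_uniform => //; exact: WU.
Qed.

End InfiniteLimit.

(** * Compactness and extraction of subsequences *)

Lemma matrix_bounded_closed_compact (R : realType) m n (A : set 'M[R]_(m, n)) :
  bounded_set A -> closed A -> compact A.
Proof.
move=> bA cA; pose g (v : 'rV[R]_(m * n)) : 'M[R]_(m, n) := vec_mx v.
have gnorm v : `|g v| = `|v|.
  apply/eqP; rewrite eq_le; apply/andP; split.
    rewrite [leLHS]/Num.norm/= mx_normrE; apply/bigmax_leP; split=> // -[i j] _ /=.
    by rewrite mxE; exact: coord_le_norm.
  rewrite [leLHS]/Num.norm/= mx_normrE; apply/bigmax_leP; split=> // -[i k] _ /=.
  rewrite ord1; case/mxvec_indexP: k => {}i j.
  by have := coord_le_norm (g v) i j; rewrite mxE.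
have cg : continuous g.
  apply: bounded_linear_continuous; apply/linear_boundedP.
  exists 1; split; first exact: num_real.
  by move=> M M1 v; rewrite gnorm -[X in X <= _]mul1r ler_wpM2r// ltW.
have -> : A = g @` (g @^-1` A).
  apply/seteqP; split=> [M AM|_ [v Av <-]//].
  by exists (mxvec M); rewrite /g /= ?mxvecK.
apply: continuous_compact; first exact: continuous_subspaceT.
apply: bounded_closed_compact.
  case: bA => M [Mr bM]; exists M; split=> // s Ms v Av.
  by have := bM s Ms (g v) Av; rewrite /= gnorm.
by apply: preimage_closed cA => v _; exact: cg.
Qed.

(** [G] contains all tails, so each of its sets has elements beyond any index; the [p]-th index is
    chosen beyond the previous one and inside the [p]-th set. *)
Lemma filter_subsequence (G : set_system nat) (P : nat -> nat -> Prop) :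
  ProperFilter G -> \oo `<=` G -> (forall p, G [set k | P p k]) ->
  exists2 s : nat -> nat, {homo s : i k / (i < k)%N} & forall p, P p (s p).
Proof.
move=> PG ooG GP.
have ex p N : exists k, (N < k)%N /\ P p k.
  have GN : G [set k | (N < k)%N] by apply: ooG; exists N.+1.
  by have [k [kN kP]] := filter_ex (filterI GN (GP p)); exists k.
have [sel selP] := choice (fun pN : nat * nat => ex pN.1 pN.2).
pose s := fix s p := if p is p'.+1 then sel (p, s p') else sel (0%N, 0%N).
exists s => [|[|p]].
- apply: homo_ltn; first exact: ltn_trans.
  by move=> p; have [] := selP (p.+1, s p).
- by have [] := selP (0%N, 0%N).
- by have [] := selP (p.+1, s p).
Qed.

Section RhoDistance.
Variables (R : realType) (r n : nat).
Hypothesis n0 : (0 < n)%N.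
Local Notation V := (cdspace R r n).
Local Notation K := (cdalg R r).

Lemma cdnorm_sumlen (h : V) : cdnorm h = 1 -> sumlen h <= n%:R.
Proof.
move=> h1; apply: le_trans (_ : \sum_(j < n) (1 : R) <= _).
  apply: ler_sum => j _; rewrite -h1 -(ger0_norm (len_ge0 _)) -sqrtr_sqr.
  apply: ler_wsqrtr; rewrite (bigD1 j)//= cdabsE lerDl.
  by apply: sumr_ge0 => i _; exact: sqr_ge0.
by rewrite sumr_const card_ord.
Qed.

(** Without unit vectors the inner supremum of [rho_dist] would be [-oo]; hence the condition
    [0 < n]. *)
Lemma cdnorm_unit_exists : exists h : V, cdnorm h = 1.
Proof.
exists (setrow0 (Ordinal n0) (cdgen R r 0)).
rewrite /cdnorm (bigD1 (Ordinal n0))//= big1 => [|j j0].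
  by rewrite row_setrow0 eqxx cdabsE len_sqr dot_cdgen0 addr0 sqrtr1.
by rewrite row_setrow0 (negPf j0) cdabsE len0 expr0n.
Qed.

Lemma rho_dist_ge0 (W : set V) (f g : V -> K) : W !=set0 -> (0 <= rho_dist W f g)%E.
Proof.
move=> [z Wz]; apply: le_trans (ereal_sup_ubound _); last by exists z.
have [h h1] := cdnorm_unit_exists.
rewrite adde_ge0//; first by rewrite lee_fin cdabsE len_ge0.
apply: le_trans (ereal_sup_ubound _); last by exists h.
by rewrite lee_fin cdabsE len_ge0.
Qed.

Lemma rho_dist_le (W : set V) (f g : V -> K) (e : R) : 0 <= e ->
  (forall z, W z -> len (f z - g z) <= e /\
    forall h, len ('d f z h - 'd g z h) <= e * sumlen h) ->
  (rho_dist W f g <= (e * n.+1%:R)%:E)%E.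
Proof.
move=> e0 fg; apply: ge_ereal_sup => _ [z Wz <-].
have [fgz dfg] := fg z Wz.
have -> : e * n.+1%:R = e + e * n%:R by rewrite -natr1 mulrDr mulr1 addrC.
rewrite EFinD; apply: leeD; first by rewrite lee_fin cdabsE.
apply: ge_ereal_sup => _ [h /= h1 <-]; rewrite lee_fin cdabsE.
apply: le_trans (dfg h) _; rewrite ler_wpM2l//; exact: cdnorm_sumlen.
Qed.

Lemma rho_subsequence (W : set V) (v : nat -> V -> K) (l : V -> K)
    (G : set_system nat) : ProperFilter G -> \oo `<=` G -> W !=set0 ->
  (forall e : R, 0 < e -> G [set k | forall z, W z -> len (v k z - l z) <= e /\
    forall h, len ('d (v k) z h - 'd l z h) <= e * sumlen h]) ->
  exists2 s : nat -> nat, {homo s : i k / (i < k)%N} &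
    rho_dist W (v (s k)) l @[k --> \oo] --> 0%E.
Proof.
move=> PG ooG W0 Ge.
have GP p : G [set k | (rho_dist W (v k) l <= (harmonic p)%:E)%E].
  (* Dividing by [n.+1] cancels the factor of [rho_dist_le]. *)
  have e0 : 0 < (harmonic p : R) / n.+1%:R by rewrite divr_gt0// harmonic_gt0.
  apply: filterS (Ge _ e0) => k /= /(rho_dist_le (ltW e0)).
  by rewrite divfK// pnatr_eq0.
have [s sh sP] := filter_subsequence PG ooG GP.
exists s => //; apply: (@squeeze_cvge _ _ _ _ (fun=> 0%E) _ (fun p => (harmonic p)%:E)).
- by apply: nearW => p; rewrite sP rho_dist_ge0.
- exact: cvg_cst.
- by apply: cvg_EFin; [exact: nearW | exact: cvg_harmonic].
Qed.

End RhoDistance.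

Theorem theorem49 (R : realType) (r n : nat) (hr : r = 2%N \/ r = 3%N)
    (hn : (0 < n)%N) (U : set (cdspace R r n))
    (openU : open U) (connU : connected U) (domU : domain_condition U)
    (F : set (cdspace R r n -> cdalg R r))
    (holF : forall f, F f -> holomorphic U f)
    (primF : forall f, F f -> exists g : cdspace R r n -> cdalg R r,
       [/\ holomorphic U g,
           forall z, U z -> exists2 g' : cdspace R r n -> cdalg R r,
             superderivative g z g' & f z = g' (cdones R r n),
           pseudoconformal_or_zero U f &
           pseudoconformal_or_zero U g])
    (omitF : forall f, F f -> forall z, U z ->
       f z <> 0 /\
       forall k : nat, (k <= 2 ^ r - 2)%N -> f z <> cdgen R r k) :
  normal_family U F.
Proof.
have pcF f : F f -> pseudoconformal_or_zero U f by move=> /primF[g []].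
split=> // u V Fu V0 closedV boundedV _ VU.
have r3 : (r <= 3)%N by case: hr => ->.
have r1 : (1 < r)%N by case: hr => ->.
have u0 k z : U z -> u k z <> 0 by move=> Uz; have [] := omitF _ (Fu k) z Uz.
have uU k : slice_bounded U (u k).
  have df z : U z -> differentiable (u k) z by move=> Uz; have [] := holF _ (Fu k) z Uz.
  split=> // j z rho rho0 zU.
  have Uz : U z by have := zU 0; rewrite len0 setrow0_0 addr0; apply.
  have orth (i : 'I_n) y h h' : U y -> dot h h' = 0 ->
      dot ('D_(setrow0 i h) (u k) y) ('D_(setrow0 i h') (u k) y) = 0.
    exact: (pseudoconformal_orthogonal r3 i (pcF _ (Fu k))).
  have [D1 D2] := row_est r1 r3 openU (holomorphic_analytic (holF _ (Fu k)))
    orth (j := j) rho0 zU (u0 k).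
  split=> [a|a ad]; first by rewrite -(deriveE _ (df z Uz)).
  by rewrite -(deriveE _ (df z Uz)); exact: D2.
have compactV := matrix_bounded_closed_compact boundedV closedV.
(* An ultrafilter containing all tails: any sequence bounded at a point has a limit along it there,
   and its sets still yield genuine subsequences. *)
have [G [UG ooG]] := ultraFilterLemma (eventually_filter).
have PG : ProperFilter G by exact: ultra_proper.
have [ub|unb] := ultra_bounded_dichotomy openU UG uU connU.
  have [l [dl Gl]] := bounded_case openU UG uU ub.
  have [s sh sl] := rho_subsequence hn PG ooG V0 (Gl V compactV VU).
  exists s => //; left; exists l => // z Vz; exact: dl (VU z Vz).
(* No point is bounded along [G], so the inverses tend to 0 and the limit is the infinite
   constant. *)
have u0' k z : U z -> u k z != 0 by move=> Uz; apply/eqP; exact: u0.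
have G0 e : 0 < e -> G [set k | forall z, V z -> len (cdinv (u k z) - 0) <= e /\
    forall h, len ('d (fun x => cdinv (u k x)) z h - 'd (cst (0 : cdalg R r)) z h)
      <= e * sumlen h].
  move=> e0; have := unbounded_case openU UG uU unb u0' compactV VU e0.
  apply: filterS => k /= Hk z Vz; have [H1 H2] := Hk z Vz.
  split=> [|h]; first by rewrite subr0.
  have E : 'd (cst (0 : cdalg R r)) z h = 0 by rewrite diff_cst.
  apply: (eq_ind_r (fun v => is_true
    (len ('d (fun x => cdinv (u k x)) z h - v) <= e * sumlen h)) _ E).
  by rewrite subr0; exact: H2.
have [s sh sl] := rho_subsequence hn PG ooG V0 G0.
exists s => //; right; split; last exact: sl.
by apply: nearW => k z Vz; apply: u0; exact: VU.
Qed.
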